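(* Let $f_0$ be an isolated plane curve singularity that is quasihomogeneous and of the form $$f_0(x,y)=x^ky^l\bigl(x^p+\ldots+\gamma_{i,j}x^iy^j+\ldots+y^q\bigr),\qquad k,l\in\{0,1\},\ p\le q,\ k+l+p\ge 2 .$$ Define $d$ and $w_{f_0}$ by: - if $p=q$, then $d=k+l+p$ and $w_{f_0}=0$; - if $p\neq q$ and $p\mid q$, then $d=k+p$ and $w_{f_0}=1$; - if $p\neq q$ and $p\nmid q$, then $d=\mathrm{GCD}(p,q)$ and $w_{f_0}=2$. Then the jump of the Milnor number of $f_0$ for linear deformations is $$\lambda^{lin}(f_0)=\begin{cases}1,& d=1,\\ 1,& d=2,\ w_{f_0}=0,\\ w_{f_0},& d=2,\ w_{f_0}\neq 0,\\ d-2+w_{f_0},& d\ge 3.\end{cases}$$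
   Context: An (isolated plane curve) singularity is a holomorphic germ $f_0:(\mathbb{C}^2,0)\to(\mathbb{C},0)$ with an isolated critical point at $0$. For a germ $f$ at $0$, $\mu(f)=\dim_{\mathbb{C}}\mathcal{O}_2/(\partial f/\partial x,\partial f/\partial y)$ is the Milnor number at $0$, where $\mathcal{O}_2$ is the ring of holomorphic germs at $0\in\mathbb{C}^2$ (so $\mu(f)=0$ if $f$ is smooth at $0$). A linear deformation of $f_0$ is a family $f_s=f_0+sg$, $s\in(\mathbb{C},0)$, where $g$ is a holomorphic function in a neighbourhood of $0\in\mathbb{C}^2$ with $g(0)=0$. For all sufficiently small $s\neq 0$ the number $\mu(f_s)$ is constant and at most $\mu(f_0)$; the jump of the deformation $(f_s)$ is $\mu(f_0)-\mu(f_s)$ for small $s\ne0$. $\lambda^{lin}(f_0)$ denotes the smallest non-zero value among the jumps of all linear deformations of $f_0$. A singularity $f_0=\sum a_{i,j}x^iy^j$ is quasihomogeneous if there are positive integers $w_x,w_y,W$ such that $iw_x+jw_y=W$ whenever $a_{i,j}\neq 0$. In the displayed form, $p,q$ are nonnegative integers, the dots stand for finitely many further monomials $\gamma_{i,j}x^iy^j$ with $\gamma_{i,j}\in\mathbb{C}$, and every monomial occurring in $f_0$ with nonzero coefficient (including $x^{k+p}y^l$ and $x^ky^{l+q}$) has the same weighted degree $W$. If $p=0$ then necessarily $q=0$, $k=l=1$, and $f_0=xy$ (the bracket being a nonzero constant normalized to $1$). *)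

(* Defs.v *)
From HB Require Import structures.
From mathcomp Require Import all_boot all_order all_algebra.
From mathcomp Require Export complex.
From mathcomp Require Import all_classical all_reals all_analysis.
Set Implicit Arguments.
Unset Strict Implicit.
Unset Printing Implicit Defensive.
Import Order.TTheory GRing.Theory Num.Theory numFieldNormedType.Exports.
Local Open Scope classical_set_scope.
Local Open Scope ring_scope.

(* The topology, norm and derivatives used below are those that the library
   attaches to an abstract [numClosedFieldType]; [R[i]] itself carries none, so
   the complex numbers are always referred to under this packed name. *)
Definition complex_field (R : realType) : numClosedFieldType := R[i].

Section Germs.
Variable R : realType.
Local Notation C := (complex_field R).
Implicit Types (f g h : C * C -> C) (a : nat -> nat -> C).

Definition power_sum a (z : C * C) (n : nat) : C :=
  \sum_(i < n) \sum_(j < n) a i j * z.1 ^+ i * z.2 ^+ j.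

Definition abs_power_sum a (z : C * C) (n : nat) : C :=
  \sum_(i < n) \sum_(j < n) `|a i j * z.1 ^+ i * z.2 ^+ j|.

(* Germs at the origin are represented by total functions, of which only the
   values near 0 matter.  Holomorphy is expandability, around 0, in an
   absolutely convergent power series in two variables. *)
Definition holomorphic_germ f : Prop :=
  exists a, \forall z \near (0 : C * C),
    cvgn (abs_power_sum a z) /\ power_sum a z @ \oo --> f z.

Definition partial_x f (z : C * C) : C := 'D_(1 : C, 0 : C) f z.
Definition partial_y f (z : C * C) : C := 'D_(0 : C, 1 : C) f z.

Definition critical_point f (z : C * C) : Prop :=
  partial_x f z = 0 /\ partial_y f z = 0.

Definition isolated_singularity f : Prop :=
  [/\ holomorphic_germ f, f 0 = 0, critical_point f 0 &
      \forall z \near (0 : C * C)^', ~ critical_point f z].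

Definition jacobian_ideal f h : Prop :=
  exists u v, [/\ holomorphic_germ u, holomorphic_germ v &
    \forall z \near (0 : C * C),
      h z = u z * partial_x f z + v z * partial_y f z].

(* [milnor_number f n]: the quotient of the ring of holomorphic germs by the
   Jacobian ideal of [f] has a basis over [C] formed by the classes of [n]
   germs, that is, it is of (finite) dimension [n]. *)
Definition milnor_number f (n : nat) : Prop :=
  exists b : 'I_n -> C * C -> C,
    (forall i, holomorphic_germ (b i)) /\
    forall h, holomorphic_germ h ->
      exists! c : 'rV[C]_n,
        jacobian_ideal f (fun z => h z - \sum_(i < n) c 0 i * b i z).

Definition linear_deformation f g (s : C) : C * C -> C :=
  fun z => f z + s * g z.

(* The jump is natural-number valued, since the Milnor number does not increase
   under a small deformation. *)
Definition deformation_jump f g (j : nat) : Prop :=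
  exists m n, [/\ milnor_number f m,
    \forall s \near (0 : C)^', milnor_number (linear_deformation f g s) n &
    (m = n + j)%N].

Definition is_linear_jump f (j : nat) : Prop :=
  exists g, [/\ holomorphic_germ g, g 0 = 0 & deformation_jump f g j].

Definition lambda_lin f (m : nat) : Prop :=
  [/\ m != 0%N, is_linear_jump f m &
      forall j, is_linear_jump f j -> j != 0%N -> (m <= j)%N].

(* In [{poly {poly C}}] the outer indeterminate is x and the inner one is y, so
   the coefficient of x^i y^j in [F] is [F`_i`_j]. *)
Definition poly_germ (F : {poly {poly C}}) : C * C -> C :=
  fun z => F.[(z.1)%:P].[z.2].

Definition quasihomogeneous (F : {poly {poly C}}) : Prop :=
  exists wx wy W : nat, [/\ (0 < wx)%N, (0 < wy)%N, (0 < W)%N &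
    forall i j, F`_i`_j != 0 -> (i * wx + j * wy = W)%N].

End Germs.

Definition num_d (k l p q : nat) : nat :=
  if p == q then (k + l + p)%N
  else if (p %| q)%N then (k + p)%N
  else gcdn p q.

Definition num_w (p q : nat) : nat :=
  if p == q then 0%N else if (p %| q)%N then 1%N else 2%N.

(* Only meant for [0 < d]. *)
Definition jump_formula (d w : nat) : nat :=
  if d == 1%N then 1%N
  else if d == 2%N then (if w == 0%N then 1%N else w)
  else (d - 2 + w)%N.

(* Main.v *)
(* Write p = d p', q = d q' with p', q' coprime, weigh x by q' and y by p', let W
   be the weight of [F] and c the number [jump_bound]; the answer is max(1, c).

   Lower bound: let G be the part of lowest weight e of the perturbation g. If
   e >= W, the Koszul relation between the partials of [F] shows that the Milnor
   number does not drop. If e < W, rescaling the variables and semicontinuity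
   replace g by G. The whole Jacobian algebra of F + G still has dimension
   m = mu(F), and the Milnor number at the origin is smaller by at least the
   dimension of the span of the classes of the polynomials of weight t, for large
   t. A homogeneous P in the Jacobian
   ideal of F + G satisfies G P = D S, where D is the Jacobian determinant of F
   and G: in the chart y = 1, Euler's relations turn this into a comparison of
   orders of vanishing at the roots of G, because F has simple roots. So these P
   form a space of dimension at most that of the S, and at least c classes of
   weight t survive.

   Existence: after a linear change of coordinates if p = q, add to F a multiple
   of a monomial of weight W - 1. The ideal then contains a homogeneous Q times
   all monomials of large degree, so that c monomials span each large weight, and
   Euler's relation moves these classes to the next weight; hence those of all
   large weights span together at most c dimensions, and no more is lost.

   Hadamard's lemma and Nakayama's lemma identify the Milnor number of a germ
   with the codimension of the Jacobian ideal of a Taylor polynomial modulo a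
   high power of the maximal ideal. *)
From HB Require Import structures.
Require Import Defs.
From mathcomp Require Import all_boot all_order all_algebra polyXY.
From mathcomp Require Import zify ring.
From mathcomp Require Import boolp.
Set Implicit Arguments. Unset Strict Implicit. Unset Printing Implicit Defensive.
Import Order.TTheory GRing.Theory Num.Theory.
Local Open Scope ring_scope.

(** * Codimension of a subspace *)

(** In [G P = D S] the weight of [S] is [t - (W - q' - p')]: the weight [e] cancels, and one
    constant bounds all jumps. For [t] a multiple of [p' q'], the monomials of this weight are [d]
    fewer than those of weight [t], up to a correction when a weight is 1; the difference is [c]. It
    is 0 only at nodes, where a nonzero jump is at least 1: whence the maximum. For existence, [Q]
    comes from the vector field [b x d/dx - a y d/dy], which kills the added monomial [x^a y^b]; if
    [p' = 1] that monomial is a power of [y] and [Q] a derivative in [x]. The weight [W - 1] makes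
    Euler's relation advance by exactly 1, so that a single chain passes through all large weights.
    When [e >= W], the wanted inequality is opposite to the semicontinuity of the rank. It is
    obtained from the syzygies instead: finitely many pairs span all pairs together with the Koszul
    pairs, and this persists under perturbation. No limit is taken in the parameter: a generic small
    value is a nonroot of a polynomial that does not vanish at 0, and the rest is linear algebra
    modulo a power of the maximal ideal. *)

Section QuotientDimension.
Variables (K : fieldType) (V : lmodType K).
Implicit Types (J : V -> Prop) (I L : finType).

Definition subspace J := J 0 /\ forall (c : K) u v, J u -> J v -> J (c *: u + v).

(** Families come with a set of indices, so that a subfamily is extracted without reindexing. *)
Definition indep J I (A : {set I}) (b : I -> V) :=
  forall c : I -> K, J (\sum_(i in A) c i *: b i) -> forall i, i \in A -> c i = 0.

Definition in_span J I (A : {set I}) (b : I -> V) (h : V) :=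
  exists c : I -> K, J (h - \sum_(i in A) c i *: b i).

(** A relation, since finiteness of the quotient is part of what has to be proved; [codim_uniq]
    makes the number well defined. *)
Definition codim J (n : nat) :=
  exists b : 'I_n -> V, indep J setT b /\ forall h, in_span J setT b h.

Lemma sum_setT I (F : I -> V) : \sum_(i in setT) F i = \sum_i F i.
Proof. by apply: eq_bigl => i; rewrite inE. Qed.

Section Subspace.
Variable J : V -> Prop.
Hypothesis sJ : subspace J.

Lemma subspace0 : J 0. Proof. by case: sJ. Qed.
Lemma subspaceZ c u : J u -> J (c *: u).
Proof. by move=> Ju; rewrite -[_ *: _]addr0; apply: sJ.2 => //; exact: sJ.1. Qed.
Lemma subspaceD u v : J u -> J v -> J (u + v).
Proof. by move=> Ju Jv; rewrite -[u]scale1r; exact: sJ.2. Qed.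
Lemma subspaceN u : J u -> J (- u).
Proof. by move=> Ju; rewrite -scaleN1r; exact: subspaceZ. Qed.
Lemma subspaceB u v : J u -> J v -> J (u - v).
Proof. by move=> Ju Jv; apply: subspaceD => //; exact: subspaceN. Qed.
Lemma subspace_sum I (P : pred I) (F : I -> V) :
  (forall i, P i -> J (F i)) -> J (\sum_(i | P i) F i).
Proof. by move=> JF; elim/big_ind: _ => //; [exact: subspace0|exact: subspaceD]. Qed.
Lemma subspace_eq u v : J (u - v) -> J v -> J u.
Proof. by move=> Juv Jv; rewrite -(subrK v u); exact: subspaceD. Qed.

Lemma in_spanD I (A : {set I}) b u v :
  in_span J A b u -> in_span J A b v -> in_span J A b (u + v).
Proof.
move=> [c Jc] [d Jd]; exists (fun i => c i + d i).
rewrite (eq_bigr (fun i => c i *: b i + d i *: b i)); last by move=> i _; rewrite scalerDl.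
by rewrite big_split opprD addrACA; exact: subspaceD.
Qed.

Lemma in_spanZ I (A : {set I}) b a u : in_span J A b u -> in_span J A b (a *: u).
Proof.
move=> [c Jc]; exists (fun i => a * c i).
rewrite (eq_bigr (fun i => a *: (c i *: b i))); last by move=> i _; rewrite scalerA.
by rewrite -scaler_sumr -scalerBr; exact: subspaceZ.
Qed.

Lemma in_span_sub I (A : {set I}) b u : J u -> in_span J A b u.
Proof.
by exists (fun=> 0); rewrite big1 ?subr0// => i _; rewrite scale0r.
Qed.

Lemma in_span_sum I L (A : {set I}) b (P : pred L) (F : L -> V) :
  (forall i, P i -> in_span J A b (F i)) -> in_span J A b (\sum_(i | P i) F i).
Proof.
move=> H; elim/big_ind: _ => //; last exact: in_spanD.
by apply: in_span_sub; exact: subspace0.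
Qed.

Lemma in_span_mem I (A : {set I}) b i : i \in A -> in_span J A b (b i).
Proof.
move=> iA; exists (fun j => (j == i)%:R).
rewrite (bigD1 i)//= eqxx scale1r big1 ?addr0 ?subrr; first exact: subspace0.
by move=> j /andP[_ /negPf->]; rewrite scale0r.
Qed.

Lemma in_span_eq I (A : {set I}) b u v :
  J (u - v) -> in_span J A b v -> in_span J A b u.
Proof. by move=> Ju Hv; rewrite -(subrK v u); apply: in_spanD => //; exact: in_span_sub. Qed.

End Subspace.

Lemma in_span_trans J J' I L (A : {set I}) (B : {set L}) b b' h :
  subspace J' -> (forall u, J u -> J' u) ->
  in_span J A b h -> (forall i, i \in A -> in_span J' B b' (b i)) -> in_span J' B b' h.
Proof.
move=> sJ' JJ' [c Jc] H.
apply: (in_span_eq sJ' (JJ' _ Jc)); apply: in_span_sum => // i iA.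
by apply: in_spanZ => //; exact: H.
Qed.

(** A matrix with more rows than columns has a nonzero left kernel, here transported to families
    indexed by sets. *)
Lemma wide_kernel I L (A : {set I}) (B : {set L}) (M : I -> L -> K) :
  (#|B| < #|A|)%N ->
  exists2 c : I -> K, (exists2 i, i \in A & c i != 0) &
    forall l, l \in B -> \sum_(i in A) c i * M i l = 0.
Proof.
move=> ltBA.
pose N := \matrix_(i < #|A|, l < #|B|) M (enum_val i) (enum_val l).
have : kermx N != 0.
  rewrite -mxrank_eq0 mxrank_ker subn_eq0 -ltnNge.
  exact: leq_ltn_trans (rank_leq_col _) ltBA.
case/rowV0Pn => v /sub_kermxP vN v0.
have [j vj] : exists j, v 0 j != 0.
  apply/existsP; apply: contraNT v0; rewrite negb_exists => /forallP H.
  by apply/eqP/rowP => j; rewrite mxE; apply/eqP; rewrite -[_ == _]negbK.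
have A0 : enum_val j \in A by exact: enum_valP.
exists (fun i => v 0 (enum_rank_in A0 i)).
  by exists (enum_val j) => //; rewrite enum_valK_in.
move=> l lB; have := congr1 (fun X : 'rV_ _ => X 0 (enum_rank_in lB l)) vN.
rewrite !mxE => {2}<-; rewrite big_enum_val/=; apply: eq_bigr => i _.
by rewrite !mxE enum_valK_in enum_rankK_in.
Qed.

Lemma steinitz J I L (A : {set I}) (B : {set L}) u b :
  subspace J -> indep J A u -> (forall i, i \in A -> in_span J B b (u i)) ->
  (#|A| <= #|B|)%N.
Proof.
move=> sJ iu H; rewrite leqNgt; apply/negP => ltBA.
have /choice [M HM] : forall i, exists c : L -> K,
    i \in A -> J (u i - \sum_(l in B) c l *: b l).
  by move=> i; have [iA|_] := boolP (i \in A);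
    [have [c ?] := H i iA; exists c|exists (fun=> 0)].
have [c [i iA ci] Hc] := wide_kernel M ltBA.
move/eqP: ci; apply; apply: iu iA.
have -> : \sum_(i in A) c i *: u i =
    \sum_(i in A) c i *: (u i - \sum_(l in B) M i l *: b l).
  rewrite -[LHS]subr0 -[X in _ - X](_ : \sum_(i in A) c i *: (\sum_(l in B) M i l *: b l) = 0).
    by rewrite -sumrB; apply: eq_bigr => j _; rewrite scalerBr.
  rewrite (eq_bigr (fun i => \sum_(l in B) (c i * M i l) *: b l)); last first.
    by move=> j _; rewrite scaler_sumr; apply: eq_bigr => l _; rewrite scalerA.
  rewrite exchange_big/= big1// => l lB.
  by rewrite -scaler_suml Hc// scale0r.
by apply: subspace_sum => // j jA; apply: subspaceZ => //; exact: HM.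
Qed.

Lemma maximal_indep J I (A : {set I}) b : subspace J ->
  exists S : {set I}, [/\ S \subset A, indep J S b & forall i, i \in A -> in_span J S b (b i)].
Proof.
move=> sJ.
pose P (S : {set I}) := (S \subset A) && `[< indep J S b >].
have P0 : P set0.
  by rewrite /P sub0set; apply/asboolP => c _ i; rewrite inE.
case: (arg_maxnP (fun S : {set I} => #|S|) P0) => S /andP[SA /asboolP iS] maxS.
exists S; split=> // i iA; have [iS'|iS'] := boolP (i \in S).
  exact: in_span_mem.
apply: contrapT => nspan.
suff : P (i |: S).
  by move=> /maxS /=; rewrite /geq /= cardsU1 iS' add1n ltnn.
rewrite /P subUset sub1set iA SA; apply/asboolP => c.
rewrite big_setU1//= => Jc.
have ci0 : c i = 0.
  apply/eqP; apply: contrapT => /negP ci; apply: nspan.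
  exists (fun j => - (c i)^-1 * c j).
  have -> : b i - \sum_(i0 in S) (- (c i)^-1 * c i0) *: b i0 =
     (c i)^-1 *: (c i *: b i + \sum_(i0 in S) c i0 *: b i0).
    rewrite scalerDr scalerA mulVf// scale1r scaler_sumr -sumrN; congr (_ + _).
    by apply: eq_bigr => j _; rewrite -scaleNr scalerA mulNr opprK.
  exact: subspaceZ.
move: Jc; rewrite ci0 scale0r add0r => Jc j; rewrite !inE => /orP[/eqP->//|jS].
exact: iS Jc _ jS.
Qed.

(* Elements of [J'] built from a family independent modulo a smaller [J]: the
   discrepancies in expressing it through a maximal part independent modulo [J']. *)
Lemma exchange J J' I b : subspace J -> subspace J' -> indep J setT b ->
  exists (S : {set I}) (c : I -> I -> K), indep J' S b /\
    let u k := b k - \sum_(j in S) c k j *: b j in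
    (forall k, J' (u k)) /\ indep J (~: S) u.
Proof.
move=> sJ sJ' ib; have [S [_ iS H]] := maximal_indep setT b sJ'.
have /choice [c Hc] i := H i (in_setT _).
exists S, c; split=> //; split=> // d.
pose e i := if i \in S then - \sum_(k in ~: S) d k * c k i else d i.
have -> : \sum_(i in ~: S) d i *: (b i - \sum_(j in S) c i j *: b j) =
   \sum_(i in setT) e i *: b i.
  rewrite [RHS](bigID (mem S))/= [RHS]addrC.
  rewrite (eq_bigr (fun i => d i *: b i - \sum_(j in S) (d i * c i j) *: b j)); last first.
    move=> i _; rewrite scalerBr scaler_sumr; congr (_ - _).
    by apply: eq_bigr => j _; rewrite scalerA.
  rewrite sumrB; congr (_ + _).
    apply: eq_big => [i|i]; first by rewrite !inE.
    by rewrite inE => /negPf iS'; rewrite /e iS'.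
  rewrite exchange_big/= -sumrN; apply: eq_big => [i|i iS'].
    by rewrite !inE.
  by rewrite /e iS' scaleNr scaler_suml.
by move=> Jd i iS'; have := ib _ Jd i (in_setT _); rewrite /e; move: iS'; rewrite inE => /negPf->.
Qed.

(** A maximal independent subfamily, reindexed. The last clause records that the basis vectors are
    members of the given family, so that bases of monomials can be obtained. *)
Lemma span_codim J I (A : {set I}) b : subspace J -> (forall h, in_span J A b h) ->
  exists n (b' : 'I_n -> V), [/\ (n <= #|A|)%N, indep J setT b',
    forall h, in_span J setT b' h & forall i, exists2 j, j \in A & b' i = b j].
Proof.
move=> sJ H; have [S [SA iS HS]] := maximal_indep A b sJ.
exists #|S|, (b \o enum_val); split.
- exact: subset_leq_card.
- move=> c Jc i _.
  have [i0 i0S|S0] := pickP (mem S); last by have := S0 (enum_val i); rewrite /= enum_valP.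
  have := iS (fun j => c (enum_rank_in i0S j)) _ (enum_val i) (enum_valP i).
  rewrite enum_valK_in; apply.
  rewrite big_enum_val/=; move: Jc; congr J.
  by apply: eq_big => [j|j _]; rewrite ?inE// enum_valK_in.
- move=> h; apply: (in_span_trans (J := J) sJ _ (H h)) => // i iA.
  apply: (in_span_trans (J := J) sJ _ (HS i iA)) => // j jS.
  have -> : b j = (b \o enum_val) (enum_rank_in jS j) by rewrite /= enum_rankK_in.
  exact: (in_span_mem sJ (b \o enum_val) (in_setT _)).
- by move=> i; exists (enum_val i) => //; apply: (subsetP SA); exact: enum_valP.
Qed.

Lemma codim_uniq J n n' : subspace J -> codim J n -> codim J n' -> n = n'.
Proof.
move=> sJ [b [ib sb]] [b' [ib' sb']]; apply/eqP; rewrite eqn_leq.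
have := steinitz sJ ib (fun i _ => sb' (b i)); rewrite !cardsT !card_ord => ->.
by have := steinitz sJ ib' (fun i _ => sb (b' i)); rewrite !cardsT !card_ord => ->.
Qed.

(** A basis modulo [J'], followed by [u], is independent modulo [J]: modulo [J'] the part in [u]
    disappears, which kills the first coefficients, and then those of [u]. *)
Lemma codim_indep_leq J J' m n I (A : {set I}) u :
  subspace J -> subspace J' -> (forall h, J h -> J' h) -> codim J m -> codim J' n ->
  indep J A u -> (forall i, i \in A -> J' (u i)) -> (n + #|A| <= m)%N.
Proof.
move=> sJ sJ' JJ' [b [ib sb]] [b' [ib' sb']] iu uJ'.
pose f (x : 'I_n + I) := match x with inl i => b' i | inr i => u i end.
pose B : {set 'I_n + I} := [set x | match x with inl _ => true | inr i => i \in A end].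
have cB : #|B| = (n + #|A|)%N.
  rewrite -!sum1_card big_sumType/=; congr (_ + _)%N.
    by rewrite (eq_bigl xpredT) ?sum1_card ?card_ord// => i; rewrite inE.
  by apply: eq_bigl => i; rewrite inE.
have iB : indep J B f.
  move=> c; rewrite big_sumType/= => Jc.
  have Ju : J' (\sum_(i | inr i \in B) c (inr i) *: u i).
    by apply: subspace_sum => // i; rewrite inE => iA; apply: subspaceZ => //; exact: uJ'.
  have cl i : c (inl i) = 0.
    apply: (ib' (c \o inl)); rewrite ?inE//.
    have := subspaceB sJ' (JJ' _ Jc) Ju; rewrite addrK; congr J'.
    by apply: eq_bigl => j; rewrite !inE.
  have cr i : i \in A -> c (inr i) = 0.
    apply: (iu (c \o inr)); move: Jc; rewrite big1 ?add0r; last by move=> j _; rewrite cl scale0r.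
    by congr J; apply: eq_bigl => j; rewrite inE.
  by case=> i; rewrite inE => H; [exact: cl|exact: cr].
have := steinitz sJ iB (fun i _ => sb (f i)).
by rewrite cB cardsT card_ord.
Qed.

Lemma codim_leq J J' m n :
  subspace J -> subspace J' -> (forall h, J h -> J' h) -> codim J m -> codim J' n ->
  (n <= m)%N.
Proof.
move=> sJ sJ' JJ' cJ cJ'.
suff : (n + #|@set0 unit| <= m)%N by rewrite cards0 addn0.
apply: (@codim_indep_leq J J' m n unit set0 (fun=> 0)) => // [c _ i|i]; by rewrite inE.
Qed.

Lemma codim_sub J J' n :
  subspace J -> subspace J' -> (forall h, J h -> J' h) -> codim J n -> codim J' n ->
  forall h, J' h -> J h.
Proof.
move=> sJ sJ' JJ' cJ cJ' h J'h; apply: contrapT => nJ.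
suff : (n + #|[set: unit]| <= n)%N by rewrite cardsT card_unit addn1 ltnn.
apply: (@codim_indep_leq J J' n n unit setT (fun=> h)) => // c Jc [] _.
move: Jc; rewrite (big_pred1 tt); last by case; rewrite !inE.
move=> Jc; apply: contrapT => /eqP c0; apply: nJ.
by rewrite -[h]scale1r -(mulVf c0) -scalerA; exact: subspaceZ.
Qed.

(** The bound of [codim_indep_leq] is attained: the discrepancies given by [exchange] are as many as
    the difference of the codimensions. *)
Lemma codim_compl J J' m n :
  subspace J -> subspace J' -> (forall h, J h -> J' h) -> codim J m -> codim J' n ->
  exists (I : finType) (A : {set I}) (u : I -> V),
    [/\ indep J A u, forall i, J' (u i) & m = (n + #|A|)%N].
Proof.
move=> sJ sJ' JJ' cJ [b' [ib' sb']]; have [b [ib sb]] := cJ.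
have [S [c [iS [J'u iu]]]] := exchange sJ sJ' ib.
exists 'I_m, (~: S), (fun k => b k - \sum_(j in S) c k j *: b j); split=> //.
have -> : n = #|S|.
  apply/eqP; rewrite eqn_leq.
  have := steinitz sJ' iS (fun i _ => sb' (b i)).
  rewrite cardsT card_ord => ->; rewrite andbT.
  suff : (#|[set: 'I_n]| <= #|S|)%N by rewrite cardsT card_ord.
  apply: (steinitz (b := b) sJ' ib') => i _.
  apply: (in_span_trans sJ' JJ' (sb (b' i))) => j _.
  by exists (c j); exact: J'u.
by rewrite cardsC card_ord.
Qed.

Lemma codim_sup J J' m :
  subspace J -> subspace J' -> (forall h, J h -> J' h) -> codim J m ->
  exists2 n, (n <= m)%N & codim J' n.
Proof.
move=> sJ sJ' JJ' [b [ib sb]].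
have [|n [b' [le_n ib' sb' _]]] := @span_codim J' 'I_m setT b sJ'.
  by move=> h; apply: (in_span_trans sJ' JJ' (sb h)) => i _; exact: in_span_mem.
by exists n; [move: le_n; rewrite cardsT card_ord|exists b'].
Qed.

(* A spanning family stays spanning under all but finitely many small
   perturbations: the determinant expressing this is a polynomial in the
   parameter which is nonzero at 0. *)
Lemma open_span J I L (e : I -> V) (v : L -> K -> V) (w : L -> I -> {poly K}) :
  subspace J ->
  (forall l t, J (v l t - \sum_i (w l i).[t] *: e i)) ->
  (forall i, in_span J setT (v ^~ 0) (e i)) ->
  exists2 D : {poly K}, D.[0] != 0 &
    forall t, D.[t] != 0 -> forall i, in_span J setT (v ^~ t) (e i).
Proof.
move=> sJ Hw /choice[X HX].
pose n := #|I|.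
(* [X] expresses the [e i] through the family at 0. The same combinations of the family at [t] give
   [G e] modulo [J], where [G] is the value of [1 + E] at [t], the identity for [t = 0]; inverting
   [G] recovers the [e i]. *)
pose E : 'M[{poly K}]_n := \matrix_(i, j)
  \sum_l X (enum_val i) l *: (w l (enum_val j) - ((w l (enum_val j)).[0])%:P).
exists (\det (1%:M + E)).
  rewrite -horner_evalE -det_map_mx [map_mx _ _](_ : _ = 1%:M) ?det1 ?oner_neq0//.
  apply/matrixP => i j; rewrite !mxE /= horner_evalE hornerD hornerMn hornerC horner_sum big1 ?addr0// => l _.
  by rewrite hornerZ hornerD hornerN hornerC subrr mulr0.
move=> t; rewrite -horner_evalE -det_map_mx; set G := map_mx _ _ => detG.
have Gu : G \in unitmx by rewrite unitmxE unitfE.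
have GE i j : G i j = (i == j)%:R + \sum_l X (enum_val i) l * ((w l (enum_val j)).[t] - (w l (enum_val j)).[0]).
  rewrite !mxE /= horner_evalE hornerD hornerMn hornerC horner_sum; congr (_ + _).
  by apply: eq_bigr => l _; rewrite hornerZ hornerD hornerN hornerC.
pose f (i : 'I_n) : V := e (enum_val i).
have Gf i : in_span J setT (v ^~ t) (\sum_j G i j *: f j).
  exists (X (enum_val i)).
  have -> : \sum_j G i j *: f j = f i + \sum_l X (enum_val i) l *: (\sum_j ((w l j).[t] - (w l j).[0]) *: e j).
    rewrite (eq_bigr (fun j => (i == j)%:R *: f j + (\sum_l X (enum_val i) l * ((w l (enum_val j)).[t] - (w l (enum_val j)).[0])) *: f j)); last first.
      by move=> j _; rewrite GE scalerDl.
    rewrite big_split/= (bigD1 i)//= eqxx scale1r [X in _ + X + _]big1 ?addr0; last first.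
      by move=> j /negPf ij; rewrite eq_sym ij scale0r.
    congr (_ + _).
    rewrite (eq_bigr (fun j => \sum_l X (enum_val i) l *: (((w l (enum_val j)).[t] - (w l (enum_val j)).[0]) *: f j))); last first.
      by move=> j _; rewrite scaler_suml; apply: eq_bigr => l _; rewrite scalerA.
    rewrite exchange_big/=; apply: eq_bigr => l _; rewrite -scaler_sumr; congr (_ *: _).
    rewrite [RHS](reindex (@enum_val I predT))//.
    exact/onW_bij/enum_val_bij.
  have -> : forall a b c, a + b - c = (a - c + b : V) by move=> a b c; rewrite addrAC.
  have -> : f i - \sum_(l in [set: L]) X (enum_val i) l *: v l t =
    (f i - \sum_(l in [set: L]) X (enum_val i) l *: v l 0) +
    (\sum_l X (enum_val i) l *: (v l 0 - v l t)).
    rewrite -addrA; congr (_ + _); rewrite !sum_setT -sumrN -[X in _ = X + _]sumrN.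
    rewrite -big_split/=; apply: eq_bigr => l _.
    by rewrite scalerBr addKr.
  rewrite -addrA; apply: subspaceD => //; first exact: HX.
  rewrite -big_split/=.
  apply: subspace_sum => // l _; rewrite -scalerDr; apply: subspaceZ => //.
  have -> : v l 0 - v l t + \sum_j ((w l j).[t] - (w l j).[0]) *: e j =
    (v l 0 - \sum_j (w l j).[0] *: e j) - (v l t - \sum_j (w l j).[t] *: e j).
    rewrite (eq_bigr (fun j => (w l j).[t] *: e j - (w l j).[0] *: e j)); last first.
      by move=> j _; rewrite scalerBl.
    by rewrite sumrB opprB addrACA [RHS]addrACA; congr (_ + _); rewrite addrC.
  exact: subspaceB.
move=> i.
have -> : e i = \sum_k invmx G (enum_rank i) k *: (\sum_j G k j *: f j).
  rewrite (eq_bigr (fun k => \sum_j (invmx G (enum_rank i) k * G k j) *: f j)); last first.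
    by move=> k _; rewrite scaler_sumr; apply: eq_bigr => j _; rewrite scalerA.
  rewrite exchange_big/= (eq_bigr (fun j => (enum_rank i == j)%:R *: f j)); last first.
    move=> j _; rewrite -scaler_suml; congr (_ *: _).
    have := congr1 (fun M : 'M_n => M (enum_rank i) j) (mulVmx Gu).
    by rewrite !mxE => <-.
  rewrite (bigD1 (enum_rank i))//= eqxx scale1r big1 ?addr0 /f ?enum_rankK//.
  by move=> j /negPf ij; rewrite eq_sym ij scale0r.
by apply: in_span_sum => // k _; apply: in_spanZ.
Qed.

End QuotientDimension.

(** * Bivariate polynomials and weights *)

(* [{poly {poly C}}] with its structure of vector space over [C], the library
   providing only the one over [{poly C}]. *)
Definition bip (C : numClosedFieldType) : Type := {poly {poly C}}.
HB.instance Definition _ (C : numClosedFieldType) := GRing.IntegralDomain.on (bip C).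

Section BipScale.
Variable C : numClosedFieldType.
Definition bscale (c : C) (h : bip C) : bip C := c%:P%:P * h.
Lemma bscaleA a b v : bscale a (bscale b v) = bscale (a * b) v.
Proof. by rewrite /bscale !polyCM mulrA. Qed.
Lemma bscale1 : left_id 1 bscale. Proof. by move=> v; rewrite /bscale mul1r. Qed.
Lemma bscaleDr : right_distributive bscale +%R.
Proof. by move=> a u v; rewrite /bscale mulrDr. Qed.
Lemma bscaleDl v : {morph bscale^~ v : a b / a + b}.
Proof. by move=> a b; rewrite /bscale !polyCD mulrDl. Qed.
HB.instance Definition _ :=
  GRing.Zmodule_isLmodule.Build C (bip C) bscaleA bscale1 bscaleDr bscaleDl.
End BipScale.

HB.lock Definition mon {C : numClosedFieldType} (i j : nat) : bip C := 'X^i * ('X^j)%:P.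

Section Coefficients.
Variable C : numClosedFieldType.
Local Notation R := (bip C).
Implicit Types (h A B T : R) (c : C).

Definition cf (h : {poly {poly C}}) (i j : nat) : C := h`_i`_j.
Definition dx (h : {poly {poly C}}) : R := h^`().
Definition dy (h : {poly {poly C}}) : R := map_poly (@deriv C) h.

Lemma bipP h A : (forall i j, cf h i j = cf A i j) -> h = A.
Proof. by move=> H; apply/polyP => i; apply/polyP => j; exact: H. Qed.

Lemma bscaleE c h : c *: h = c%:P%:P * h. Proof. by []. Qed.

Lemma bscaleAl c h A : (c *: h) * A = c *: (h * A).
Proof. by rewrite !bscaleE mulrA. Qed.
Lemma bscaleAr c h A : h * (c *: A) = c *: (h * A).
Proof. by rewrite !bscaleE mulrCA. Qed.

Lemma cf0 i j : cf 0 i j = 0. Proof. by rewrite /cf !coef0. Qed.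
Lemma cfD h A i j : cf (h + A) i j = cf h i j + cf A i j.
Proof. by rewrite /cf !coefD. Qed.
Lemma cfN h i j : cf (- h) i j = - cf h i j.
Proof. by rewrite /cf !coefN. Qed.
Lemma cfB h A i j : cf (h - A) i j = cf h i j - cf A i j.
Proof. by rewrite cfD cfN. Qed.
Lemma cf_sum (I : Type) (r : seq I) (P : pred I) (F : I -> R) i j :
  cf (\sum_(k <- r | P k) F k) i j = \sum_(k <- r | P k) cf (F k) i j.
Proof. by rewrite /cf !coef_sum. Qed.
Lemma cfM h A k l : cf (h * A) k l =
  \sum_(i < k.+1) \sum_(j < l.+1) cf h i j * cf A (k - i) (l - j).
Proof. by rewrite /cf coefM coef_sum; apply: eq_bigr => i _; rewrite coefM. Qed.
Lemma cfZ c h i j : cf (c *: h) i j = c * cf h i j.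
Proof. by rewrite bscaleE /cf !coefCM. Qed.
Lemma cf_mon i j k l : cf (@mon C i j) k l = ((k == i) && (l == j))%:R.
Proof.
rewrite /cf mon.unlock coefMC coefXn; case: eqP => _ /=; last by rewrite mul0r coef0.
by rewrite mul1r coefXn.
Qed.
Lemma cf_dx h i j : cf (dx h) i j = cf h i.+1 j *+ i.+1.
Proof. by rewrite /cf /dx coef_deriv coefMn. Qed.
Lemma cf_dy h i j : cf (dy h) i j = cf h i j.+1 *+ j.+1.
Proof. by rewrite /cf /dy coef_map_id0 ?deriv0// coef_deriv. Qed.

Lemma monM i j k l : mon i j * mon k l = mon (i + k) (j + l) :> R.
Proof. by rewrite mon.unlock !exprD polyCM; ring. Qed.
Lemma mon00 : mon 0 0 = 1 :> R. Proof. by rewrite mon.unlock !expr0 mulr1. Qed.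

Lemma cf_monM a b h k l : cf (mon a b * h) k l =
  if (a <= k)%N && (b <= l)%N then cf h (k - a) (l - b) else 0.
Proof.
rewrite /cf mon.unlock -mulrA coefXnM; case: ltnP => _ /=; first by rewrite coef0.
by rewrite coefCM coefXnM; case: ltnP.
Qed.

Lemma dxD h A : dx (h + A) = dx h + dx A. Proof. exact: derivD. Qed.
Lemma dxM h A : dx (h * A) = dx h * A + h * dx A. Proof. exact: derivM. Qed.
Lemma dxZ c h : dx (c *: h) = c *: dx h.
Proof. by rewrite !bscaleE dxM /dx derivC mul0r add0r. Qed.
Lemma dyD h A : dy (h + A) = dy h + dy A.
Proof. by apply: bipP => i j; rewrite cf_dy !cfD !cf_dy mulrnDl. Qed.
Lemma dyM h A : dy (h * A) = dy h * A + h * dy A.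
Proof.
apply/polyP => k; rewrite coef_map_id0 ?deriv0// coefM coefD !coefM raddf_sum -big_split/=.
apply: eq_bigr => i _; rewrite derivM; congr (_ * _ + _ * _).
  by rewrite coef_map_id0 ?deriv0.
by rewrite coef_map_id0 ?deriv0.
Qed.
Lemma dyZ c h : dy (c *: h) = c *: dy h.
Proof. by apply: bipP => i j; rewrite cf_dy !cfZ cf_dy mulrnAr. Qed.

Lemma dx_mon i j : dx (@mon C i j) = i%:R *: mon i.-1 j :> R.
Proof.
apply: bipP => k l; rewrite cf_dx cfZ !cf_mon; case: i => [|i] /=.
  by rewrite mul0rn mul0r.
by rewrite eqSS; case: eqP => [->|_]; case: eqP => _ /=; rewrite ?mul0rn ?mulr0// mulr1.
Qed.
Lemma dy_mon i j : dy (@mon C i j) = j%:R *: mon i j.-1 :> R.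
Proof.
apply: bipP => k l; rewrite cf_dy cfZ !cf_mon; case: j => [|j] /=.
  by rewrite andbF mul0rn mul0r.
by rewrite eqSS; case: eqP => _; case: eqP => [->|_] /=; rewrite ?mul0rn ?mulr0// mulr1.
Qed.

Lemma cf_sizex h i j : (size h <= i)%N -> cf h i j = 0.
Proof. by move=> H; rewrite /cf (_ : h`_i = 0) ?coef0// nth_default. Qed.
Lemma cf_sizey h i j : (size (h`_i)%R <= j)%N -> cf h i j = 0.
Proof. exact: nth_default. Qed.

Lemma cf_bound h : exists n, forall i j, cf h i j != 0 -> (i < n)%N && (j < n)%N.
Proof.
exists (size h + \sum_(i < size h) size (h`_i)%R)%N => i j h0.
have ih : (i < size h)%N by rewrite ltnNge; apply: contra h0 => /cf_sizex->.
have jh : (j < size (h`_i)%R)%N by rewrite ltnNge; apply: contra h0 => /cf_sizey->.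
rewrite (ltn_addr _ ih)/= (leq_trans jh)// (leq_trans _ (leq_addl _ _))//.
by rewrite (bigD1 (Ordinal ih))//= leq_addr.
Qed.

Lemma bip_expand n h : (forall i j, cf h i j != 0 -> (i < n)%N && (j < n)%N) ->
  h = \sum_(u : 'I_n * 'I_n) cf h u.1 u.2 *: mon u.1 u.2.
Proof.
move=> H; apply: bipP => i j; rewrite cf_sum.
have [/eqP h0|h0] := boolP (cf h i j == 0).
  rewrite h0 big1// => -[u v] _ /=; rewrite cfZ cf_mon.
  by case: eqP => [iu|_]; case: eqP => [jv|_] /=; rewrite ?mulr0// -iu -jv h0 mul0r.
have /andP[ni nj] := H _ _ h0.
rewrite (bigD1 (Ordinal ni, Ordinal nj))//= cfZ cf_mon !eqxx mulr1 big1 ?addr0//.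
move=> -[u v] /= uv; rewrite cfZ cf_mon.
case: eqP => [iu|_]; case: eqP => [jv|_] /=; rewrite ?mulr0//.
by move: uv; rewrite -[_ == _]/((_ == _) && (_ == _)) -!val_eqE/= iu jv !eqxx.
Qed.

Lemma bip_ind (P : R -> Prop) : P 0 -> (forall h A, P h -> P A -> P (h + A)) ->
  (forall c i j, P (c *: mon i j)) -> forall h, P h.
Proof.
move=> P0 PD Pm h; have [n Hn] := cf_bound h.
by rewrite (bip_expand Hn); elim/big_ind: _.
Qed.

End Coefficients.

Section Ideals.
Variable C : numClosedFieldType.
Local Notation R := (bip C).
Implicit Types (h A B T P Q F : R) (c : C).

Definition ideal2 P Q h := exists A B, h = A * P + B * Q.
Definition jac F := ideal2 (dx F) (dy F).

Lemma ideal2D P Q u v : ideal2 P Q u -> ideal2 P Q v -> ideal2 P Q (u + v).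
Proof. by move=> [A [B ->]] [A' [B' ->]]; exists (A + A'), (B + B'); ring. Qed.
Lemma ideal2M P Q u v : ideal2 P Q v -> ideal2 P Q (u * v).
Proof. by move=> [A [B ->]]; exists (u * A), (u * B); ring. Qed.
Lemma ideal2N P Q u : ideal2 P Q u -> ideal2 P Q (- u).
Proof. by move=> /(ideal2M (-1)); rewrite mulN1r. Qed.
Lemma ideal2B P Q u v : ideal2 P Q u -> ideal2 P Q v -> ideal2 P Q (u - v).
Proof. by move=> Hu Hv; apply: ideal2D => //; exact: ideal2N. Qed.
Lemma ideal2Z P Q c u : ideal2 P Q u -> ideal2 P Q (c *: u).
Proof. by rewrite bscaleE; exact: ideal2M. Qed.
Lemma ideal20 P Q : ideal2 P Q 0. Proof. by exists 0, 0; rewrite !mul0r addr0. Qed.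
Lemma ideal2l P Q : ideal2 P Q P. Proof. by exists 1, 0; rewrite mul1r mul0r addr0. Qed.
Lemma ideal2r P Q : ideal2 P Q Q. Proof. by exists 0, 1; rewrite mul1r mul0r add0r. Qed.
Lemma ideal2_eq P Q u v : ideal2 P Q (u - v) -> ideal2 P Q v -> ideal2 P Q u.
Proof. by move=> Hu Hv; rewrite -(subrK v u); exact: ideal2D. Qed.
Lemma subspace_ideal2 P Q : subspace (ideal2 P Q).
Proof. by split=> [|c u v Hu Hv]; [exact: ideal20|apply: ideal2D => //; exact: ideal2Z]. Qed.
End Ideals.

Section Weights.
Variable C : numClosedFieldType.
Local Notation R := (bip C).
Implicit Types (h A B T P Q F : R) (c : C).
Variables (wx wy : nat).

Definition wt (i j : nat) := (i * wx + j * wy)%N.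
Definition homog n h := forall i j, cf h i j != 0 -> wt i j = n.
Definition ordw N h := forall i j, (wt i j < N)%N -> cf h i j = 0.
Definition wpart (n : nat) h : R :=
  \poly_(i < size h) \poly_(j < size (h`_i)%R) (if wt i j == n then cf h i j else 0).

Lemma wtD i j k l : wt (i + k) (j + l) = (wt i j + wt k l)%N.
Proof. by rewrite /wt; ring. Qed.

Lemma cf_wpart n h i j : cf (wpart n h) i j = if wt i j == n then cf h i j else 0.
Proof.
rewrite {1}/cf coef_poly; case: ltnP => [_|H]; last by rewrite coef0 cf_sizex ?if_same.
by rewrite coef_poly; case: ltnP => [//|H]; rewrite cf_sizey ?if_same.
Qed.

Lemma wpartD n h A : wpart n (h + A) = wpart n h + wpart n A.
Proof. by apply: bipP => i j; rewrite cfD !cf_wpart cfD; case: ifP; rewrite ?addr0. Qed.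
Lemma wpartN n h : wpart n (- h) = - wpart n h.
Proof. by apply: bipP => i j; rewrite cfN !cf_wpart cfN; case: ifP; rewrite ?oppr0. Qed.
Lemma wpartB n h A : wpart n (h - A) = wpart n h - wpart n A.
Proof. by rewrite wpartD wpartN. Qed.
Lemma wpartZ n c h : wpart n (c *: h) = c *: wpart n h.
Proof. by apply: bipP => i j; rewrite cfZ !cf_wpart cfZ; case: ifP; rewrite ?mulr0. Qed.
Lemma wpart0 n : wpart n 0 = 0.
Proof. by apply: bipP => i j; rewrite cf_wpart cf0 if_same. Qed.

Lemma homog_wpart n h : homog n (wpart n h).
Proof. by move=> i j; rewrite cf_wpart; case: (wt i j =P n) => //; rewrite eqxx. Qed.
Lemma wpart_homog n h : homog n h -> wpart n h = h.
Proof.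
move=> H; apply: bipP => i j; rewrite cf_wpart; case: eqP => // ne.
by apply/eqP; rewrite eq_sym; apply/negPn/negP => /H.
Qed.
Lemma wpart_homog_ne (n k : nat) h : homog n h -> k != n -> wpart k h = 0.
Proof.
move=> H kn; apply: bipP => i j; rewrite cf_wpart cf0; case: eqP => // e.
by apply/eqP/negPn/negP => /H E; rewrite -e E eqxx in kn.
Qed.

Lemma homog0 n : homog n 0. Proof. by move=> i j; rewrite cf0 eqxx. Qed.
Lemma homogD n h A : homog n h -> homog n A -> homog n (h + A).
Proof.
move=> Hh HA i j; rewrite cfD; have [h0|/Hh//] := eqVneq (cf h i j) 0.
by rewrite h0 add0r; exact: HA.
Qed.
Lemma homogN n h : homog n h -> homog n (- h).
Proof. by move=> Hh i j; rewrite cfN oppr_eq0; exact: Hh. Qed.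
Lemma homogB n h A : homog n h -> homog n A -> homog n (h - A).
Proof. by move=> Hh HA; apply: homogD => //; exact: homogN. Qed.
Lemma homogZ n c h : homog n h -> homog n (c *: h).
Proof. by move=> Hh i j; rewrite cfZ mulf_eq0 negb_or => /andP[_]; exact: Hh. Qed.
Lemma homog_mon i j : homog (wt i j) (@mon C i j).
Proof. by move=> k l; rewrite cf_mon; case: (k =P i) => [->|]; case: (l =P j) => [->|] //=; rewrite eqxx. Qed.
Arguments homog_mon : clear implicits.
Lemma homogM n m h A : homog n h -> homog m A -> homog (n + m) (h * A).
Proof.
move=> Hh HA k l; rewrite cfM => H.
have [i [j [hn An]]] : exists (i : 'I_k.+1) (j : 'I_l.+1), cf h i j != 0 /\ cf A (k - i) (l - j) != 0.
  apply: contrapT => N; move/negP: H; apply; apply/eqP.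
  apply: big1 => i _; apply: big1 => j _; apply/eqP; rewrite mulf_eq0.
  by apply: contrapT => /negP; rewrite negb_or => /andP[? ?]; apply: N; exists i, j.
by rewrite -(Hh _ _ hn) -(HA _ _ An) -wtD !subnKC ?leq_ord.
Qed.
Lemma homogX n h r : homog n h -> homog (n * r) (h ^+ r).
Proof.
move=> Hh; elim: r => [|r IH]; last by rewrite exprS mulnS; exact: homogM.
by rewrite expr0 muln0; have := homog_mon 0 0; rewrite mon00.
Qed.
Lemma homog_dx n h : homog n h -> homog (n - wx) (dx h).
Proof.
move=> H i j; rewrite cf_dx mulrn_eq0/= => /H <-.
by rewrite /wt mulSn; lia.
Qed.
Lemma homog_dy n h : homog n h -> homog (n - wy) (dy h).
Proof.
move=> H i j; rewrite cf_dy mulrn_eq0/= => /H <-.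
by rewrite /wt mulSn; lia.
Qed.

Lemma wpartMr n a T A : homog a A -> wpart (n + a) (T * A) = wpart n T * A.
Proof.
move=> HA; apply: bipP => k l; rewrite cf_wpart !cfM.
rewrite (fun_if (fun x => x)); case: eqP => [e|e].
  apply: eq_bigr => i _; apply: eq_bigr => j _; rewrite cf_wpart.
  have [->|/HA An] := eqVneq (cf A (k - i) (l - j)) 0; first by rewrite !mulr0.
  have := wtD i j (k - i) (l - j); rewrite !subnKC ?leq_ord// e An => /eqP.
  by rewrite eqn_add2r => /eqP <-; rewrite eqxx.
symmetry; apply: big1 => i _; apply: big1 => j _; rewrite cf_wpart.
have [->|/HA An] := eqVneq (cf A (k - i) (l - j)) 0; first by rewrite mulr0.
case: eqP => [e'|]; last by rewrite mul0r.
by case: e; have := wtD i j (k - i) (l - j); rewrite !subnKC ?leq_ord// e' An.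
Qed.

Lemma wpartMr0 n a T A : homog a A -> (n < a)%N -> wpart n (T * A) = 0.
Proof.
move=> HA na; apply: bipP => k l; rewrite cf_wpart cf0 cfM.
case: eqP => // e; apply: big1 => i _; apply: big1 => j _.
have [->|/HA An] := eqVneq (cf A (k - i) (l - j)) 0; first by rewrite mulr0.
exfalso; move: na; rewrite -An -e ltnNge => /negP; apply; rewrite /wt.
by apply: leq_add; rewrite leq_mul2r leq_subr orbT.
Qed.

Arguments wpartMr n {a} T {A}.
Arguments wpartMr0 {n a} T {A}.
Lemma wpart_expand h : exists N0, forall N, (N0 <= N)%N -> h = \sum_(n < N) wpart n h.
Proof.
have [m Hm] := cf_bound h; exists (wt m m).+1 => N HN; apply: bipP => i j.
rewrite cf_sum; have [h0|h0] := eqVneq (cf h i j) 0.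
  by rewrite h0 big1// => n _; rewrite cf_wpart h0 if_same.
have /andP[im jm] := Hm _ _ h0.
have lN : (wt i j < N)%N.
  apply: leq_trans HN; rewrite ltnS /wt.
  by apply: leq_add; rewrite leq_mul2r (ltnW im, ltnW jm) orbT.
rewrite (bigD1 (Ordinal lN))//= cf_wpart eqxx big1 ?addr0// => n ne.
rewrite cf_wpart; case: eqP => // e; case/negP: ne; apply/eqP/val_inj; by rewrite /= e.
Qed.

Lemma wpart_large h : exists N0, forall n, (N0 <= n)%N -> wpart n h = 0.
Proof.
have [m Hm] := cf_bound h; exists (wt m m).+1 => n Hn; apply: bipP => i j.
rewrite cf_wpart cf0; case: eqP => // e; apply/eqP; apply: contraTT Hn => /Hm /andP[im jm].
rewrite -ltnNge ltnS -e /wt.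
by apply: leq_add; rewrite leq_mul2r (ltnW im, ltnW jm) orbT.
Qed.

Lemma subspace_ordw N : subspace (ordw N).
Proof.
split=> [i j _|c u v Hu Hv i j H]; first exact: cf0.
by rewrite cfD cfZ Hu// Hv// mulr0 addr0.
Qed.
Lemma ordwM a b A B : ordw a A -> ordw b B -> ordw (a + b) (A * B).
Proof.
move=> HA HB k l H; rewrite cfM; apply: big1 => i _; apply: big1 => j _.
have [/HA->|ai] := ltnP (wt i j) a; first by rewrite mul0r.
rewrite [cf B _ _]HB ?mulr0// -(ltn_add2l a); apply: leq_ltn_trans H.
have -> : wt k l = (wt i j + wt (k - i) (l - j))%N by rewrite -wtD !subnKC ?leq_ord.
by rewrite leq_add2r.
Qed.
Lemma ordwMl N A B : ordw N B -> ordw N (A * B).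
Proof. by move=> HB; rewrite -[N]add0n; apply: ordwM. Qed.
Lemma ordw_leq N M A : (N <= M)%N -> ordw M A -> ordw N A.
Proof. by move=> NM H i j ij; apply: H; exact: leq_trans NM. Qed.
Lemma ordw_homog n A : homog n A -> ordw n A.
Proof. by move=> H i j; apply: contraTeq => /H ->; rewrite ltnn. Qed.
Lemma ordw_mon i j : ordw (wt i j) (@mon C i j).
Proof. exact/ordw_homog/homog_mon. Qed.
Arguments ordw_mon : clear implicits.

Section Homogenization.
Variables (A1 A2 : R) (a1 a2 : nat).
Hypotheses (HA1 : homog a1 A1) (HA2 : homog a2 A2).

Lemma wpart_ideal2 n u : ideal2 A1 A2 u -> ideal2 A1 A2 (wpart n u).
Proof.
move=> [T1 [T2 ->]]; rewrite wpartD.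
have H a A T : homog a A -> exists T', wpart n (T * A) = T' * A.
  move=> HA; have [na|an] := ltnP n a.
    by exists 0; rewrite (wpartMr0 _ HA na) mul0r.
  by exists (wpart (n - a) T); rewrite -(wpartMr (n - a)%N T HA) subnK.
have [T1' ->] := H _ _ T1 HA1; have [T2' ->] := H _ _ T2 HA2.
by exists T1', T2'.
Qed.

(* The restriction to the chart [y = 1]. *)
Definition dehomog (h : {poly {poly C}}) : {poly C} := map_poly (horner_eval (1 : C)) h.
Definition lift_x (t : {poly C}) : R := map_poly polyC t.

Lemma dehomogD h A : dehomog (h + A) = dehomog h + dehomog A. Proof. exact: rmorphD. Qed.
Lemma dehomogB h A : dehomog (h - A) = dehomog h - dehomog A. Proof. exact: rmorphB. Qed.
Lemma dehomogM h A : dehomog (h * A) = dehomog h * dehomog A. Proof. exact: rmorphM. Qed.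
Lemma dehomog_lift t : dehomog (lift_x t) = t.
Proof. by apply/polyP => i; rewrite !coef_map/= horner_evalE hornerC. Qed.

(** Each coefficient, a polynomial in [y], vanishes at 1 and is divisible by [y - 1]. *)
Lemma dehomog_eq0 h : dehomog h = 0 -> exists S, h = (mon 0 1 - 1) * S.
Proof.
move=> H; exists (\poly_(i < size h) ((h`_i)%R %/ ('X - 1%:P))).
have -> : mon 0 1 - 1 = ('X - 1%:P)%:P :> R by rewrite mon.unlock expr0 mul1r expr1 polyCB.
apply/polyP => i; rewrite mulrC coefMC coef_poly.
case: ltnP => [_|?]; last by rewrite mul0r nth_default.
rewrite divpK// dvdp_XsubCl; apply/rootP.
have := congr1 (fun p : {poly C} => p`_i) H; rewrite coef0 coef_map_id0 ?horner_evalE//.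
by rewrite horner0.
Qed.

(** With [L] the lifted combination, [B - L = (y - 1) S]. In each weight the component of [S] is,
    modulo the ideal, [y] times an earlier component minus that of [B]. So the components of [S]
    below weight [b] lie in the ideal, and that of weight [b + r wy] is [- y^r B] modulo it; for
    large [r] it vanishes because [S] is a polynomial. *)
Lemma homogenize b B t1 t2 : (0 < wy)%N -> homog b B ->
  dehomog B = t1 * dehomog A1 + t2 * dehomog A2 -> exists M, ideal2 A1 A2 (mon 0 M * B).
Proof.
move=> wy0 HB E.
pose J := ideal2 A1 A2.
have [S HS] : exists S, B - (lift_x t1 * A1 + lift_x t2 * A2) = (mon 0 1 - 1) * S.
  by apply: dehomog_eq0; rewrite dehomogB dehomogD !dehomogM !dehomog_lift E subrr.
have HY : homog wy (mon 0 1 : R) by have := homog_mon 0 1; rewrite /wt mul0n mul1n.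
have rec n : J (wpart n S - (wpart n (S * mon 0 1) - wpart n B)).
  have -> : wpart n S - (wpart n (S * mon 0 1) - wpart n B) =
     wpart n (lift_x t1 * A1 + lift_x t2 * A2).
    by rewrite -!wpartB; congr wpart; rewrite -(subrK (lift_x t1 * A1 + lift_x t2 * A2) B) HS; ring.
  by apply: wpart_ideal2; exists (lift_x t1), (lift_x t2).
have low n : (n < b)%N -> J (wpart n S).
  elim/ltn_ind: n => n IH nb; apply: ideal2_eq (rec n) _.
  rewrite (wpart_homog_ne HB) ?subr0 ?ltn_eqF//.
  have [nw|wn] := ltnP n wy; first by rewrite (wpartMr0 _ HY nw); exact: ideal20.
  rewrite -(subnK wn) (wpartMr _ _ HY) mulrC; apply: ideal2M; apply: IH; lia.
have high r : J (wpart (b + r * wy) S + mon 0 r * B).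
  elim: r => [|r IH].
    rewrite mul0n addn0 mon00 mul1r.
    have := rec b; rewrite (wpart_homog HB) opprB addrA => H.
    apply: ideal2_eq; first exact: H.
    have [nw|wn] := ltnP b wy; first by rewrite (wpartMr0 _ HY nw); exact: ideal20.
    rewrite -{1}(subnK wn) (wpartMr _ _ HY) mulrC; apply: ideal2M; apply: low; lia.
  have := rec (b + r.+1 * wy)%N.
  rewrite (wpart_homog_ne HB) ?subr0; last by rewrite mulSn; lia.
  have -> : (b + r.+1 * wy = b + r * wy + wy)%N by rewrite mulSn; lia.
  rewrite (wpartMr _ _ HY) => H.
  have -> : mon 0 r.+1 = mon 0 1 * mon 0 r :> R by rewrite monM.
  have := ideal2D H (ideal2M (mon 0 1) IH); rewrite mulrDr addrA mulrA; congr (J (_ + _)).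
  by rewrite mulrC subrK.
have [N HN] := wpart_large S; exists N.
have := high N; rewrite HN ?add0r//.
by rewrite (leq_trans _ (leq_addl _ _))// leq_pmulr.
Qed.
End Homogenization.
End Weights.

(** * Koszul relations and the global Jacobian algebra *)

Section Koszul.
Variable C : numClosedFieldType.
Local Notation R := (bip C).
Implicit Types (h A B T P Q F : R) (c : C).

Lemma mon_neq0 i j : mon i j != 0 :> R.
Proof.
apply/eqP => /(congr1 (fun h => cf h i j)); rewrite cf_mon cf0 !eqxx/=.
by apply/eqP; exact: oner_neq0.
Qed.

Lemma mon_coprime M N (U V : R) : mon M 0 * U = mon 0 N * V -> exists W, U = mon 0 N * W.
Proof.
move=> E; exists (map_poly (drop_poly N) U); apply: bipP => i j.
rewrite cf_monM subn0 leq0n/=.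
have [Nj|jN] := leqP N j.
  rewrite /cf coef_map_id0 ?coef_drop_poly ?subnK//.
  by apply/polyP => k; rewrite coef_drop_poly !coef0.
have := congr1 (fun h => cf h (M + i) j) E.
rewrite !cf_monM leq_addr leq0n/= addKn subn0 => ->.
by rewrite leqNgt jN.
Qed.

(** Powers of [x] and [y] are coprime: cross-multiplication gives [x^M U = y^N V], so [y^N] divides
    [U] and can be cancelled. Used to glue divisibilities that hold up to a power of [y] and up to a
    power of [x]. *)
Lemma dvd_charts M N A B U V : mon 0 N * B = A * U -> mon M 0 * B = A * V ->
  exists W, B = A * W.
Proof.
move=> E1 E2; have [A0|A0] := eqVneq A 0.
  exists 0; apply/eqP; move/eqP: E1.
  by rewrite A0 mul0r mulf_eq0 (negPf (mon_neq0 _ _)) mulr0.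
have /mon_coprime[W HW] : mon M 0 * U = mon 0 N * V.
  by apply: (mulfI A0); rewrite mulrCA -E1 mulrCA E2 mulrCA.
exists W; apply: (mulfI (mon_neq0 0 N)).
by rewrite E1 HW mulrCA.
Qed.

Section Complete.
Variables (P Q : R) (M : nat).
Hypotheses (xM : ideal2 P Q (mon M 0)) (yM : ideal2 P Q (mon 0 M)).

(** Writing [x^M = U P + V Q] turns the relation into [x^M A = Q (V A - U B)], and likewise for
    [y^M]; [dvd_charts] then removes the powers. *)
Lemma koszul_dvd A B : A * P + B * Q = 0 -> exists T, A = Q * T.
Proof.
move=> E; case: xM => [U [V HU]]; case: yM => [U' [V' HU']].
have EA : A * P = - (B * Q) by apply/eqP; rewrite -addr_eq0 E.
apply: (@dvd_charts M M Q A (V' * A - U' * B) (V * A - U * B)).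
  rewrite HU' (_ : _ * A = U' * (A * P) + V' * A * Q); last by ring.
  by rewrite EA; ring.
rewrite HU (_ : _ * A = U * (A * P) + V * A * Q); last by ring.
by rewrite EA; ring.
Qed.
End Complete.

Lemma koszul P Q M A B : ideal2 P Q (mon M 0) -> ideal2 P Q (mon 0 M) ->
  A * P + B * Q = 0 -> exists T, A = T * Q /\ B = - (T * P).
Proof.
(* For [Q = 0] divisibility by [Q] gives no information on [B]; the roles are exchanged, [P] being
   nonzero since [x^M] lies in the ideal. *)
move=> xM yM E; have [Q0|Q0] := eqVneq Q 0.
  have [|||T HT] := @koszul_dvd Q P M _ _ B A.
  - by case: xM => U [V ->]; exists V, U; rewrite addrC.
  - by case: yM => U [V ->]; exists V, U; rewrite addrC.
  - by rewrite addrC.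
  exists (- T); split; last by rewrite HT; ring.
  move/eqP: E; rewrite Q0 !mulr0 addr0 mulf_eq0 => /orP[/eqP//|/eqP P0].
  case: xM => U [V]; rewrite P0 Q0 !mulr0 addr0 => /eqP.
  by rewrite (negPf (mon_neq0 _ _)).
have [T HT] := koszul_dvd xM yM E.
exists T; split; first by rewrite HT mulrC.
apply: (mulIf Q0); apply/eqP; rewrite -subr_eq0 -[X in _ == X]E HT; apply/eqP; ring.
Qed.

(** Monomials with an exponent at least [M] lie in the ideal, so finitely many others span. A basis
    of monomials lets weights be followed when the ideal is perturbed. *)
Lemma mon_basis P Q M : ideal2 P Q (mon M 0) -> ideal2 P Q (mon 0 M) ->
  exists n (b : 'I_n -> nat * nat),
    indep (ideal2 P Q) setT (fun i => mon (b i).1 (b i).2) /\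
    forall h, in_span (ideal2 P Q) setT (fun i => mon (b i).1 (b i).2) h.
Proof.
move=> xM yM; pose f (u : 'I_M * 'I_M) : R := mon u.1 u.2.
have sJ := subspace_ideal2 P Q.
have [|n [b [_ ib sb Hb]]] := @span_codim _ _ _ _ setT f sJ.
  elim/bip_ind => [|h A|c i j].
  - by apply: in_span_sub => //; exact: ideal20.
  - exact: in_spanD.
  apply: in_spanZ => //; have [Mi|iM] := leqP M i.
    apply: in_span_sub => //; rewrite -(subnK Mi) -[j in mon _ j]addn0 -monM.
    exact: ideal2M.
  have [Mj|jM] := leqP M j.
    apply: in_span_sub => //; rewrite -(subnK Mj) -[i in mon i]addn0 -monM.
    exact: ideal2M.
  exact: (in_span_mem sJ f (in_setT (Ordinal iM, Ordinal jM))).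
have /choice[g Hg] : forall i, exists u : nat * nat, b i = mon u.1 u.2.
  by move=> i; have [[u v] _ ->] := Hb i; exists (nat_of_ord u, nat_of_ord v).
exists n, g.
by rewrite -(_ : b = fun i => mon (g i).1 (g i).2) //; apply/funext => i; rewrite Hg.
Qed.
End Koszul.

(** * Perturbing homogeneous generators by terms of lower weight *)

Section LowerTerms.
Variable C : numClosedFieldType.
Local Notation R := (bip C).
Implicit Types (h A B T : R) (c : C).
Variables (wx wy : nat).
Local Notation wt := (wt wx wy).
Local Notation homog := (homog wx wy).
Local Notation wpart := (wpart wx wy).
Variables (P0 Q0 P1 Q1 : R) (a b M : nat).
Hypotheses (HP0 : homog a P0) (HQ0 : homog b Q0).
Hypotheses (HP1 : forall i j, cf P1 i j != 0 -> (wt i j < a)%N)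
           (HQ1 : forall i j, cf Q1 i j != 0 -> (wt i j < b)%N).
Hypotheses (xM : ideal2 P0 Q0 (mon M 0)) (yM : ideal2 P0 Q0 (mon 0 M)).

Let P := P0 + P1.
Let Q := Q0 + Q1.

Definition hshift (n k : nat) h := forall i j, cf h i j != 0 -> (wt i j + k = n)%N.
(** The component of weight [n - k], set to zero for [n < k], where the truncated difference would
    select the constant term. *)
Definition wpartd (n k : nat) h : R := if (k <= n)%N then wpart (n - k) h else 0.

Lemma hshift_wpartd n k h : hshift n k (wpartd n k h).
Proof.
move=> i j; rewrite /wpartd; case: leqP => kn; last by rewrite cf0 eqxx.
by move/homog_wpart->; rewrite subnK.
Qed.

Lemma wpartdM n k h A : homog k A -> wpart n (h * A) = wpartd n k h * A.
Proof.
move=> HA; rewrite /wpartd; case: leqP => kn; last by rewrite (wpartMr0 _ HA) ?mul0r.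
by rewrite -(wpartMr _ _ HA) subnK.
Qed.

Lemma cfM_wt k l A B : cf (A * B) k l != 0 ->
  exists i j i' j', [/\ cf A i j != 0, cf B i' j' != 0 & wt k l = (wt i j + wt i' j')%N].
Proof.
rewrite cfM => H.
have [i [j [hn An]]] : exists (i : 'I_k.+1) (j : 'I_l.+1), cf A i j != 0 /\ cf B (k - i) (l - j) != 0.
  apply: contrapT => N; move/negP: H; apply; apply/eqP.
  apply: big1 => i _; apply: big1 => j _; apply/eqP; rewrite mulf_eq0.
  by apply: contrapT => /negP; rewrite negb_or => /andP[? ?]; apply: N; exists i, j.
by exists i, j, (k - i)%N, (l - j)%N; split=> //; rewrite -wtD !subnKC ?leq_ord.
Qed.

Lemma wpart_lowM n k A B : (forall i j, cf A i j != 0 -> (wt i j + k <= n)%N) ->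
  (forall i j, cf B i j != 0 -> (wt i j < k)%N) -> wpart n (A * B) = 0.
Proof.
move=> HA HB; apply: bipP => i j; rewrite cf_wpart cf0; case: eqP => // e.
apply/eqP; apply: contraT => /cfM_wt[u [v [u' [v' [/HA h1 /HB h2 h3]]]]]; lia.
Qed.

Variables (n : nat) (w : 'I_n -> nat) (e : 'I_n -> R).
Hypothesis He : forall i, homog (w i) (e i).

(** Induction on a strict bound for the weights: the top component is reduced with [P0] and [Q0],
    and replacing these by [P] and [Q] costs only terms of smaller weight. *)
Lemma lower_span : (forall h, in_span (ideal2 P0 Q0) setT e h) ->
  forall h, in_span (ideal2 P Q) setT e h.
Proof.
move=> se h; have sJ := subspace_ideal2 P Q.
suff H N : forall h, (forall i j, cf h i j != 0 -> (wt i j < N)%N) -> in_span (ideal2 P Q) setT e h.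
  have [m Hm] := cf_bound h; apply: (H (wt m m).+1) => i j /Hm/andP[im jm].
  by rewrite ltnS /wt leq_add// leq_mul2r (ltnW im, ltnW jm) orbT.
elim: N => [|N IH] {}h Hh.
  apply: in_span_sub => //; have -> : h = 0; last exact: ideal20.
  by apply: bipP => i j; rewrite cf0; apply/eqP; apply: contraT => /Hh.
have [c [A [B E]]] := se (wpart N h).
have {}E : wpart N h = \sum_i (if w i == N then c i else 0) *: e i +
    (wpartd N a A * P0 + wpartd N b B * Q0).
  have -> : wpart N h = wpart N (wpart N h) by rewrite (wpart_homog (@homog_wpart _ _ _ _ _)).
  rewrite -[wpart N h in LHS](subrK (\sum_(i in setT) c i *: e i)) E addrC wpartD; congr (_ + _).
    rewrite sum_setT (big_morph (wpart N) (@wpartD _ _ _ N) (@wpart0 _ _ _ N)).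
    apply: eq_bigr => i _; rewrite wpartZ; case: eqP => [<-|ne].
      by rewrite (wpart_homog (He (i := i))).
    by rewrite (wpart_homog_ne (He (i := i))) ?scaler0 ?scale0r// eq_sym; apply/eqP.
  by rewrite wpartD !(wpartdM _ _ HP0, wpartdM _ _ HQ0).
pose h' := h - wpart N h - (wpartd N a A * P1 + wpartd N b B * Q1).
have -> : h = \sum_i (if w i == N then c i else 0) *: e i +
    ((wpartd N a A * P + wpartd N b B * Q) + h').
  by rewrite /h' E /P /Q; ring.
apply: in_spanD => //.
  apply: in_span_sum => // i _; apply: in_spanZ => //.
  exact: in_span_mem.
apply: in_spanD => //; first by apply: in_span_sub => //; eexists; eexists.
apply: IH => i j; rewrite /h' !cfB cfD cf_wpart.
have [->|] := eqVneq (cf (wpartd N a A * P1) i j) 0; last first.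
  by move=> /cfM_wt[u [v [u' [v' [/hshift_wpartd h1 /HP1 h2 h3]]]]] _; lia.
have [->|] := eqVneq (cf (wpartd N b B * Q1) i j) 0; last first.
  by move=> /cfM_wt[u [v [u' [v' [/hshift_wpartd h1 /HQ1 h2 h3]]]]] _; lia.
rewrite addr0 subr0; case: (wt i j =P N) => [|ne]; first by rewrite subrr eqxx.
by rewrite subr0 => /Hh; rewrite ltnS leq_eqVlt => /orP[/eqP|].
Qed.

(** Induction on a bound for the weights of the two products. Their top components form a relation
    for [P0] and [Q0], so the top coefficients [c] vanish and a Koszul syzygy remains. Subtracting
    the same multiple of the syzygy [(Q, - P)] lowers the bound. *)
Lemma lower_indep : indep (ideal2 P0 Q0) setT e -> indep (ideal2 P Q) setT e.
Proof.
move=> ie c [A [B E]].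
have [N [HA HB]] : exists N, (forall i j, cf A i j != 0 -> (wt i j + a < N)%N) /\
    (forall i j, cf B i j != 0 -> (wt i j + b < N)%N).
  have [p Hp] := cf_bound A; have [q Hq] := cf_bound B.
  exists (wt p p + wt q q + a + b).+1; split=> i j.
    move=> /Hp/andP[ip jp].
    by have := leq_mul (ltnW ip) (leqnn wx); have := leq_mul (ltnW jp) (leqnn wy); rewrite /wt; lia.
  move=> /Hq/andP[ip jp].
  by have := leq_mul (ltnW ip) (leqnn wx); have := leq_mul (ltnW jp) (leqnn wy); rewrite /wt; lia.
elim: N => [|N IH] in A B HA HB E *.
  have A0 : A = 0 by apply: bipP => i j; rewrite cf0; apply/eqP; apply: contraT => /HA.
  have B0 : B = 0 by apply: bipP => i j; rewrite cf0; apply/eqP; apply: contraT => /HB.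
  by apply: ie; rewrite E A0 B0 !mul0r addr0; exact: ideal20.
have Etop : wpart N (\sum_(i in setT) c i *: e i) = wpartd N a A * P0 + wpartd N b B * Q0.
  rewrite E /P /Q !mulrDr !wpartD (wpartdM _ _ HP0) (wpartdM _ _ HQ0).
  by rewrite (@wpart_lowM N a A P1)// (@wpart_lowM N b B Q1)// !addr0.
have top2 : wpart N (\sum_(i in setT) c i *: e i) = \sum_(i in setT) (if w i == N then c i else 0) *: e i.
  rewrite (big_morph (wpart N) (@wpartD _ _ _ N) (@wpart0 _ _ _ N)).
  apply: eq_bigr => i _; rewrite wpartZ; case: eqP => [<-|ne].
    by rewrite (wpart_homog (He (i := i))).
  by rewrite (wpart_homog_ne (He (i := i))) ?scaler0 ?scale0r// eq_sym; apply/eqP.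
have c0 i : (if w i == N then c i else 0) = 0.
  apply: (ie (fun i => if w i == N then c i else 0)); rewrite ?inE//.
  by rewrite -top2 Etop; eexists; eexists.
have : wpartd N a A * P0 + wpartd N b B * Q0 = 0.
  by rewrite -Etop top2 big1// => i _; rewrite c0 scale0r.
case/(koszul xM yM) => T [TA TB].
(* Only the component of [T] of weight [N - a - b] contributes to the top weight; keeping it alone
   controls the weights of [T' * Q1] and [T' * P1]. *)
pose T' := if (a + b <= N)%N then wpart (N - (a + b)) T else 0.
have T'Q i j : cf T' i j != 0 -> (wt i j + a + b = N)%N.
  rewrite /T'; case: leqP => abN; last by rewrite cf0 eqxx.
  by move/homog_wpart->; lia.
have EA : wpartd N a A = T' * Q0.
  have [aN|Na] := leqP a N; last first.
    by rewrite /wpartd leqNgt Na /= /T' leqNgt (leq_trans Na (leq_addr _ _)) mul0r.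
  have : wpart (N - a) (wpartd N a A) = wpart (N - a) (T * Q0) by rewrite TA.
  rewrite (wpartdM _ _ HQ0) {1}/wpartd aN (wpart_homog (@homog_wpart _ _ _ _ _)) /wpartd aN => ->.
  rewrite /T' leq_subRL//; case: leqP => // abN; congr (wpart _ _ * _); lia.
have EB : wpartd N b B = - (T' * P0).
  have [bN|Nb] := leqP b N; last first.
    by rewrite /wpartd leqNgt Nb /= /T' leqNgt (leq_trans Nb (leq_addl _ _)) mul0r oppr0.
  have : wpart (N - b) (wpartd N b B) = wpart (N - b) (- (T * P0)) by rewrite TB.
  rewrite wpartN (wpartdM _ _ HP0) {1}/wpartd bN (wpart_homog (@homog_wpart _ _ _ _ _)) /wpartd bN => ->.
  rewrite /T' leq_subRL// addnC; case: leqP => // abN; congr (- (wpart _ _ * _)); lia.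
have lowA k D : (forall i j, cf D i j != 0 -> (wt i j + k < N.+1)%N) ->
    forall i j, cf (D - wpartd N k D) i j != 0 -> (wt i j + k < N)%N.
  move=> HD i j; rewrite cfB /wpartd; case: (leqP k N) => kN.
    rewrite cf_wpart; case: (wt i j =P (N - k)%N) => e'; first by rewrite subrr eqxx.
    by rewrite subr0 => /HD; lia.
  by rewrite cf0 subr0 => /HD; lia.
apply: (IH (A - T' * Q) (B + T' * P)).
- move=> i j; have -> : A - T' * Q = (A - wpartd N a A) - T' * Q1 by rewrite EA /Q; ring.
  rewrite cfB; have [->|] := eqVneq (cf (T' * Q1) i j) 0.
    by rewrite subr0; exact: lowA.
  by move=> /cfM_wt[u [v [u' [v' [/T'Q h1 /HQ1 h2 h3]]]]] _; lia.
- move=> i j; have -> : B + T' * P = (B - wpartd N b B) + T' * P1 by rewrite EB /P; ring.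
  rewrite cfD; have [->|] := eqVneq (cf (T' * P1) i j) 0.
    by rewrite addr0; exact: lowA.
  by move=> /cfM_wt[u [v [u' [v' [/T'Q h1 /HP1 h2 h3]]]]] _; lia.
by rewrite E; ring.
Qed.
End LowerTerms.

(** * Homogeneous elements of the Jacobian ideal *)

Section Univariate.
Variable C : numClosedFieldType.
Implicit Types (p q : {poly C}).

(** Over an algebraically closed field multiplicities decide divisibility; the induction removes a
    root of [p] with its full multiplicity. *)
Lemma dvdp_multiplicity p q : p != 0 ->
  (forall r n, ('X - r%:P) ^+ n %| p -> ('X - r%:P) ^+ n %| q) -> p %| q.
Proof.
elim/ltn_ind: {p}(size p) {-2}p (erefl (size p)) q => s IH p sp q p0 H.
have [/eqP/size_poly1P[c c0 ->]|/closed_rootP[r rp]] := eqVneq (size p) 1%N.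
  by rewrite -[c%:P]mulr1 mul_polyC dvdpZl// dvd1p.
have [n [p1 + pE]] := multiplicity_XsubC p r; rewrite p0/= => np1.
have : ('X - r%:P) ^+ n %| q by apply: H; rewrite pE dvdp_mull.
case/dvdpP => q1 qE; rewrite pE qE.
have X0 : ('X - r%:P) ^+ n != 0 by rewrite expf_neq0// polyXsubC_eq0.
have p10 : p1 != 0 by apply: contraNneq p0 => p10; rewrite pE p10 mul0r.
rewrite dvdp_mul2r//; apply: (IH _ _ _ erefl) => //.
  rewrite -sp pE size_mul// size_exp_XsubC addnS/=.
  case: n pE {X0 qE} => [|n _]; last by rewrite addnS ltnS leq_addr.
 by rewrite expr0 mulr1 => pE'; exfalso; move/negP: np1; apply; rewrite -pE'.
move=> a k Ha; have [ar|ar] := eqVneq a r.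
  case: k Ha => [|k]; first by rewrite expr0 !dvd1p.
  move=> /(dvdp_trans _) H'; case/negP: np1; rewrite -dvdp_XsubCl -ar.
  by apply: H'; rewrite exprS dvdp_mulr.
have := H a k; rewrite pE dvdp_mulr// qE mulrC Gauss_dvdpr; first by apply.
rewrite coprimep_expl// coprimep_expr// coprimep_XsubC2// subr_eq0 eq_sym//.
Qed.

(* At a root of [g], the form
   [e g f' - w f g'] vanishes to order at most that of [g], as [f] has only
   simple roots there and [e < w]. *)
Lemma wronskian_dvd (f g : {poly C}) (e w k : nat) p :
  coprimep f f^`() -> g != 0 -> (0 < e)%N -> (e < w)%N ->
  e%:R * g * f^`() - w%:R * f * g^`() %| (f * g) ^+ k * p ->
  e%:R * g * f^`() - w%:R * f * g^`() %| g * p.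
Proof.
set d := _ - _ => cf g0 e0 ew H.
have f0 : f != 0.
  by apply: contraTneq cf => ->; rewrite deriv0 coprimep0 -size_poly_eq1 size_poly0.
have simple r : root f r -> ~~ root f^`() r.
  by move=> fr; exact: coprimep_root cf fr.
have natX (n : nat) r : (n%:R : {poly C}).[r] = n%:R by rewrite -polyC_natr hornerC.
have [d0|d0] := eqVneq d 0.
  move: H; rewrite d0 !dvd0p !mulf_eq0 expf_eq0 mulf_eq0 (negPf f0) (negPf g0) !andbF/=.
  by [].
apply: dvdp_multiplicity => // r n dn.
(* Outside the roots of [g], a root of [f] is not a root of [d], which equals [e g f'] there with
   [f'] nonzero. Otherwise [f g] is prime to [X - r] and its power can be cancelled. *)
have [gr|gr] := boolP (root g r); last first.
  have [->|n0] := posnP n; first by rewrite expr0 dvd1p.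
  apply: dvdp_mull.
  have fr : ~~ root f r.
    apply/negP => fr; have : root d r.
      rewrite -dvdp_XsubCl; apply: dvdp_trans dn.
      by rewrite -(prednK n0) exprS dvdp_mulr.
    rewrite rootE /d !hornerE !natX (rootP fr) mulr0 mul0r subr0 !mulf_eq0 pnatr_eq0.
    by rewrite gtn_eqF//= -!rootE (negPf gr) (negPf (simple _ fr)).
  have := dvdp_trans dn H; rewrite Gauss_dvdpr// coprimep_expl// coprimep_expr//.
  by rewrite coprimep_sym coprimep_XsubC rootM negb_or fr gr.
apply: dvdp_mulr.
have [m [g1 + gE]] := multiplicity_XsubC g r; rewrite g0/= => g1r.
case: m gE => [|m] gE; first by rewrite expr0 mulr1 in gE; exfalso; move/negP: g1r; apply; rewrite -gE.
suff nm : (n <= m.+1)%N.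
  by apply: dvdp_trans (dvdp_exp2l _ nm) _; rewrite gE dvdp_mull.
rewrite leqNgt; apply/negP => mn.
(* With [g = (X - r)^(m+1) g1], this is the cofactor of [(X - r)^m] in [d]; if the multiplicity of
   [d] exceeded that of [g], it would be divisible by [(X - r)^2]. *)
pose br := e%:R * ('X - r%:P) * g1 * f^`() - w%:R * f * (m.+1%:R * g1 + ('X - r%:P) * g1^`()).
have dE : d = ('X - r%:P) ^+ m * br.
  rewrite /d /br gE derivM deriv_exp derivXsubC/= exprS -mulr_natl; ring.
have X0 k' : ('X - r%:P) ^+ k' != 0 by rewrite expf_neq0// polyXsubC_eq0.
have br2 : ('X - r%:P) ^+ 2 %| br.
  rewrite -(dvdp_mul2l _ _ (X0 m)) -exprD addn2 -dE.
  exact: dvdp_trans (dvdp_exp2l _ mn) dn.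
have g1r0 : g1.[r] != 0 by rewrite -rootE.
have [fr|fr] := boolP (root f r); last first.
  have : root br r by rewrite -dvdp_XsubCl; apply: dvdp_trans br2; rewrite expr2 dvdp_mulr.
  rewrite rootE /br !hornerE !natX subrr !(mulr0, mul0r) addr0 sub0r oppr_eq0 !mulf_eq0.
  rewrite (negPf g1r0) -rootE (negPf fr) !pnatr_eq0 /= !orbF.
  by rewrite gtn_eqF// (leq_trans _ ew).
have /dvdpP[f1 fE] : 'X - r%:P %| f by rewrite dvdp_XsubCl.
have f1r : f1.[r] != 0.
  by have := simple _ fr; rewrite rootE fE derivM derivXsubC !hornerE subrr mulr0 add0r.
have bE : br = ('X - r%:P) * (e%:R * g1 * f^`() - w%:R * f1 * (m.+1%:R * g1 + ('X - r%:P) * g1^`())).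
  by rewrite /br {2}fE; ring.
have : root (e%:R * g1 * f^`() - w%:R * f1 * (m.+1%:R * g1 + ('X - r%:P) * g1^`())) r.
  rewrite -dvdp_XsubCl -(dvdp_mul2l _ _ (X0 1%N)) expr1 -expr2 -bE; exact: br2.
rewrite rootE fE derivM derivXsubC !hornerE !natX subrr !(mulr0, mul0r) add0r addr0.
(* At a common root the value is [e - w (m + 1)] up to a nonzero factor, and [e < w] forbids its
   vanishing. *)
have -> : e%:R * g1.[r] * f1.[r] - w%:R * f1.[r] * (m.+1%:R * g1.[r]) =
  (e%:R - (w * m.+1)%:R) * (g1.[r] * f1.[r]) by rewrite natrM; ring.
rewrite !mulf_eq0 (negPf g1r0) (negPf f1r) !orbF subr_eq0 eqr_nat => /eqP E.
by move: ew; rewrite E ltnNge leq_pmulr.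
Qed.
End Univariate.

Section Swap.
Variable C : numClosedFieldType.
Local Notation R := (bip C).
Implicit Types (h A B P Q : R).

Definition swapxy (h : R) : R := swapXY h.
Lemma cf_swapxy h i j : cf (swapxy h) i j = cf h j i.
Proof. by rewrite /cf /swapxy coef_swapXY. Qed.
Lemma swapxyK : involutive swapxy. Proof. exact: swapXYK. Qed.
Lemma swapxyD h A : swapxy (h + A) = swapxy h + swapxy A. Proof. exact: rmorphD. Qed.
Lemma swapxyN h : swapxy (- h) = - swapxy h.
Proof. by apply: bipP => i j; rewrite cfN !cf_swapxy cfN. Qed.
Lemma swapxyM h A : swapxy (h * A) = swapxy h * swapxy A. Proof. exact: rmorphM. Qed.
Lemma swapxy_mon i j : swapxy (mon i j) = mon j i.
Proof. by apply: bipP => k l; rewrite cf_swapxy !cf_mon andbC. Qed.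
Lemma swapxy_dx h : swapxy (dx h) = dy (swapxy h).
Proof. by apply: bipP => k l; rewrite cf_swapxy cf_dx cf_dy cf_swapxy. Qed.
Lemma swapxy_dy h : swapxy (dy h) = dx (swapxy h).
Proof. by apply: bipP => k l; rewrite cf_swapxy cf_dx cf_dy cf_swapxy. Qed.
Lemma swapxy_homog wx wy n h : homog wx wy n h -> homog wy wx n (swapxy h).
Proof. by move=> H i j; rewrite cf_swapxy => /H <-; rewrite /wt addnC. Qed.
Lemma swapxy_ideal2 P Q h : ideal2 P Q h -> ideal2 (swapxy Q) (swapxy P) (swapxy h).
Proof. by move=> [A [B ->]]; exists (swapxy B), (swapxy A); rewrite swapxyD !swapxyM addrC. Qed.
Lemma swapxy_jac P h : jac P h -> jac (swapxy P) (swapxy h).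
Proof. by move/swapxy_ideal2; rewrite /jac swapxy_dx swapxy_dy. Qed.
End Swap.

Section Wronskian.
Variable C : numClosedFieldType.
Local Notation R := (bip C).
Implicit Types (h A B T P F g : R).

Definition jacobian F g : R := dx F * dy g - dy F * dx g.

Lemma natr_bscale (n : nat) (h : R) : n%:R * h = (n%:R : C) *: h.
Proof. by rewrite bscaleE -!polyC_natr. Qed.

Lemma euler wx wy n h : homog wx wy n h ->
  wx%:R * (mon 1 0 * dx h) + wy%:R * (mon 0 1 * dy h) = n%:R * h.
Proof.
move=> H; apply: bipP => i j; rewrite cfD !natr_bscale !cfZ !cf_monM !leq0n !subn0 andbT/=.
have -> : (if (0 < i)%N then cf (dx h) (i - 1) j else 0) = cf h i j *+ i.
  by case: i => [|i] /=; rewrite ?mulr0n// cf_dx subn1.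
have -> : (if (0 < j)%N then cf (dy h) i (j - 1) else 0) = cf h i j *+ j.
  by case: j => [|j] /=; rewrite ?mulr0n// cf_dy subn1.
have [->|/H <-] := eqVneq (cf h i j) 0; first by rewrite !mul0rn !mulr0 addr0.
by rewrite /wt natrD !natrM -[_ *+ i]mulr_natl -[_ *+ j]mulr_natl; ring.
Qed.

Lemma dehomog_dx h : dehomog (dx h) = (dehomog h)^`().
Proof. by rewrite /dehomog /dx deriv_map. Qed.

Lemma dehomog_mon i j : dehomog (@mon C i j) = 'X^i.
Proof.
rewrite /dehomog mon.unlock rmorphM/= map_polyXn map_polyC/= horner_evalE hornerXn expr1n.
by rewrite mulr1.
Qed.

Lemma dehomog_nat (n : nat) : dehomog (@GRing.natmul R 1 n) = n%:R.
Proof. by rewrite /dehomog rmorph_nat. Qed.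

Section Chart.
Variables (wx wy W e t M : nat) (F g P : R).
Hypotheses (wx0 : (0 < wx)%N) (wy0 : (0 < wy)%N).
Hypotheses (HF : homog wx wy W F) (Hg : homog wx wy e g) (HP : homog wx wy t P).
Hypotheses (e0 : (0 < e)%N) (eW : (e < W)%N) (g0 : g != 0).
Hypothesis yM : jac F (mon 0 M).
Hypothesis PJ : jac (F + g) P.

(** At [y = 1] the power of [y] in the Jacobian ideal becomes 1, and Euler's relation expresses the
    derivative in [y] by the restriction of [F] and its derivative. So this restriction has simple
    roots. *)
Lemma coprime_chart : coprimep (dehomog F) (dehomog F)^`().
Proof.
have [A [B E]] := yM.
apply/Bezout_eq1_coprimepP; exists (dehomog B * (W%:R / wy%:R)%:P, dehomog A - dehomog B * (wx%:R / wy%:R)%:P * 'X).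
have wyC : (wy%:R : C) != 0 by rewrite pnatr_eq0 -lt0n.
have := congr1 (@dehomog C) E; rewrite dehomog_mon expr0 dehomogD !dehomogM dehomog_dx => ->.
have := congr1 (@dehomog C) (euler HF); rewrite dehomogD !dehomogM !dehomog_nat !dehomog_mon dehomog_dx expr0 expr1 mul1r => E2.
have -> : dehomog (dy F) = (wy%:R^-1)%:P * (W%:R * dehomog F - wx%:R * ('X * (dehomog F)^`())).
  by rewrite -E2 addrC addKr mulrA -polyC_natr -polyCM mulVf// mul1r.
rewrite /= !polyCM !polyC_natr; ring.
Qed.

Lemma jacobian_homog : homog wx wy (W + e - wx - wy) (jacobian F g).
Proof.
have H (h A : R) n m : homog wx wy n h -> homog wx wy m A ->
    homog wx wy (n + m - wx - wy) (dx h * dy A).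
  move=> Hh HA i j /(@cfM_wt _ wx wy)[u [v [u' [v' []]]]] H1 H2 ->.
  move: H1 H2; rewrite cf_dx cf_dy !mulrn_eq0/= => /Hh E1 /HA E2.
  by move: E1 E2; rewrite /wt !mulSn; lia.
rewrite /jacobian; apply: homogB; first exact: (H _ _ _ _ HF Hg).
by rewrite mulrC addnC; exact: (H _ _ _ _ Hg HF).
Qed.

(** Euler's relations for [F] and [g] eliminate the derivatives in [y]; at [y = 1] the result is the
    form of [wronskian_dvd]. *)
Lemma wronskianE : wy%:R * (mon 0 1 * jacobian F g) = e%:R * g * dx F - W%:R * F * dx g.
Proof.
rewrite /jacobian.
have -> : wy%:R * (mon 0 1 * (dx F * dy g - dy F * dx g)) =
  dx F * (wy%:R * (mon 0 1 * dy g)) - dx g * (wy%:R * (mon 0 1 * dy F)) by ring.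
have E h n : homog wx wy n h -> wy%:R * (mon 0 1 * dy h) = n%:R * h - wx%:R * (mon 1 0 * dx h).
  by move=> /euler <-; ring.
by rewrite (E _ _ HF) (E _ _ Hg); ring.
Qed.

(** A principal ideal, written with a second generator 0 in order to use the lemmas on [ideal2]. *)
Let J := ideal2 (jacobian F g) 0.

Lemma J_nat (n : nat) h : (0 < n)%N -> J (n%:R * h) -> J h.
Proof.
move=> n0 /(ideal2Z n%:R^-1); rewrite natr_bscale scalerA mulVf ?scale1r//.
by rewrite pnatr_eq0 -lt0n.
Qed.

(** Let [A], [B] be coefficients of [P] on the partials of [F + g] and [D = A g_x + B g_y]. Euler's
    relations give [e g P = W F D + e g D] modulo [J]. In a weight [n] other than [e + t] this links
    the components of [D] of weights [n - W] and [n - e]. Going up from weight 0, powers of [g]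
    bring the components of weight below [t] into [J]; going down from the vanishing ones, powers of
    [F] do so from weight [t] on. In weight [e + t] one component of each kind accompanies [g P]. *)
Lemma wronskian_mem : exists k, J ((F * g) ^+ k * (g * P)).
Proof.
have [A [B PE]] := PJ.
pose D := A * dx g + B * dy g.
have H0 : J (e%:R * g * P - (W%:R * (D * F) + e%:R * (D * g))).
  exists (wy%:R * mon 0 1 * A - wx%:R * mon 1 0 * B), 0.
  have -> : e%:R * g * P - (W%:R * (D * F) + e%:R * (D * g)) =
    (e%:R * g) * P - D * (W%:R * F) - D * (e%:R * g) by ring.
  by rewrite -(euler HF) -(euler Hg) PE dxD dyD /D /jacobian; ring.
have HJ := jacobian_homog.
have comps n : J (e%:R * wpart wx wy n (g * P) - (W%:R * (wpartd wx wy n W D * F) + e%:R * (wpartd wx wy n e D * g))).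
  have := wpart_ideal2 HJ (@homog0 C wx wy 0) n H0.
  rewrite wpartB wpartD -mulrA !natr_bscale !wpartZ !(wpartdM _ _ HF) !(wpartdM _ _ Hg).
  by [].
have gP : homog wx wy (e + t) (g * P) by exact: homogM.
have up i : (i < t)%N -> exists k, J (g ^+ k * wpart wx wy i D).
  elim/ltn_ind: i => i IH it.
  have := comps (i + e)%N; rewrite (wpart_homog_ne gP); last by rewrite addnC eqn_add2l ltn_eqF.
  rewrite mulr0 sub0r => /ideal2N; rewrite opprK {2}/wpartd leq_addl addnK.
  rewrite /wpartd; case: leqP => We; last first.
    rewrite mul0r mulr0 add0r => /(J_nat e0) H.
    by exists 1%N; rewrite expr1 mulrC.
  have [||k Hk] := IH (i + e - W)%N; [lia|lia|].
  move=> H; exists k.+1; apply: (J_nat e0).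
  have -> : e%:R * (g ^+ k.+1 * wpart wx wy i D) =
    g ^+ k * (W%:R * (wpart wx wy (i + e - W) D * F) + e%:R * (wpart wx wy i D * g))
     - W%:R * F * (g ^+ k * wpart wx wy (i + e - W) D) by rewrite exprSr; ring.
  by apply: ideal2B; exact: ideal2M.
have [N HN] := wpart_large wx wy D.
have down i : (t + e < i + W)%N -> exists k, J (F ^+ k * wpart wx wy i D).
  have [n] := ubnP (N - i)%N; elim: n i => [//|n IH] i ni it.
  have [Ni|iN] := leqP N i; first by exists 0%N; rewrite HN// mulr0; exact: ideal20.
  have := comps (i + W)%N; rewrite (wpart_homog_ne gP); last by apply/eqP; lia.
  rewrite mulr0 sub0r => /ideal2N; rewrite opprK {1}/wpartd leq_addl addnK.
  rewrite /wpartd (leq_trans (ltnW eW) (leq_addl _ _)) => H.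
  have [||k Hk] := IH (i + W - e)%N; [lia|lia|].
  exists k.+1; apply: (J_nat (leq_ltn_trans (leq0n _) eW)).
  have -> : W%:R * (F ^+ k.+1 * wpart wx wy i D) =
    F ^+ k * (W%:R * (wpart wx wy i D * F) + e%:R * (wpart wx wy (i + W - e) D * g))
     - e%:R * g * (F ^+ k * wpart wx wy (i + W - e) D) by rewrite exprSr; ring.
  by apply: ideal2B; exact: ideal2M.
have := comps (e + t)%N; rewrite (wpart_homog gP) {2}/wpartd leq_addr addKn.
have [k Hk] : exists k, J (F ^+ k * wpart wx wy t D) by apply: down; lia.
rewrite /wpartd; case: leqP => Wet.
  have [k' Hk'] : exists k, J (g ^+ k * wpart wx wy (e + t - W) D) by apply: up; lia.
  move=> H; exists (k + k')%N; apply: (J_nat e0).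
  rewrite exprMn.
  have -> : e%:R * (F ^+ (k + k') * g ^+ (k + k') * (g * P)) =
    F ^+ (k + k') * g ^+ (k + k') * (e%:R * (g * P) - (W%:R * (wpart wx wy (e + t - W) D * F) + e%:R * (wpart wx wy t D * g)))
    + F ^+ (k + k') * g ^+ k * F * W%:R * (g ^+ k' * wpart wx wy (e + t - W) D)
    + F ^+ k' * g ^+ (k + k') * e%:R * g * (F ^+ k * wpart wx wy t D).
    by rewrite !exprD; ring.
  by apply: ideal2D; [apply: ideal2D|]; exact: ideal2M.
move=> H; exists k; apply: (J_nat e0).
rewrite exprMn.
have -> : e%:R * (F ^+ k * g ^+ k * (g * P)) =
  F ^+ k * g ^+ k * (e%:R * (g * P) - (W%:R * (0 * F) + e%:R * (wpart wx wy t D * g)))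
  + g ^+ k * e%:R * g * (F ^+ k * wpart wx wy t D) by ring.
by apply: ideal2D; exact: ideal2M.
Qed.

(** At [y = 1], [wronskian_dvd] removes the powers of [F] and [g] left by [wronskian_mem];
    [homogenize] returns to two variables at the cost of a power of [y]. *)
Lemma chart_dvd : exists N U, mon 0 N * (g * P) = jacobian F g * U.
Proof.
have [k [U [V E]]] := wronskian_mem; rewrite mulr0 addr0 in E.
have wyC : (wy%:R : C) != 0 by rewrite pnatr_eq0 -lt0n.
pose d := e%:R * dehomog g * (dehomog F)^`() - W%:R * dehomog F * (dehomog g)^`().
have dE : wy%:R * dehomog (jacobian F g) = d.
  have := congr1 (@dehomog C) wronskianE.
  by rewrite dehomogB !dehomogM !dehomog_nat !dehomog_dx dehomog_mon expr0 mul1r.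
(* If [g] were [(y - 1) S], comparing weights would make [- y^r g] the component of [S] of weight
   [e + r wy] for every [r], which no polynomial allows. *)
have g1 : dehomog g != 0.
  apply: contraNneq g0 => /dehomog_eq0 [S gS].
  have HY : homog wx wy wy (mon 0 1 : R) by have := @homog_mon C wx wy 0 1; rewrite /wt mul0n mul1n.
  have HS n : wpart wx wy n (S * mon 0 1) - wpart wx wy n S = wpart wx wy n g.
    by rewrite -wpartB gS; congr wpart; ring.
  have low n : (n < e)%N -> wpart wx wy n S = 0.
    elim/ltn_ind: n => n IH ne; have := HS n; rewrite (wpart_homog_ne Hg) ?ltn_eqF//.
    have [nw|wn] := ltnP n wy; first by rewrite (wpartMr0 _ HY nw) sub0r => /eqP; rewrite oppr_eq0 => /eqP.
    rewrite -{1}(subnK wn) (wpartMr _ _ HY) IH ?mul0r ?sub0r; [|lia|lia].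
    by move/eqP; rewrite oppr_eq0 => /eqP.
  have [N HN] := wpart_large wx wy S.
  have high r : wpart wx wy (e + r * wy) S + mon 0 r * g = 0.
    elim: r => [|r IH].
      rewrite mul0n addn0 mon00 mul1r; have := HS e; rewrite (wpart_homog Hg) => <-.
      rewrite addrC subrK; have [nw|wn] := ltnP e wy; first by rewrite (wpartMr0 _ HY nw).
      by rewrite -(subnK wn) (wpartMr _ _ HY) low ?mul0r//; lia.
    have := HS (e + r * wy + wy)%N; rewrite (wpartMr _ _ HY) (wpart_homog_ne Hg); last by lia.
    have -> : (e + r.+1 * wy = e + r * wy + wy)%N by rewrite mulSn; lia.
    move/eqP; rewrite subr_eq0 => /eqP <-.
    have -> : mon 0 r.+1 = mon 0 1 * mon 0 r :> R by rewrite monM.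
    by rewrite mulrC -mulrA -mulrDr IH mulr0.
  have := high N; rewrite HN; last by rewrite (leq_trans _ (leq_addl _ _))// leq_pmulr.
  by rewrite add0r => /eqP; rewrite mulf_eq0 (negPf (mon_neq0 _ _ _)).
have H1 : d %| (dehomog F * dehomog g) ^+ k.+1 * dehomog P.
  apply/dvdpP; exists ((wy%:R^-1)%:P * dehomog U * dehomog F).
  have eyX h n : dehomog (h ^+ n) = dehomog h ^+ n by exact: rmorphXn.
  have := congr1 (@dehomog C) E; rewrite !dehomogM eyX !dehomogM => E'.
  rewrite exprSr [LHS](_ : _ = dehomog F * ((dehomog F * dehomog g) ^+ k * (dehomog g * dehomog P))); last by ring.
  rewrite E' -dE -polyC_natr.
  rewrite [RHS](_ : _ = (wy%:R^-1)%:P * (wy%:R)%:P * (dehomog F * (dehomog U * dehomog (jacobian F g)))); last by ring.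
  by rewrite -polyCM mulVf// mul1r.
have /dvdpP[q qE] := wronskian_dvd coprime_chart g1 e0 eW H1.
have E2 : dehomog (g * P) = q * wy%:R * dehomog (jacobian F g) + 0 * dehomog 0.
  by rewrite dehomogM qE -/d -dE mul0r addr0; ring.
have [N [U' [V' E3]]] := homogenize jacobian_homog (@homog0 C wx wy 0) wy0 (homogM Hg HP) E2.
by exists N, U'; rewrite E3 mulr0 addr0 mulrC.
Qed.
End Chart.

(** The chart [x = 1] is reached by exchanging the variables, which changes the sign of the Jacobian
    determinant; [dvd_charts] combines the two charts. *)
Lemma homog_mem_dvd wx wy W e t M F g P :
  (0 < wx)%N -> (0 < wy)%N -> homog wx wy W F -> homog wx wy e g -> homog wx wy t P ->
  (0 < e)%N -> (e < W)%N -> g != 0 -> jac F (mon M 0) -> jac F (mon 0 M) ->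
  jac (F + g) P -> exists S, g * P = jacobian F g * S.
Proof.
move=> wx0 wy0 HF Hg HP e0 eW g0 xM yM PJ.
have [N [U E1]] := chart_dvd wx0 wy0 HF Hg HP e0 eW g0 yM PJ.
have [|||N' [U' E2]] := chart_dvd wy0 wx0 (swapxy_homog HF) (swapxy_homog Hg) (swapxy_homog HP) e0 eW _
  (M := M) _ (_ : jac (swapxy F + swapxy g) (swapxy P)).
- by apply: contraNneq g0 => E; rewrite -[g]swapxyK E /swapxy rmorph0.
- by rewrite -swapxy_mon; exact: swapxy_jac.
- by rewrite -swapxyD; exact: swapxy_jac.
apply: (@dvd_charts C N' N (jacobian F g) (g * P) U (- swapxy U') E1).
have := congr1 (@swapxy C) E2; rewrite !swapxyM swapxy_mon !swapxyK => ->.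
have -> : swapxy (jacobian (swapxy F) (swapxy g)) = - jacobian F g.
  by rewrite /jacobian swapxyD swapxyN !swapxyM -!swapxy_dx -!swapxy_dy !swapxyK; ring.
by rewrite mulNr mulrN.
Qed.
End Wronskian.

(** * The local codimension *)

Section LocalIdeal.
Variable C : numClosedFieldType.
Local Notation R := (bip C).
Implicit Types (h A B T P Q F g : R).

(* [ordw 1 1 N] is the [N]-th power of the ideal of the origin. *)
Definition locid P Q N h := exists A B, ordw 1 1 N (h - (A * P + B * Q)).
Definition locjac F N := locid (dx F) (dy F) N.

Lemma ordw0 wx wy N : ordw wx wy N (0 : R). Proof. by move=> i j _; exact: cf0. Qed.

Lemma subspace_locid P Q N : subspace (locid P Q N).
Proof.
split; first by exists 0, 0; rewrite !mul0r addr0 subr0; exact: ordw0.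
move=> c u v [A [B H]] [A' [B' H']]; exists (c *: A + A'), (c *: B + B').
have -> : c *: u + v - ((c *: A + A') * P + (c *: B + B') * Q) =
   c *: (u - (A * P + B * Q)) + (v - (A' * P + B' * Q)) by rewrite !bscaleE; ring.
by move=> i j ij; rewrite cfD cfZ H// H'// mulr0 addr0.
Qed.

Lemma locid_ideal2 P Q N h : ideal2 P Q h -> locid P Q N h.
Proof.
by move=> [A [B ->]]; exists A, B; rewrite subrr; exact: ordw0.
Qed.
Lemma locid_ord P Q N h : ordw 1 1 N h -> locid P Q N h.
Proof. by exists 0, 0; rewrite !mul0r addr0 subr0. Qed.
Lemma locid_leq P Q N N' h : (N <= N')%N -> locid P Q N' h -> locid P Q N h.
Proof. by move=> NN [A [B H]]; exists A, B; exact: ordw_leq H. Qed.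

Lemma ordw_expand wx wy N h (J : R -> Prop) : subspace J ->
  ordw wx wy N h -> (forall i j, (N <= wt wx wy i j)%N -> J (mon i j)) -> J h.
Proof.
move=> sJ Hh HJ; have [n Hn] := cf_bound h; rewrite (bip_expand Hn).
apply: subspace_sum => // -[i j] _ /=.
have [ij|ij] := ltnP (wt wx wy i j) N; first by rewrite Hh// scale0r; exact: subspace0.
by apply: subspaceZ => //; exact: HJ.
Qed.

(** A monomial of degree at least [2 M] has an exponent at least [M]. *)
Lemma ord_jac P Q M N h : ideal2 P Q (mon M 0) -> ideal2 P Q (mon 0 M) ->
  (2 * M <= N)%N -> ordw 1 1 N h -> ideal2 P Q h.
Proof.
move=> xM yM MN Hh; apply: (ordw_expand (subspace_ideal2 P Q) Hh) => i j.
rewrite /wt !muln1 => Nij.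
have [Mi|iM] := leqP M i.
  by rewrite -(subnK Mi) -[j in mon _ j]addn0 -monM; exact: ideal2M.
have Mj : (M <= j)%N by lia.
by rewrite -(subnK Mj) -[i in mon i]addn0 -monM; exact: ideal2M.
Qed.
End LocalIdeal.

(** * Counting the classes of large weight *)

Section Count.
Variable C : numClosedFieldType.
Local Notation R := (bip C).
Implicit Types (h A B T P Q F g : R).

Lemma subspace_eq0 (V : lmodType C) : subspace (fun h : V => h = 0).
Proof. by split=> // c u v -> ->; rewrite scaler0 addr0. Qed.

Lemma homog_sum wx wy n (I : finType) (p : pred I) (f : I -> R) :
  (forall i, p i -> homog wx wy n (f i)) -> homog wx wy n (\sum_(i | p i) f i).
Proof. by move=> H; elim/big_ind: _ => //; [exact: homog0|exact: homogD]. Qed.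

Lemma dx_sum (I : finType) (p : pred I) (f : I -> R) :
  dx (\sum_(i | p i) f i) = \sum_(i | p i) dx (f i).
Proof. by rewrite /dx raddf_sum. Qed.

(** [F] is the part of largest weight of [F + g], so monomials forming a basis for [F] still form
    one. This counts all critical points in the plane, including those away from the origin. *)
Lemma codim_jac_lower wx wy W M F :
  (0 < wx)%N -> (0 < wy)%N -> homog wx wy W F -> jac F (mon M 0) -> jac F (mon 0 M) ->
  exists2 m, codim (jac F) m &
    forall e g, homog wx wy e g -> (e < W)%N -> codim (jac (F + g)) m.
Proof.
move=> wx0 wy0 HF xM yM.
have [m [b [ib sb]]] := mon_basis xM yM.
exists m; first by exists (fun i => mon (b i).1 (b i).2).
move=> e g Hg eW; exists (fun i => mon (b i).1 (b i).2).
have H0 : homog wx wy (W - wx) (dx F) by exact: homog_dx.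
have H1 : homog wx wy (W - wy) (dy F) by exact: homog_dy.
have L0 i j : cf (dx g) i j != 0 -> (wt wx wy i j < W - wx)%N.
  by rewrite cf_dx mulrn_eq0/= => /Hg; rewrite /wt mulSn; lia.
have L1 i j : cf (dy g) i j != 0 -> (wt wx wy i j < W - wy)%N.
  by rewrite cf_dy mulrn_eq0/= => /Hg; rewrite /wt mulSn; lia.
rewrite /jac dxD dyD; split.
  exact: (lower_indep H0 H1 L0 L1 xM yM (fun i => @homog_mon C wx wy (b i).1 (b i).2)).
exact: (lower_span H0 H1 L0 L1 (fun i => @homog_mon C wx wy (b i).1 (b i).2)).
Qed.

Section Bound.
Variables (wx wy W e M : nat) (F g : R).
Hypotheses (wx0 : (0 < wx)%N) (wy0 : (0 < wy)%N).
Hypotheses (HF : homog wx wy W F) (Hg : homog wx wy e g).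
Hypotheses (e0 : (0 < e)%N) (eW : (e < W)%N) (g0 : g != 0).
Hypotheses (xM : jac F (mon M 0)) (yM : jac F (mon 0 M)).

(* [P -> S], [g P = jacobian F g * S], injects the homogeneous part of weight [t]
   of the ideal into the space of homogeneous polynomials of weight [t']. *)
Lemma jac_count t t' (I L : finType) (z : I -> R) (y : L -> R) :
  (t' + (W + e - wx - wy) = e + t)%N ->
  (forall i, homog wx wy t (z i)) -> indep (fun h => h = 0) setT z ->
  (forall S, homog wx wy t' S -> in_span (fun h => h = 0) setT y S) ->
  exists A : {set I}, indep (jac (F + g)) A z /\ (#|I| <= #|A| + #|L|)%N.
Proof.
move=> tt' Hz iz Hy.
have [A [c [iA]]] := @exchange _ _ (fun h => h = 0) (jac (F + g)) I z (@subspace_eq0 R) (subspace_ideal2 _ _) iz.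
set u := fun k => _ => -[Ju iu]; exists A; split=> //.
rewrite -(cardsC A) leq_add2l -[X in (_ <= X)%N]cardsT.
have Hu k : homog wx wy t (u k).
  by apply: homogB => //; apply: homog_sum => j _; exact: homogZ.
have /choice[s Hs] k : exists S, homog wx wy t' S /\ g * u k = jacobian F g * S.
  have [S HS] := homog_mem_dvd wx0 wy0 HF Hg (Hu k) e0 eW g0 xM yM (Ju k).
  exists (wpart wx wy t' S); split; first exact: homog_wpart.
  have := congr1 (wpart wx wy (e + t)) HS.
  rewrite (wpart_homog (homogM Hg (Hu k))) => ->.
  by rewrite -tt' mulrC (wpartMr _ _ (jacobian_homog wx0 wy0 HF Hg e0 eW g0)) mulrC.
apply: (@steinitz _ _ (fun h => h = 0) I L (~: A) setT s y (@subspace_eq0 R)); last first.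
  by move=> i _; apply: Hy; exact: (Hs i).1.
move=> d Hd; apply: iu; apply: (mulfI g0); rewrite mulr0 mulr_sumr.
rewrite (eq_bigr (fun i => jacobian F g * (d i *: s i))); last first.
  by move=> i _; rewrite !bscaleAr (Hs i).2.
by rewrite -mulr_sumr Hd mulr0.
Qed.
End Bound.

Lemma cf_mon_sum (I : finType) (f : I -> nat * nat) (c : I -> C) i j :
  cf (\sum_(k in setT) c k *: mon (f k).1 (f k).2 : R) i j =
  \sum_(k | f k == (i, j)) c k.
Proof.
rewrite cf_sum [RHS]big_mkcond; apply: eq_big => [k|k _]; first by rewrite inE.
rewrite cfZ cf_mon -[f k == _]/(((f k).1 == i) && ((f k).2 == j)) [i == _]eq_sym [j == _]eq_sym.
by case: ifP; rewrite ?mulr1 ?mulr0.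
Qed.

Lemma indep_mon (I : finType) (f : I -> nat * nat) : injective f ->
  indep (fun h : R => h = 0) setT (fun i => mon (f i).1 (f i).2).
Proof.
move=> fi c Hc i _; have := congr1 (fun h => cf h (f i).1 (f i).2) Hc.
by rewrite cf0 cf_mon_sum -surjective_pairing (big_pred1 i) // => k; apply/eqP/eqP => [/fi|->].
Qed.

Lemma span_mon wx wy t (L : finType) (f : L -> nat * nat) S :
  (forall i j, wt wx wy i j = t -> exists l, f l = (i, j)) -> homog wx wy t S ->
  in_span (fun h : R => h = 0) setT (fun i => mon (f i).1 (f i).2) S.
Proof.
move=> Hf HS; have [n Hn] := cf_bound S; rewrite (bip_expand Hn).
have s0 := @subspace_eq0 R.
apply: in_span_sum => // -[i j] _ /=; have [->|/HS/Hf[l fl]] := eqVneq (cf S i j) 0.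
  by rewrite scale0r; exact: in_span_sub.
apply: in_spanZ => //.
by have := in_span_mem s0 (fun l => mon (f l).1 (f l).2) (in_setT l); rewrite /= fl.
Qed.

(** The number of monomials of weight [X px qx] minus that of weight
    [(X - d) px qx + (1 - k) qx + (1 - l) px]. The latter are in general [x^(1-k) y^(1-l)] times a
    monomial in [x^px] and [y^qx]; if [px = 1] (or [qx = 1]) no congruence keeps the exponent of [x]
    (or [y]) from being smaller, and [1 - k] (or [1 - l]) more occur. *)
Definition jump_bound (k l px qx d : nat) :=
  (d - (if px == 1 then 1 - k else 0) - (if qx == 1 then 1 - l else 0))%N.

(** [jac_count] in a weight whose monomials all lie in the [N]-th power of the maximal ideal: the
    classes it finds are independent in the global Jacobian algebra and vanish in the local one. *)
Lemma local_codim_bound px qx k l d W e M N m n F g :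
  (0 < px)%N -> (px <= qx)%N -> coprime px qx -> (k <= 1)%N -> (l <= 1)%N ->
  (W = k * qx + l * px + d * (px * qx))%N -> (qx + px <= W)%N ->
  homog qx px W F -> homog qx px e g -> (0 < e)%N -> (e < W)%N -> g != 0 ->
  jac F (mon M 0) -> jac F (mon 0 M) ->
  codim (jac (F + g)) m -> codim (locjac (F + g) N) n ->
  (n + jump_bound k l px qx d <= m)%N.
Proof.
move=> px0 pq cop hk hl HW Wb HF Hg e0 eW g0 xM yM cm cn.
have qx0 : (0 < qx)%N by exact: leq_trans pq.
(* Monomials of weight [X px qx] have degree at least [X], hence at least [N]; the summand [d] makes
   [X - d] a true difference. *)
pose X := (N + d)%N.
pose t := (X * (px * qx))%N.
pose a := if px == 1%N then (1 - k)%N else 0%N.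
pose b := if qx == 1%N then (1 - l)%N else 0%N.
(* The weight of [S] in [g P = jacobian F g * S], from which [e] has cancelled. *)
pose t' := ((X - d) * (px * qx) + (1 - k) * qx + (1 - l) * px)%N.
pose z (r : 'I_X.+1) := (px * r, qx * (X - r))%N.
(* The smallest exponent of [x] is [1 - k], or 0 if [px = 1]; the exponent of [y] follows from the
   weight. *)
pose ix (r : nat) := (1 - k + px * r - a)%N.
pose y (r : 'I_(X - d + 1 + a + b)) := (ix r, (t' - ix r * qx) %/ px)%N.
have tt' : (t' + (W + e - qx - px) = e + t)%N.
  have -> : t = ((X - d) * (px * qx) + d * (px * qx))%N by rewrite -mulnDl subnK ?leq_addl.
  rewrite /t'; move: Wb; rewrite HW.
  have : (k = 0 \/ k = 1)%N by lia.
  have : (l = 0 \/ l = 1)%N by lia.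
  move: (d * (px * qx))%N ((X - d) * (px * qx))%N => u v.
  by case=> ->; case=> ->; rewrite ?subn0 ?subnn ?mul0n ?mul1n; lia.
have zi : injective z.
  move=> r r' /(congr1 fst) /= /eqP; rewrite eqn_pmul2l// => /eqP; exact: val_inj.
have Hz (r : 'I_X.+1) : homog qx px t (mon (z r).1 (z r).2 : R).
  have -> : t = wt qx px (z r).1 (z r).2; last exact: homog_mon.
  rewrite /wt /t /= -[X in LHS](subnK (_ : r <= X)%N) ?leq_ord//; nia.
have Hy i j : wt qx px i j = t' -> exists r, y r = (i, j).
  rewrite /wt => ij.
  suff [r rn ri] : exists2 r, (r < X - d + 1 + a + b)%N & ix r = i.
    exists (Ordinal rn); rewrite /y /= ri -ij addKn mulnK//.
  move: ij; rewrite /t' /ix /a /b; case: eqP => [p1|p1].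
    rewrite p1 !mul1n !muln1 => ij; exists i; last by rewrite addnC addnK mul1n.
    case: eqP => [q1|q1]; first by rewrite q1 !muln1 in ij; lia.
    rewrite ltnNge; apply/negP => H.
    have : ((X - d + 1 + (1 - k) + 0) * qx <= i * qx)%N by rewrite leq_mul2r H orbT.
    by rewrite !mulnDl; lia.
  have q1 : qx != 1%N by lia.
  rewrite (negPf q1) !addn0 => ij.
  pose c := (1 - k)%N; pose v := (X - d)%N; rewrite -/c -/v in ij *.
  (* For [px > 1], an exponent of [x] below [1 - k] is 0 with [k = 0], and the weight modulo [px]
     shows that [px] divides [qx]. *)
  have ci : (c <= i)%N.
    rewrite leqNgt; apply/negP => H; have [i0 c1] : i = 0%N /\ c = 1%N by rewrite /c in H *; lia.
    have : (px %| qx)%N.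
      rewrite -[qx]mul1n -c1 -(dvdn_addr _ (dvdn_mull (v * qx) (dvdnn px))) addnC.
      have -> : (c * qx + v * qx * px = (j - (1 - l)) * px)%N.
        by rewrite mulnBl; move: ij; rewrite i0; nia.
      exact: dvdn_mull.
    by move/gcdn_idPl; rewrite (eqP cop) => /esym.
  have ij' : ((i - c) * qx + j * px = (v * qx + (1 - l)) * px)%N.
    by move: ij; rewrite -{1}(subnK ci) !mulnDl; lia.
  have /dvdnP[r rE] : (px %| i - c)%N.
    rewrite -(Gauss_dvdl _ cop) -(dvdn_addl _ (dvdn_mull j (dvdnn px))) ij'.
    exact: dvdn_mull.
  exists r; last by rewrite mulnC -rE subn0; lia.
  have : (r * qx + j = v * qx + (1 - l))%N.
    by apply/eqP; rewrite -(eqn_pmul2r px0) -ij' rE; apply/eqP; ring.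
  rewrite addn1 ltnS leqNgt => H; apply/negP => vr.
  have : (v.+1 * qx <= r * qx)%N by rewrite leq_mul2r vr orbT.
  by rewrite mulSn; lia.
have [A [iA cA]] := jac_count qx0 px0 HF Hg e0 eW g0 xM yM tt' Hz (indep_mon zi)
  (fun S => span_mon Hy).
have := codim_indep_leq (subspace_ideal2 _ _) (subspace_locid _ _ N) _ cm cn iA.
move=> /(_ (fun h => @locid_ideal2 _ _ _ _ h)) H.
apply: leq_trans (H _).
  rewrite leq_add2l; move: cA; rewrite !card_ord /jump_bound -/a -/b /X addnK; lia.
move=> r _; apply: locid_ord; apply: (ordw_leq _ (@ordw_mon C 1 1 _ _)).
by rewrite /wt /z /= !muln1; have := leq_ord r; rewrite /X; nia.
Qed.

End Count.

(** * Adding a monomial of weight [W - 1] *)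

Section AdjacentMonomial.
Variable C : numClosedFieldType.
Local Notation R := (bip C).
Variables (px qx W a b n K : nat) (th : nat -> C) (s : C) (F : R).
Hypotheses (px0 : (0 < px)%N) (qx0 : (0 < qx)%N) (cop : coprime px qx).
Hypotheses (HF : homog qx px W F) (ab : (a * qx + b * px + 1 = W)%N) (W2 : (2 <= W)%N).
Hypotheses (s0 : s != 0) (thn : th n != 0) (th0 : a = 0%N \/ th 0%N != 0).

Let f := F + s *: mon a b.
Let J := jac f.
Let Q : R := \sum_(r < n.+1) th r *: mon (px * r) (qx * (n - r)).
Hypothesis HQ : forall u v, (K <= u + v)%N -> J (mon u v * Q).

(** From this weight on, cofactors of the monomials of [Q] have degree at least [K], and monomials
    whose exponent of [x] is below [a + n px] are divisible by [y^b]. *)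
Let T1 := (2 * (n * (px * qx)) + a * qx + b * px + K * (px + qx))%N.

(** The Euler field multiplies the two parts of [f] by their weights [W] and [W - 1]. Hence a
    multiple of [x^a y^b] is traded for a multiple of [F], one weight higher. *)
Lemma adjacent_euler X : J (mon a b * X + (W%:R / (s * W.-1%:R)) *: (F * X)).
Proof.
have e0 : (W.-1%:R : C) != 0 by rewrite pnatr_eq0; lia.
have Hg : homog qx px W.-1 (@mon C a b).
  by rewrite -ab addn1 /=; exact: homog_mon.
exists ((s * W.-1%:R)^-1%:P%:P * X * qx%:R * mon 1 0), ((s * W.-1%:R)^-1%:P%:P * X * px%:R * mon 0 1).
rewrite /f dxD dyD dxZ dyZ !bscaleE.
have -> : (W%:R / (s * W.-1%:R))%:P%:P = (s * W.-1%:R)^-1%:P%:P * W%:R :> R.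
  by rewrite mulrC !polyCM !polyC_natr.
have -> : mon a b * X = (s * W.-1%:R)^-1%:P%:P * (s%:P%:P * (W.-1%:R * mon a b)) * X :> R.
  rewrite -[in LHS](mul1r (mon a b)); congr (_ * _); rewrite !mulrA; congr (_ * _).
  by rewrite -!polyC_natr -!polyCM -mulrA mulVf// mulf_neq0.
rewrite -(euler Hg) -[W%:R](mulr1) -[_ * (F * X)](_ : (s * W.-1%:R)^-1%:P%:P * (W%:R * F) * X = _); last by ring.
by rewrite -(euler HF); ring.
Qed.

Lemma weight_shift i j t u v : (T1 <= t)%N -> wt qx px i j = t ->
  wt qx px i j = (wt qx px u v + n * (px * qx))%N -> (K <= u + v)%N.
Proof.
move=> Tt ij uv; rewrite leqNgt; apply/negP => H.
have : ((u + v).+1 * (px + qx) <= K * (px + qx))%N by rewrite leq_mul2r H orbT.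
move: Tt; rewrite -ij uv /T1 /wt.
have -> : ((u + v).+1 * (px + qx) = u * px + u * qx + v * px + v * qx + px + qx)%N by ring.
by lia.
Qed.

(** Multiples of [Q] rewrite monomials: the last coefficient [th n] serves to lower large exponents
    of [x], the first one to raise those below [a], until the exponent lies in a window of length
    [n px]. In a given weight it is determined modulo [px], which leaves at most [n] monomials, all
    divisible by [x^a y^b] as [adjacent_euler] requires. *)
Lemma adjacent_span t : (T1 <= t)%N -> exists y : 'I_n -> R,
  (forall r, y r = 0 \/ exists i j, [/\ (a <= i)%N, (b <= j)%N, wt qx px i j = t & y r = mon i j]) /\
  forall h, homog qx px t h -> in_span J setT y h.
Proof.
move=> Tt; have sJ : subspace J by exact: subspace_ideal2.
pose E i j := wt qx px i j = t.
suff [y [Hy1 Hy2]] : exists y : 'I_n -> R,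
    (forall r, y r = 0 \/ exists i j, [/\ (a <= i)%N, (b <= j)%N, E i j & y r = mon i j]) /\
    forall i j, (a <= i)%N -> (i < a + n * px)%N -> E i j -> in_span J setT y (mon i j).
  exists y; split=> // h Hh.
  have Hmid i j : (i < a + n * px)%N -> E i j -> in_span J setT y (mon i j).
    have [k] := ubnP (a + n * px - i)%N; elim: k i j => [//|k IH] i j ik iu ij.
    have [ai|ia] := leqP a i; first exact: Hy2.
    have t0 : th 0%N != 0 by case: th0 => // a0; rewrite a0 in ia.
    have jn : (qx * n <= j)%N.
      rewrite -(leq_pmul2r px0) leqNgt; apply/negP => H.
      have : (i * qx <= a * qx)%N by rewrite leq_mul2r (ltnW ia) orbT.
      by move: ij Tt H; rewrite /E /wt /T1; nia.
    have Kuv : (K <= i + (j - qx * n))%N.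
      apply: (weight_shift Tt ij); rewrite /wt -{1}(subnK jn); ring.
    have := HQ Kuv; rewrite /Q big_ord_recl/= muln0 subn0 mulrDr bscaleAr monM addn0 subnK// => H.
    have -> : mon i j = (th 0%N)^-1 *: (th 0%N *: mon i j) :> R by rewrite scalerA mulVf// scale1r.
    apply: in_spanZ => //.
    apply: (in_span_eq sJ (v := - \sum_(r < n) mon i (j - qx * n) * (th (bump 0 r) *: mon (px * bump 0 r) (qx * (n - bump 0 r))))).
      by rewrite opprK -mulr_sumr.
    rewrite -scaleN1r; apply: in_spanZ => //; apply: in_span_sum => // r _.
    rewrite bscaleAr monM; apply: in_spanZ => //; rewrite /bump leq0n add1n.
    have rn := ltn_ord r.
    apply: IH; first by nia.
      by apply: leq_trans (_ : i + px * n < _)%N; [rewrite ltnS leq_add2l leq_pmul2l//|nia].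
    rewrite /E /wt -ij /wt.
    rewrite -[in RHS](subnK jn); have -> : (qx * n = qx * (n - r.+1) + qx * r.+1)%N by rewrite -mulnDr subnK.
    ring.
  have Hall i j : E i j -> in_span J setT y (mon i j).
    elim/ltn_ind: i j => i IH j ij.
    have [iu|ui] := ltnP i (a + n * px); first exact: Hmid.
    have ni : (px * n <= i)%N by rewrite mulnC (leq_trans (leq_addl _ _) ui).
    have Kuv : (K <= (i - px * n) + j)%N.
      apply: (weight_shift Tt ij); rewrite /wt -{1}(subnK ni); ring.
    have := HQ Kuv; rewrite /Q big_ord_recr/= subnn muln0 mulrDr bscaleAr monM addn0 subnK// => H.
    have -> : mon i j = (th n)^-1 *: (th n *: mon i j) :> R by rewrite scalerA mulVf// scale1r.
    apply: in_spanZ => //.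
    apply: (in_span_eq sJ (v := - \sum_(r < n) mon (i - px * n) j * (th r *: mon (px * r) (qx * (n - r))))).
      by rewrite opprK -mulr_sumr addrC.
    rewrite -scaleN1r; apply: in_spanZ => //; apply: in_span_sum => // r _.
    rewrite bscaleAr monM; apply: in_spanZ => //.
    have rn := ltn_ord r.
    apply: IH.
      by rewrite -[X in (_ < X)%N](subnK ni) ltn_add2l ltn_pmul2l.
    rewrite /E /wt -ij /wt.
    rewrite -[in RHS](subnK ni); have -> : (px * n = px * (n - r) + px * r)%N by rewrite -mulnDr subnK// ltnW.
    ring.
  have [m Hm] := cf_bound h; rewrite (bip_expand Hm).
  apply: in_span_sum => // -[i j] _ /=; have [->|/Hh/Hall H] := eqVneq (cf h i j) 0.
    by rewrite scale0r; apply: in_span_sub => //; exact: subspace0 sJ.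
  exact: in_spanZ.
(* Either some monomial of this weight has its exponent of [x] in the first [px] places of the
   window, and the others are its translates, or the whole window is empty and the zero family
   does. *)
have [[i0 [j0 [ai0 i0a ij0]]]|none] := pselect (exists i0 j0, [/\ (a <= i0)%N, (i0 < a + px)%N & E i0 j0]).
  have low (r : 'I_n) : (qx * r + b <= j0)%N.
    rewrite -(leq_pmul2r px0) leqNgt; apply/negP => H.
    have : (i0 * qx <= (a + px) * qx)%N by rewrite leq_mul2r (ltnW i0a) orbT.
    have : ((r.+1 * (px * qx)) <= n * (px * qx))%N by rewrite leq_mul2r ltn_ord orbT.
    by move: ij0 Tt H; rewrite /E /wt /T1 mulSn !mulnDl; lia.
  have Er (r : 'I_n) : E (i0 + px * r)%N (j0 - qx * r)%N.
    have lr := leq_trans (leq_addr b _) (low r).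
    by rewrite /E -ij0 /wt -[in RHS](subnK lr); ring.
  exists (fun r => mon (i0 + px * r) (j0 - qx * r)); split=> [r|i j ai ia ij].
    right; exists (i0 + px * r)%N, (j0 - qx * r)%N; split=> //; first exact: leq_trans (leq_addr _ _).
    by have := low r; lia.
  pose r := ((i - a) %/ px)%N.
  have rn : (r < n)%N by rewrite /r ltn_divLR//; lia.
  pose i1 := ((i - a) %% px + a)%N.
  have iE : i = (i1 + px * r)%N.
    by rewrite /i1 /r mulnC addnAC addnC [(_ %% _ + _)%N]addnC -divn_eq subnKC.
  have i1E : i1 = i0.
    have Ei1 : (i1 * qx + (j + qx * r) * px = i0 * qx + j0 * px)%N.
      by move: ij ij0; rewrite /E /wt iE => <- ; lia.
    have dv x y u v : (x * qx + u * px = y * qx + v * px)%N -> (y <= x)%N -> (px %| x - y)%N.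
      move=> e yx; rewrite -(Gauss_dvdl _ cop) mulnBl.
      have -> : (x * qx - y * qx = (v - u) * px)%N by rewrite mulnBl; lia.
      exact: dvdn_mull.
    have m1 : (i1 < a + px)%N by rewrite /i1 addnC ltn_add2l ltn_pmod.
    have m0 : (a <= i1)%N by rewrite /i1 leq_addl.
    have [le|/ltnW le] := leqP i0 i1.
      have := dv _ _ _ _ Ei1 le; have [->//|ne] := eqVneq i1 i0.
      by move/dvdn_leq => H; have := H ltac:(lia); lia.
    have := dv _ _ _ _ (esym Ei1) le; have [->//|ne] := eqVneq i1 i0.
    by move/dvdn_leq => H; have := H ltac:(lia); lia.
  have := in_span_mem sJ (fun r : 'I_n => mon (i0 + px * r) (j0 - qx * r) : R) (in_setT (Ordinal rn)).
  rewrite /= -i1E -iE; congr (in_span _ _ _ (mon _ _)).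
  have lr := leq_trans (leq_addr b _) (low (Ordinal rn)).
  apply/eqP; rewrite -(eqn_pmul2r px0) mulnBl; apply/eqP.
  have := ij0; have := ij; rewrite /E /wt iE i1E => <-; lia.
exists (fun=> 0); split=> [r|i j ai ia ij]; first by left.
exfalso; apply: none.
exists ((i - a) %% px + a)%N, (j + qx * ((i - a) %/ px))%N; split.
- exact: leq_addl.
- by rewrite addnC ltn_add2l ltn_pmod.
have iE : i = ((i - a) %% px + a + px * ((i - a) %/ px))%N.
  by rewrite mulnC addnAC addnC [(_ %% _ + _)%N]addnC -divn_eq subnKC.
by rewrite /E -ij /wt [in RHS]iE; ring.
Qed.

(** The spanning monomials are divisible by [x^a y^b], and [adjacent_euler] raises their weight by
    one. *)
Lemma adjacent_step t h : (T1 <= t)%N -> homog qx px t h ->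
  exists2 h', homog qx px t.+1 h' & J (h - h').
Proof.
move=> Tt Hh; have sJ : subspace J by exact: subspace_ideal2.
have [y [Hy1 Hy2]] := adjacent_span Tt.
have /choice[y' Hy'] r : exists y', homog qx px t.+1 y' /\ J (y r - y').
  case: (Hy1 r) => [->|[i [j [ai bj ij ->]]]].
    by exists 0; rewrite subr0; split; [exact: homog0|exact: subspace0 sJ].
  exists (- ((W%:R / (s * W.-1%:R)) *: (F * mon (i - a) (j - b)))); split.
    apply: homogN; apply: homogZ.
    have -> : t.+1 = (W + wt qx px (i - a) (j - b))%N.
      by rewrite -ij -ab /wt -[in LHS](subnK ai) -[in LHS](subnK bj); ring.
    by apply: homogM => //; exact: homog_mon.
  rewrite opprK; have := adjacent_euler (mon (i - a) (j - b)).
  by rewrite {1}monM !subnKC.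
have [c Hc] := Hy2 h Hh; exists (\sum_(r in setT) c r *: y' r).
  by apply: homog_sum => r _; apply: homogZ; exact: (Hy' r).1.
rewrite -(subrK (\sum_(r in setT) c r *: y r) h) -addrA; apply: subspaceD => //.
rewrite -sumrB; apply: subspace_sum => // r _; rewrite -scalerBr.
by apply: subspaceZ => //; exact: (Hy' r).2.
Qed.

(** The loss is the size of a family independent modulo [J] whose members have order at least [N]
    modulo [J]. By [adjacent_step] all of them are congruent to homogeneous polynomials of one
    common large weight, where [n] elements span. *)
Lemma adjacent_codim N m n' : (T1 <= N)%N ->
  codim J m -> codim (locjac f N) n' -> (m <= n' + n)%N.
Proof.
move=> TN cm cn; have sJ : subspace J by exact: subspace_ideal2.
have sL : subspace (locjac f N) by exact: subspace_locid.
have [I [A [u [iu Hu ->]]]] := codim_compl sJ sL (fun h => @locid_ideal2 _ _ _ N h) cm cn.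
rewrite leq_add2l.
have step t t' h : (T1 <= t)%N -> (t <= t')%N -> homog qx px t h ->
    exists2 h', homog qx px t' h' & J (h - h').
  move=> Tt; elim: t' => [|t' IH].
    by rewrite leqn0 => /eqP->; exists h => //; rewrite subrr; exact: subspace0 sJ.
  rewrite leq_eqVlt => /orP[/eqP->|]; first by exists h => //; rewrite subrr; exact: subspace0 sJ.
  rewrite ltnS => tt Hh; have [h1 H1 J1] := IH tt Hh.
  have [h2 H2 J2] := adjacent_step (leq_trans Tt tt) H1.
  exists h2 => //; rewrite -(subrK h1 h) -addrA; exact: subspaceD.
have Hv i : exists T, forall T', (T <= T')%N -> exists2 h', homog qx px T' h' & J (u i - h').
  have [P [P' HP]] := Hu i.
  set v := u i - _ in HP.
  have Hv t : (t < T1)%N -> wpart qx px t v = 0.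
    move=> tT; apply: bipP => k l; rewrite cf_wpart cf0; case: eqP => // kl.
    apply: HP; rewrite /wt !muln1; apply: leq_trans TN; apply: leq_ltn_trans tT.
    by rewrite -kl /wt leq_add// leq_pmulr.
  have [T HT] := wpart_expand qx px v.
  exists T => T' TT'; have E := HT _ TT'.
  have /choice[w Hw] (t : 'I_T') : exists w, homog qx px T' w /\ J (wpart qx px t v - w).
    have [tT|Tt] := ltnP t T1.
      by exists 0; rewrite Hv// subr0; split; [exact: homog0|exact: subspace0 sJ].
    have [w ? ?] := step t T' (wpart qx px t v) Tt (ltnW (ltn_ord t)) (@homog_wpart _ _ _ _ _).
    by exists w.
  exists (\sum_t w t); first by apply: homog_sum => t _; exact: (Hw t).1.
  have -> : u i - \sum_t w t = (P * dx f + P' * dy f) + \sum_(t < T') (wpart qx px t v - w t).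
    by rewrite sumrB -E /v; ring.
  apply: subspaceD => //; first by exists P, P'.
  by apply: subspace_sum => // t _; exact: (Hw t).2.
have /choice[T HT] := Hv.
pose T' := (T1 + \max_i T i)%N.
have [y [_ Hy]] := adjacent_span (leq_addr _ _ : (T1 <= T')%N).
have := @steinitz _ _ J I 'I_n A setT u y sJ iu; rewrite cardsT card_ord; apply=> i _.
have [|h Hh Jh] := HT i T'; first by rewrite /T' (leq_trans (leq_bigmax i))// leq_addl.
by apply: (in_span_eq sJ Jh); exact: Hy.
Qed.
End AdjacentMonomial.

(** * Semicontinuity *)

Lemma codim_iso (K : fieldType) (V : lmodType K) (J J' : V -> Prop) (f g : V -> V) n :
  subspace J' ->
  (forall u v, f (u + v) = f u + f v) -> (forall c u, f (c *: u) = c *: f u) ->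
  cancel g f -> (forall u, J u <-> J' (f u)) -> codim J n -> codim J' n.
Proof.
move=> sJ fD fZ gf HJ [b [ib sb]]; exists (fun i => f (b i)).
have f0 : f 0 = 0 by rewrite -[X in f X](scale0r 0) fZ scale0r.
have fB u v : f (u - v) = f u - f v by rewrite -scaleN1r fD fZ scaleN1r.
have fS c : f (\sum_(i in setT) c i *: b i) = \sum_(i in setT) c i *: f (b i).
  by rewrite (big_morph f fD f0); apply: eq_bigr => i _; rewrite fZ.
split=> [c|h]; first by rewrite -fS => /HJ; exact: ib.
by have [c /HJ Hc] := sb (g h); exists c; move: Hc; rewrite fB gf fS.
Qed.

Section Truncation.
Variable C : numClosedFieldType.
Local Notation R := (bip C).
Implicit Types (h A B P Q F G : R).
Variables (wx wy : nat).
Hypotheses (wx0 : (0 < wx)%N) (wy0 : (0 < wy)%N).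

Lemma trunc_expand N h :
  ordw wx wy N (h - \sum_(u : 'I_N * 'I_N) cf h u.1 u.2 *: mon u.1 u.2).
Proof.
move=> i j ij; rewrite cfB cf_sum.
have iN : (i < N)%N by apply: leq_ltn_trans ij; rewrite /wt; nia.
have jN : (j < N)%N by apply: leq_ltn_trans ij; rewrite /wt; nia.
rewrite (bigD1 (Ordinal iN, Ordinal jN))//= cfZ cf_mon !eqxx mulr1 big1 ?addr0 ?subrr//.
move=> -[u v] /= uv; rewrite cfZ cf_mon.
case: eqP => [iu|_]; case: eqP => [jv|_] /=; rewrite ?mulr0//.
by move: uv; rewrite -[_ == _]/((_ == _) && (_ == _)) -!val_eqE/= iu jv !eqxx.
Qed.

Lemma ordw_in_span N (L : finType) (v : L -> R) :
  (forall u : 'I_N * 'I_N, in_span (ordw wx wy N) setT v (mon u.1 u.2)) ->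
  forall h, in_span (ordw wx wy N) setT v h.
Proof.
move=> H h; have sN := @subspace_ordw C wx wy N.
apply: (in_span_eq sN (@trunc_expand N h)); apply: in_span_sum => // u _.
exact: in_spanZ.
Qed.

Lemma codim_ordw N : exists D, codim (ordw wx wy N : R -> Prop) D.
Proof.
have sN := @subspace_ordw C wx wy N.
have [|n [b [_ ib sb _]]] := @span_codim _ _ _ _ setT (fun u : 'I_N * 'I_N => mon u.1 u.2 : R) sN.
  apply: ordw_in_span => u.
  exact: (in_span_mem sN (fun u : 'I_N * 'I_N => mon u.1 u.2 : R) (in_setT u)).
by exists n, b.
Qed.
End Truncation.

Section Scaling.
Variable C : numClosedFieldType.
Local Notation R := (bip C).
Implicit Types (h A B P Q F G : R).
Variables (wx wy : nat).

(** The substitution [x -> t^wx x], [y -> t^wy y]. *)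
Definition rescale (t : C) h : R :=
  \poly_(i < size h) \poly_(j < size (h`_i)%R) (t ^+ wt wx wy i j * cf h i j).

Lemma cf_rescale t h i j : cf (rescale t h) i j = t ^+ wt wx wy i j * cf h i j.
Proof.
rewrite {1}/cf coef_poly; case: ltnP => [_|H]; last by rewrite coef0 cf_sizex ?mulr0.
by rewrite coef_poly; case: ltnP => [//|H]; rewrite cf_sizey ?mulr0.
Qed.
Lemma rescaleD t h A : rescale t (h + A) = rescale t h + rescale t A.
Proof. by apply: bipP => i j; rewrite cfD !cf_rescale cfD mulrDr. Qed.
Lemma rescaleZ t c h : rescale t (c *: h) = c *: rescale t h.
Proof. by apply: bipP => i j; rewrite cfZ !cf_rescale cfZ mulrCA. Qed.
Lemma rescaleB t h A : rescale t (h - A) = rescale t h - rescale t A.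
Proof. by rewrite -scaleN1r rescaleD rescaleZ scaleN1r. Qed.
Lemma rescaleM t h A : rescale t (h * A) = rescale t h * rescale t A.
Proof.
apply: bipP => k l; rewrite cf_rescale !cfM mulr_sumr; apply: eq_bigr => i _.
rewrite mulr_sumr; apply: eq_bigr => j _; rewrite !cf_rescale.
have -> : wt wx wy k l = (wt wx wy i j + wt wx wy (k - i) (l - j))%N.
  by rewrite -wtD !subnKC ?leq_ord.
by rewrite exprD; ring.
Qed.
Lemma rescaleK t h : t != 0 -> rescale t (rescale t^-1 h) = h.
Proof.
by move=> t0; apply: bipP => i j; rewrite !cf_rescale mulrA -exprMn mulfV// expr1n mul1r.
Qed.
Lemma dx_rescale t h : dx (rescale t h) = t ^+ wx *: rescale t (dx h).
Proof.
apply: bipP => i j; rewrite cf_dx cfZ !cf_rescale cf_dx -!mulrnAr mulrA -exprD.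
by congr (_ ^+ _ * _); rewrite /wt mulSn; lia.
Qed.
Lemma dy_rescale t h : dy (rescale t h) = t ^+ wy *: rescale t (dy h).
Proof.
apply: bipP => i j; rewrite cf_dy cfZ !cf_rescale cf_dy -!mulrnAr mulrA -exprD.
by congr (_ ^+ _ * _); rewrite /wt mulSn; lia.
Qed.
Lemma ordw_rescale t N h : ordw 1 1 N h -> ordw 1 1 N (rescale t h).
Proof. by move=> H i j ij; rewrite cf_rescale H ?mulr0. Qed.
Lemma rescale_homog t n h : homog wx wy n h -> rescale t h = t ^+ n *: h.
Proof.
move=> H; apply: bipP => i j; rewrite cf_rescale cfZ.
by have [->|/H->//] := eqVneq (cf h i j) 0; rewrite !mulr0.
Qed.

Lemma locjac_scale (c : C) F N h : c != 0 -> locjac (c *: F) N h -> locjac F N h.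
Proof.
move=> c0 [A [B H]]; exists (c *: A), (c *: B).
by move: H; rewrite dxZ dyZ !bscaleE; congr ordw; ring.
Qed.

Lemma locjac_rescale t F N h : t != 0 -> locjac F N h -> locjac (rescale t F) N (rescale t h).
Proof.
move=> t0 [A [B /(ordw_rescale t)]]; rewrite rescaleB rescaleD !rescaleM => H.
exists ((t ^+ wx)^-1 *: rescale t A), ((t ^+ wy)^-1 *: rescale t B).
rewrite dx_rescale dy_rescale !bscaleAl !bscaleAr !scalerA !mulVf ?scale1r//; exact: expf_neq0.
Qed.

Lemma codim_rescale t c F G N n : t != 0 -> c != 0 -> rescale t F = c *: G ->
  codim (locjac F N) n -> codim (locjac G N) n.
Proof.
move=> t0 c0 E; apply: (codim_iso (f := rescale t) (g := rescale t^-1)) => //.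
- exact: subspace_locid.
- exact: rescaleD.
- exact: rescaleZ.
- by move=> h; rewrite rescaleK.
move=> h; split.
  by move/(locjac_rescale t0); rewrite E; exact: locjac_scale.
have E2 : rescale t^-1 G = c^-1 *: F.
  have tV0 : t^-1 != 0 by rewrite invr_eq0.
  have := rescaleK F tV0; rewrite invrK E rescaleZ => <-.
  by rewrite scalerA mulVf// scale1r.
have tV0 : t^-1 != 0 by rewrite invr_eq0.
have Kh := rescaleK h tV0; rewrite invrK in Kh.
move/(locjac_rescale tV0); rewrite E2 Kh => H.
by apply: locjac_scale H; rewrite invr_eq0.
Qed.
End Scaling.

Section Degeneration.
Variable C : numClosedFieldType.
Local Notation R := (bip C).
Variables (wx wy W e N n ne : nat) (F G : R).
Hypotheses (HF : homog wx wy W F) (HG : ordw wx wy e G) (eW : (e < W)%N).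
Hypothesis cn : codim (locjac (F + wpart wx wy e G) N) ne.
Hypothesis gen : forall D : {poly C}, D.[0] != 0 -> exists t, [/\ t != 0, D.[t] != 0 &
  codim (locjac (F + t ^+ (W - e) *: G) N) n].

(** Rescaling turns [F + t^(W-e) G] into [t^W] times [F + G_e + t G_(e+1) + ...], with value
    [F + wpart wx wy e G] at [t = 0] inside the bracket. A basis of the quotient at 0 still spans
    for [t] outside the roots of a polynomial, and [gen] supplies such a [t]. *)
Lemma lowest_degeneration : (n <= ne)%N.
Proof.
have [T0 HT] := wpart_expand wx wy G.
pose T := T0.+1.
have GE := HT (e + T)%N (leq_trans (leqnSn _) (leq_addl _ _)).
pose Gt (t : C) : R := \sum_(i < T) t ^+ i *: wpart wx wy (e + i) G.
pose I := ('I_N * 'I_N)%type.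
have [b [ib sb]] := cn.
pose L := ('I_ne + (I + I))%type.
(* A basis of the quotient together with the monomial multiples of the partials spans everything
   modulo the fixed space [O]; the quotient itself varies with [t], so [open_span] is applied to
   this larger family. *)
pose v (l : L) (t : C) : R := match l with
  | inl k => b k | inr (inl u) => mon u.1 u.2 * dx (F + Gt t)
  | inr (inr u) => mon u.1 u.2 * dy (F + Gt t) end.
pose w (l : L) (i : I) : {poly C} := match l with
  | inl k => (cf (b k) i.1 i.2)%:P
  | inr (inl u) => (cf (mon u.1 u.2 * dx F) i.1 i.2)%:P +
      \sum_(k < T) cf (mon u.1 u.2 * dx (wpart wx wy (e + k) G)) i.1 i.2 *: 'X^k
  | inr (inr u) => (cf (mon u.1 u.2 * dy F) i.1 i.2)%:P +
      \sum_(k < T) cf (mon u.1 u.2 * dy (wpart wx wy (e + k) G)) i.1 i.2 *: 'X^k end.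
have dyS (t : C) : dy (Gt t) = \sum_(i < T) t ^+ i *: dy (wpart wx wy (e + i) G).
  have dy0 : dy (0 : R) = 0 by apply: bipP => i j; rewrite cf_dy !cf0 mul0rn.
  by rewrite /Gt (big_morph _ (@dyD C) dy0); apply: eq_bigr => i _; rewrite dyZ.
have dxS (t : C) : dx (Gt t) = \sum_(i < T) t ^+ i *: dx (wpart wx wy (e + i) G).
  by rewrite /Gt dx_sum; apply: eq_bigr => i _; rewrite dxZ.
have wv l (i : I) t : (w l i).[t] = cf (v l t) i.1 i.2.
  case: l => [k|[u|u]] /=; first by rewrite hornerC.
    rewrite dxD dxS mulrDr mulr_sumr cfD cf_sum hornerD hornerC horner_sum.
    congr (_ + _); apply: eq_bigr => k _.
    by rewrite hornerZ hornerXn bscaleAr cfZ mulrC.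
  rewrite dyD dyS mulrDr mulr_sumr cfD cf_sum hornerD hornerC horner_sum.
  congr (_ + _); apply: eq_bigr => k _.
  by rewrite hornerZ hornerXn bscaleAr cfZ mulrC.
pose O := ordw 1 1 N : R -> Prop.
have sO : subspace O by exact: subspace_ordw.
have mulO (A P : R) : O (A * P - \sum_(u : I) cf A u.1 u.2 *: (mon u.1 u.2 * P)).
  have -> : \sum_(u : I) cf A u.1 u.2 *: (mon u.1 u.2 * P) = (\sum_(u : I) cf A u.1 u.2 *: mon u.1 u.2) * P.
    by rewrite mulr_suml; apply: eq_bigr => u _; rewrite bscaleAl.
  by rewrite -mulrBl mulrC; apply: ordwMl; exact: trunc_expand.
have Gt0 : Gt 0 = wpart wx wy e G.
  rewrite /Gt big_ord_recl expr0 scale1r addn0 big1 ?addr0// => i _.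
  by rewrite /bump /= exprS mul0r scale0r.
have jacspan t : (forall u : I, in_span O setT (v ^~ t) (mon u.1 u.2)) ->
    forall h, in_span (locjac (F + Gt t) N) setT b h.
  move=> H h; have [c Hc] := ordw_in_span (isT : (0 < 1)%N) (isT : (0 < 1)%N) H h.
  have sJ := subspace_locid (dx (F + Gt t)) (dy (F + Gt t)) N.
  exists (fun k => c (inl k)).
  apply: (subspace_eq (J := locjac (F + Gt t) N) sJ (v := \sum_(u : I) c (inr (inl u)) *: (mon u.1 u.2 * dx (F + Gt t)) +
    \sum_(u : I) c (inr (inr u)) *: (mon u.1 u.2 * dy (F + Gt t)))).
    apply: locid_ord; move: Hc; congr O.
    by rewrite !sum_setT !big_sumType/= !opprD !addrA.
  by apply: (subspaceD sJ); apply: (subspace_sum sJ) => u _; apply: (subspaceZ sJ);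
    apply: locid_ideal2; apply: ideal2M; [exact: ideal2l|exact: ideal2r].
have [||D D0 HD] := open_span (J := O) (e := fun u : I => mon u.1 u.2) (v := v) (w := w) sO.
- move=> l t; apply: (ordw_leq (leqnn N)).
  under eq_bigr do rewrite wv; exact: trunc_expand.
- move=> u; have [c [A [B HAB]]] := sb (mon u.1 u.2).
  pose d (l : L) : C := match l with inl k => c k | inr (inl u) => cf A u.1 u.2
    | inr (inr u) => cf B u.1 u.2 end.
  exists d; rewrite sum_setT !big_sumType/= Gt0.
  rewrite sum_setT in HAB.
  set S1 := \sum_(k < ne) _ in HAB *; set S2 := (\sum_(i : I) _ in X in _ - (_ + (X + _))).
  set S3 := (X in _ - (_ + (_ + X))).
  have -> : mon u.1 u.2 - (S1 + (S2 + S3)) = (mon u.1 u.2 - S1 - (A * dx (F + wpart wx wy e G) + B * dy (F + wpart wx wy e G)))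
    + (A * dx (F + wpart wx wy e G) - S2) + (B * dy (F + wpart wx wy e G) - S3) by ring.
  by apply: (subspaceD sO); [apply: (subspaceD sO) => //|]; exact: mulO.
have [t [t0 Dt cnt]] := gen D0.
have cG : codim (locjac (F + Gt t) N) n.
  apply: (codim_rescale (wx := wx) (wy := wy) (t := t) (c := t ^+ W) t0 _ _ cnt); first exact: expf_neq0.
  rewrite rescaleD rescaleZ (rescale_homog t HF) scalerDr; congr (_ + _).
  rewrite [in LHS]GE big_split_ord/= big1 ?add0r; last first.
    move=> i _; apply: bipP => k l; rewrite cf_wpart cf0; case: eqP => // kl.
    by apply: HG; rewrite kl.
  have rescale0 : rescale wx wy t 0 = 0 by apply: bipP => i j; rewrite cf_rescale cf0 mulr0.
  rewrite (big_morph _ (rescaleD wx wy t) rescale0) !scaler_sumr; apply: eq_bigr => i _.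
  rewrite (rescale_homog t (@homog_wpart _ _ _ _ _)) !scalerA -!exprD; congr (_ ^+ _ *: _).
  by rewrite addnA subnK ?(ltnW eW).
have [b' [ib' _]] := cG.
have := @steinitz _ _ (locjac (F + Gt t) N) 'I_n 'I_ne setT setT b' b (subspace_locid _ _ _) ib'.
rewrite !cardsT !card_ord; apply=> i _; apply: jacspan; exact: HD.
Qed.
End Degeneration.

Lemma sum_pair (K : fieldType) (U V : lmodType K) (I : finType) (c : I -> K) (p : I -> U) (q : I -> V) :
  \sum_i c i *: ((p i, q i) : (U * V)%type) = (\sum_i c i *: p i, \sum_i c i *: q i).
Proof. by elim/big_rec3: _ => // i x y z _ ->. Qed.

(** * Perturbations of weight at least [W] *)

Section HigherTerms.
Variable C : numClosedFieldType.
Local Notation R := (bip C).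
Implicit Types (A B : R).
Variables (wx wy W N M m n : nat) (F G : R).
Hypotheses (wx0 : (0 < wx)%N) (wy0 : (0 < wy)%N) (xW : (wx <= W)%N) (yW : (wy <= W)%N).
Hypotheses (HF : homog wx wy W F) (HG : ordw wx wy W G).
Hypotheses (xM : jac F (mon M 0)) (yM : jac F (mon 0 M)).
Hypotheses (MN : (2 * M * (wx + wy) <= N)%N) (WN : (W <= N)%N).
Hypothesis cm : codim (jac F) m.
Hypothesis gen : forall D : {poly C}, D.[0] != 0 -> exists s,
  D.[s] != 0 /\ codim (locjac (F + s *: G) N) n.

Let O := ordw wx wy N : R -> Prop.
Let a := (W - wx)%N.
Let b := (W - wy)%N.
Let lo k (h : R) := \sum_(i < k) wpart wx wy i h.
Let nabla (f : R) (v : (R * R)%type) : R := v.1 * dx f + v.2 * dy f.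

Lemma ordw_dx (f : R) : ordw wx wy W f -> ordw wx wy a (dx f).
Proof. by move=> H i j ij; rewrite cf_dx H ?mul0rn// /wt mulSn; move: ij; rewrite /a /wt; lia. Qed.
Lemma ordw_dy (f : R) : ordw wx wy W f -> ordw wx wy b (dy f).
Proof. by move=> H i j ij; rewrite cf_dy H ?mul0rn// /wt mulSn; move: ij; rewrite /b /wt; lia. Qed.

Lemma cf_lo k h i j : cf (lo k h) i j = if (wt wx wy i j < k)%N then cf h i j else 0.
Proof.
rewrite cf_sum; case: ltnP => H; last first.
  rewrite big1// => l _; rewrite cf_wpart; case: eqP => // e.
  by have := ltn_ord l; rewrite -e ltnNge H.
rewrite (bigD1 (Ordinal H))//= cf_wpart eqxx big1 ?addr0// => l nl.
by rewrite cf_wpart; case: eqP => // e; case/eqP: nl; apply: val_inj; rewrite /= e.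
Qed.

(** Cut at the weights [N - a] and [N - b], the coefficients satisfy an exact relation, since all
    its terms have weight below [N]. *)
Lemma koszul_mod A B : O (A * dx F + B * dy F) -> exists T,
  ordw wx wy (N - a) (A - T * dy F) /\ ordw wx wy (N - b) (B + T * dx F).
Proof.
move=> H; have HFx : homog wx wy a (dx F) by exact: homog_dx.
have HFy : homog wx wy b (dy F) by exact: homog_dy.
have oA k h : ordw wx wy k (h - lo k h).
  by move=> i j ij; rewrite cfB cf_lo ij subrr.
have cl k l (h : R) : (k <= l)%N -> wpart wx wy l (lo k h) = 0.
  move=> kl; apply: bipP => i j; rewrite cf_wpart cf0; case: eqP => // e.
  by rewrite cf_lo e ltnNge kl.
have E0 : lo (N - a) A * dx F + lo (N - b) B * dy F = 0.
  have H2 : O (lo (N - a) A * dx F + lo (N - b) B * dy F).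
    have -> : lo (N - a) A * dx F + lo (N - b) B * dy F = (A * dx F + B * dy F)
      - (A - lo (N - a) A) * dx F - (B - lo (N - b) B) * dy F by ring.
    have aN : (N - a + a = N)%N by rewrite subnK//; rewrite /a; lia.
    have bN : (N - b + b = N)%N by rewrite subnK//; rewrite /b; lia.
    apply: (subspaceB (@subspace_ordw C wx wy N)); first apply: (subspaceB (@subspace_ordw C wx wy N)) => //.
      by rewrite -[X in ordw _ _ X]aN; apply: ordwM => //; exact: ordw_homog.
    by rewrite -[X in ordw _ _ X]bN; apply: ordwM => //; exact: ordw_homog.
  apply: bipP => i j; rewrite cf0; have [ij|ij] := ltnP (wt wx wy i j) N; first exact: H2.
  have := cf_wpart wx wy (wt wx wy i j) (lo (N - a) A * dx F + lo (N - b) B * dy F) i j.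
  rewrite eqxx => <-; rewrite wpartD (wpartdM _ _ HFx) (wpartdM _ _ HFy) /wpartd.
  by rewrite !cl ?leq_sub2r// !if_same !mul0r addr0 cf0.
have [T [TA TB]] := koszul xM yM E0.
by exists T; rewrite -TA -[T * dx F]opprK -TB.
Qed.

Lemma nabla_eq0 f T : nabla f (T * dy f, - (T * dx f)) = 0.
Proof. by rewrite /nabla /=; ring. Qed.

(** The rank of [nabla f] modulo [O] might increase under perturbation, and an upper bound is
    wanted. [S] indexes pairs whose images under [nabla F] form a basis of the image. By
    [koszul_mod] these pairs and the Koszul pairs of [F] span all pairs, and for all [s] but
    finitely many so do they with the Koszul pairs of [f]. These are killed by [nabla f], whose rank
    is therefore at most [#|S|]. *)
Lemma higher_terms_leq : (m <= n)%N.
Proof.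
have sO : subspace O by exact: subspace_ordw.
(* [N] is so large that weight at least [N] forces degree at least [2 M]. *)
have OJ h : O h -> jac F h.
  move=> Hh; apply: (ordw_expand (subspace_ideal2 _ _) Hh) => i j ij.
  apply: (ord_jac xM yM (leqnn _)) => k l kl; rewrite cf_mon.
  case: eqP => // ki; case: eqP => // lj; exfalso.
  move: kl ij; rewrite ki lj /wt !muln1 => kl ij.
  have : ((i + j).+1 * (wx + wy) <= 2 * M * (wx + wy))%N by rewrite leq_mul2r kl orbT.
  by rewrite mulSn mulnDl !mulnDr; lia.
have nD f u v : nabla f (u + v) = nabla f u + nabla f v by rewrite /nabla/=; ring.
have nZ f c u : nabla f (c *: u) = c *: nabla f u by rewrite /nabla/= !bscaleE; ring.
have n0 f : nabla f 0 = 0 by rewrite /nabla/= !mul0r addr0.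
have nS f (I : finType) (p : pred I) (c : I -> C) (v : I -> (R * R)%type) :
    nabla f (\sum_(i | p i) c i *: v i) = \sum_(i | p i) c i *: nabla f (v i).
  by rewrite (big_morph (nabla f) (nD f) (n0 f)); apply: eq_bigr => i _; exact: nZ.
pose I := ('I_N * 'I_N)%type.
pose I2 := (I + I)%type.
pose e (u : I2) : (R * R)%type := match u with inl u => (mon u.1 u.2, 0) | inr u => (0, mon u.1 u.2) end.
pose O2 (v : (R * R)%type) := ordw wx wy (N - a) v.1 /\ ordw wx wy (N - b) v.2.
have sO2 : subspace O2.
  split; first by split; exact: ordw0.
  move=> c u v [H1 H2] [H3 H4]; split.
    exact: (@subspace_ordw C wx wy (N - a)).2.
  exact: (@subspace_ordw C wx wy (N - b)).2.
pose Z (v : (R * R)%type) := O (nabla F v).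
have sZ : subspace Z.
  split; first by rewrite /Z n0; exact: subspace0 sO.
  by move=> c u v Zu Zv; rewrite /Z nD nZ; exact: sO.2.
have [S [_ iS HS]] := maximal_indep setT e sZ.
pose L := (I2 + I)%type.
pose v (l : L) (s : C) : (R * R)%type := match l with
  | inl k => if k \in S then e k else 0
  | inr u => (mon u.1 u.2 * dy (F + s *: G), - (mon u.1 u.2 * dx (F + s *: G))) end.
pose cf2 (x : (R * R)%type) (i : I2) : C :=
  match i with inl i => cf x.1 i.1 i.2 | inr i => cf x.2 i.1 i.2 end.
pose w (l : L) (i : I2) : {poly C} := match l with
  | inl k => (cf2 (v l 0) i)%:P
  | inr u => (cf2 (v l 0) i)%:P + cf2 (mon u.1 u.2 * dy G, - (mon u.1 u.2 * dx G)) i *: 'X end.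
have wv l i s : (w l i).[s] = cf2 (v l s) i.
  case: l => [k|u] /=; first by rewrite hornerC.
  rewrite hornerD hornerC hornerZ hornerX scale0r addr0.
  by case: i => i /=; rewrite ?(dxD, dyD, dxZ, dyZ) mulrDr ?opprD ?cfD ?cfN bscaleAr cfZ ?cfN;
    rewrite ?mulrN ?mulNr ?(mulrC s).
have e_expand x : O2 (x - \sum_i cf2 x i *: e i).
  rewrite big_sumType/=.
  rewrite (sum_pair (fun i : I => cf x.1 i.1 i.2) (fun i => mon i.1 i.2) (fun=> 0)).
  rewrite (sum_pair (fun i : I => cf x.2 i.1 i.2) (fun=> 0) (fun i => mon i.1 i.2)).
  have z0 (c : I -> C) : \sum_(i : I) c i *: (0 : R) = 0 by rewrite big1// => i _; rewrite scaler0.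
  rewrite !z0.
  by split; rewrite /= ?addr0 ?add0r; apply: (ordw_leq (leq_subr _ _) (trunc_expand wx0 wy0 _)).
have [||D D0 HD] := open_span (J := O2) (e := e) (v := v) (w := w) sO2.
- by move=> l t; under eq_bigr do rewrite wv; exact: e_expand.
- move=> i; have [c Hc] := HS i (in_setT i).
  set x := e i - _ in Hc.
  have [T [TA TB]] := koszul_mod Hc.
  exists (fun l : L => match l with inl k => if k \in S then c k else 0 | inr u => cf T u.1 u.2 end).
  rewrite sum_setT big_sumType/=.
  have -> : \sum_(k : I2) (if k \in S then c k else 0) *: (if k \in S then e k else 0) =
      \sum_(k in S) c k *: e k.
    by rewrite [RHS]big_mkcond; apply: eq_bigr => k _; case: ifP => // _; rewrite scale0r.
  rewrite opprD addrA -/x scale0r addr0.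
  pose T' := \sum_(u : I) cf T u.1 u.2 *: mon u.1 u.2 : R.
  have -> : \sum_(u : I) cf T u.1 u.2 *: ((mon u.1 u.2 * dy F, - (mon u.1 u.2 * dx F)) : (R * R)%type) =
      (T' * dy F, - (T' * dx F)).
    rewrite (sum_pair (fun u : I => cf T u.1 u.2)); congr (_, _).
      by rewrite mulr_suml; apply: eq_bigr => u _; rewrite bscaleAl.
    by rewrite mulr_suml -sumrN; apply: eq_bigr => u _; rewrite bscaleAl scalerN.
  have HT' : ordw wx wy N (T - T') by exact: trunc_expand.
  split => /=.
    have -> : x.1 - T' * dy F = (x.1 - T * dy F) + dy F * (T - T') by ring.
    apply: (subspaceD (@subspace_ordw C wx wy (N - a))) => //.
    by apply: ordwMl; apply: ordw_leq HT'; exact: leq_subr.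
  have -> : x.2 - - (T' * dx F) = (x.2 + T * dx F) - dx F * (T - T') by ring.
  apply: (subspaceB (@subspace_ordw C wx wy (N - b))) => //.
  by apply: ordwMl; apply: ordw_leq HT'; exact: leq_subr.
have [s [Ds cns]] := gen D0.
set f := F + s *: G in cns.
have of_ : ordw wx wy W f.
  by apply: (subspaceD (@subspace_ordw C wx wy W)); [exact: ordw_homog|apply: (subspaceZ (@subspace_ordw C wx wy W))].
have spanf x : in_span O S (fun k => nabla f (e k)) (nabla f x).
  have [c Hc] : in_span O2 setT (v ^~ s) x.
    by apply: (in_span_eq sO2 (e_expand x)); apply: in_span_sum => // i _; apply: in_spanZ => //; exact: HD.
  exists (fun k => c (inl k)).
  have On y : O2 y -> O (nabla f y).
    move=> [H1 H2]; apply: (subspaceD sO).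
      by apply: (@ordw_leq C wx wy N (N - a + a)); [rewrite subnK//; rewrite /a; lia|apply: ordwM => //; exact: ordw_dx].
    by apply: (@ordw_leq C wx wy N (N - b + b)); [rewrite subnK//; rewrite /b; lia|apply: ordwM => //; exact: ordw_dy].
  have := On _ Hc; rewrite -scaleN1r nD nZ scaleN1r sum_setT nS big_sumType/=.
  rewrite [X in _ - (_ + X)]big1 ?addr0 => [|u _]; last by rewrite nabla_eq0 scaler0.
  congr (O (_ - _)); rewrite [RHS]big_mkcond; apply: eq_bigr => k _.
  by case: ifP => // _; rewrite n0 scaler0.
have [Dim cD] := codim_ordw C wx0 wy0 N.
have lb : (m + #|S| <= Dim)%N.
  apply: (codim_indep_leq (u := fun k => nabla F (e k)) sO (subspace_ideal2 _ _) OJ cD cm) => [c|k _].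
    by rewrite -nS; exact: iS.
  by exists (e k).1, (e k).2.
(* The ideal modulo the weighted filtration; it contains [locjac f N], the weights being at least 1,
   and so has codimension at most [n]. *)
pose Jf h := exists A B, O (h - (A * dx f + B * dy f)).
have sJf : subspace Jf.
  split; first by exists 0, 0; rewrite !mul0r addr0 subr0; exact: subspace0 sO.
  move=> c u u' [A [B H]] [A' [B' H']]; exists (c *: A + A'), (c *: B + B').
  have -> : c *: u + u' - ((c *: A + A') * dx f + (c *: B + B') * dy f) =
    c *: (u - (A * dx f + B * dy f)) + (u' - (A' * dx f + B' * dy f)) by rewrite !bscaleE; ring.
  by apply: (subspaceD sO) => //; exact: (subspaceZ sO).
have locJf h : locjac f N h -> Jf h.
  move=> [A [B H]]; exists A, B => i j ij; apply: H.
  by apply: leq_ltn_trans ij; rewrite /wt !muln1 leq_add// leq_pmulr.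
have [n' le_n' cn'] := codim_sup (subspace_locid _ _ _) sJf locJf cns.
have OJf h : O h -> Jf h by move=> Oh; exists 0, 0; rewrite !mul0r addr0 subr0.
have [I' [A' [u [iu Hu DE]]]] := codim_compl sO sJf OJf cD cn'.
have : (#|A'| <= #|S|)%N.
  apply: (steinitz sO iu) => i _; have [A [B H]] := Hu i.
  exact: (in_span_eq sO H (spanf (A, B))).
lia.
Qed.
End HigherTerms.

(** * Deformations with the smallest jump *)

Section Jumps.
Variable C : numClosedFieldType.
Local Notation R := (bip C).
Implicit Types (h A B P Q F G : R).

(** Algebraic, and stronger than a jump of germs: the codimensions are the same for all large [N],
    which is what Nakayama's lemma needs, and for all nonzero [s], not only small ones. *)
Definition has_jump F c := exists G m n N1, [/\ cf G 0 0 = 0, (n + c = m)%N &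
  forall N, (N1 <= N)%N -> codim (locjac F N) m /\
    forall s, s != 0 -> codim (locjac (F + s *: G) N) n].

Lemma codim_eqv (V : lmodType C) (J J' : V -> Prop) n : (forall v : V, J v <-> J' v) -> codim J n -> codim J' n.
Proof.
by move=> E [b [ib sb]]; exists b; split=> [c /E|h]; [exact: ib|have [c /E Hc] := sb h; exists c].
Qed.

Lemma locjac_jac F M N h : jac F (mon M 0) -> jac F (mon 0 M) -> (2 * M <= N)%N ->
  locjac F N h <-> jac F h.
Proof.
move=> xM yM MN; split=> [[A [B H]]|]; last exact: locid_ideal2.
apply: (ideal2_eq (ord_jac xM yM MN H)); by exists A, B.
Qed.

(** [local_codim_bound] and [adjacent_codim] give the two inequalities for the codimension of the
    deformation. *)
Lemma adjacent_jump px qx k l d W M a b th K F :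
  (0 < px)%N -> (px <= qx)%N -> coprime px qx -> (k <= 1)%N -> (l <= 1)%N ->
  (W = k * qx + l * px + d * (px * qx))%N -> (qx + px <= W)%N ->
  homog qx px W F -> jac F (mon M 0) -> jac F (mon 0 M) -> (a * qx + b * px + 1 = W)%N ->
  let n := jump_bound k l px qx d in
  th n != 0 -> a = 0%N \/ th 0%N != 0 ->
  (forall s u v, s != 0 -> (K <= u + v)%N ->
    jac (F + s *: mon a b) (mon u v * \sum_(r < n.+1) th r *: mon (px * r) (qx * (n - r)))) ->
  has_jump F n.
Proof.
move=> px0 pq cop k1 l1 EW pqW HF xM yM abW n thn th0 HQ.
have qx0 : (0 < qx)%N by exact: leq_trans pq.
have [m cm low] := codim_jac_lower qx0 px0 HF xM yM.
have W2 : (2 <= W)%N by move: px0 qx0 pqW; clear; lia.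
have e0 : (0 < W.-1)%N by move: W2; clear; lia.
have eW : (W.-1 < W)%N by move: W2; clear; lia.
have Hg s : homog qx px W.-1 (s *: mon a b : R).
  by apply: homogZ; rewrite -abW addn1 /=; exact: homog_mon.
pose N1 := (2 * M + (2 * (n * (px * qx)) + a * qx + b * px + K * (px + qx)))%N.
exists (mon a b), m, (m - n)%N, N1; split.
- rewrite cf_mon; case: eqP => //= a0; case: eqP => //= b0.
  by move: abW W2; rewrite -a0 -b0; clear; lia.
(* The lower bound at [s = 1] shows [n <= m], so that the difference is not truncated. *)
- have [n' nm cn'] := codim_sup (subspace_ideal2 _ _) (subspace_locid _ _ N1) (@locid_ideal2 _ _ _ N1)
    (low _ _ (Hg 1) eW).
  have g0 : (1 : C) *: mon a b != 0 :> R by rewrite scale1r mon_neq0.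
  have := local_codim_bound px0 pq cop k1 l1 EW pqW HF (Hg 1) e0 eW g0 xM yM (low _ _ (Hg 1) eW) cn'.
  by rewrite -/n; move: (n); clear; lia.
move=> N NN; split=> [|s s0].
  apply: codim_eqv cm => h; apply: iff_sym; apply: (locjac_jac _ xM yM).
  by move: NN; rewrite /N1; clear; lia.
have cs := low _ _ (Hg s) eW.
have [n' nm cn'] := codim_sup (subspace_ideal2 _ _) (subspace_locid _ _ N) (@locid_ideal2 _ _ _ N) cs.
have g0 : s *: mon a b != 0 :> R.
  by rewrite bscaleE mulf_neq0 ?mon_neq0// !polyC_eq0.
have B1 := local_codim_bound px0 pq cop k1 l1 EW pqW HF (Hg s) e0 eW g0 xM yM cs cn'.
have B2 := adjacent_codim px0 qx0 cop HF abW W2 s0 thn th0 (fun u v => HQ s u v s0) (N := N) _ cs cn'.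
suff <- : n' = (m - n)%N by [].
rewrite -/n in B1; have {}B2 := B2 (leq_trans (leq_addl _ _) NN).
by move: (n) B1 B2; clear; lia.
Qed.

Lemma homog_expand px qx n Q : (0 < px)%N -> (0 < qx)%N -> coprime px qx -> homog qx px (n * (px * qx)) Q ->
  Q = \sum_(r < n.+1) cf Q (px * r) (qx * (n - r)) *: mon (px * r) (qx * (n - r)).
Proof.
move=> px0 qx0 cop HQ; apply: bipP => i j; rewrite cf_sum.
have [ij|ij] := eqVneq (wt qx px i j) (n * (px * qx))%N; last first.
  have -> : cf Q i j = 0 by apply/eqP; apply: contraNT ij => /HQ ->.
  rewrite big1// => r _; rewrite cfZ cf_mon; case: eqP => [Ei|_]; last by rewrite mulr0.
  case: eqP => [Ej|_]; last by rewrite mulr0.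
  exfalso; move/eqP: ij; apply; rewrite /wt Ei Ej; have := ltn_ord r; rewrite ltnS => rn.
  rewrite -[in RHS](subnKC rn); move: (n - r)%N (nat_of_ord r) => u v; clear; nia.
have pi : (px %| i)%N.
  have : (px %| i * qx)%N.
    rewrite -(dvdn_addl (n := (j * px)%N)) ?dvdn_mull//.
    by rewrite -/(wt qx px i j) ij dvdn_mull// dvdn_mulr.
  by rewrite Gauss_dvdl.
have /dvdnP[r Er] := pi.
have Ej : (j = qx * (n - r))%N /\ (r <= n)%N.
  move: ij; rewrite /wt Er => ij.
  have E : ((r * qx + j) * px = (n * qx) * px)%N by rewrite mulnDl; move: ij; clear; lia.
  move/eqP: E; rewrite eqn_pmul2r// => /eqP E.
  have rn : (r <= n)%N by rewrite -(leq_pmul2r qx0) -E leq_addr.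
  by split=> //; rewrite mulnBr; move: E; clear; lia.
case: Ej => Ej rn.
have rn1 : (r < n.+1)%N by rewrite ltnS.
rewrite (bigD1 (Ordinal rn1))//= cfZ cf_mon Ej Er [(r * px)%N]mulnC !eqxx mulr1 big1 ?addr0// => r' rr'.
rewrite cfZ cf_mon -val_eqE /= in rr' *.
have -> : (px * r == px * r')%N = false by rewrite eqn_pmul2l// eq_sym (negbTE rr').
by rewrite mulr0.
Qed.

Lemma low_divisible qx n F1 : (0 < qx)%N -> homog qx 1 (n.+1 * qx) F1 ->
  exists B, F1 = cf F1 n.+1 0 *: mon n.+1 0 + mon 0 1 * B.
Proof.
move=> qx0 H1; have /= E := @homog_expand 1 qx n.+1 F1 isT qx0 (coprime1n _).
rewrite mul1n in E; rewrite {1}(E H1) big_ord_recr /= subnn !muln0 mul1n.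
exists (\sum_(r < n.+1) cf F1 (1 * r) (qx * (n.+1 - r)) *: mon (1 * r) (qx * (n.+1 - r)).-1).
rewrite addrC; congr (_ + _); rewrite mulr_sumr; apply: eq_bigr => r _.
rewrite bscaleAr monM add0n add1n prednK// muln_gt0 qx0 /= subn_gt0.
exact: ltn_ord.
Qed.

(** The added monomial is [y^(W-1)], so the derivative in [x] of the deformation is [y^l] times that
    of [F1], which serves as [Q]. As [a = 0], only the coefficient of [x^n] in [Q] has to be
    nonzero. *)
Lemma axis_jump qx l n M F F1 : (0 < qx)%N -> (l <= 1)%N -> (0 < n)%N -> (l = 0%N -> (1 < qx)%N) ->
  F = mon 0 l * F1 -> homog qx 1 (n.+1 * qx) F1 -> cf F1 n.+1 0 != 0 ->
  jac F (mon M 0) -> jac F (mon 0 M) -> has_jump F n.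
Proof.
move=> qx0 l1 n0 lq EF H1 c0 xM yM.
pose W := (l + n.+1 * qx)%N.
have HF : homog qx 1 W F.
  by rewrite EF; apply: homogM => //; have := @homog_mon C qx 1 0 l; rewrite /wt mul0n muln1 add0n.
have Ejb : jump_bound 0 l 1 qx n.+1 = n.
  rewrite /jump_bound eqxx subn0 subn1 /=; case: l l1 lq {EF W HF} => [|[|]] // _ lq.
    by rewrite ifF ?subn0//; apply/negbTE; move: (lq erefl); clear; lia.
  by case: ifP; rewrite ?subn0.
have HQh : homog qx 1 (n * (1 * qx)) (dx F1).
  by have := homog_dx H1; rewrite mulSn addKn mul1n.
have EQ := homog_expand (isT : (0 < 1)%N) qx0 (coprime1n _) HQh.
have Edx : dx F = mon 0 l * dx F1 by rewrite EF dxM dx_mon scale0r mul0r add0r.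
rewrite -Ejb; apply: (@adjacent_jump 1 qx 0 l n.+1 W M 0 W.-1 (fun r => cf (dx F1) (1 * r) (qx * (n - r))) (n.+1) F) => //.
- exact: coprime1n.
- by rewrite /W mul1n mul0n muln1.
- rewrite /W; case: l l1 lq {EF W HF Ejb Edx} => [|[|]] // _ lq.
    have := lq erefl; move: n0; clear; nia.
  by move: n0 qx0; clear; nia.
- by rewrite mul0n muln1 add0n addn1 prednK// /W; move: qx0; clear; nia.
- by rewrite Ejb mul1n subnn muln0 cf_dx -mulr_natr mulf_neq0// pnatr_eq0.
- by left.
move=> s u v s0 Kuv; rewrite Ejb -EQ.
set f := F + _.
have fx : dx f = mon 0 l * dx F1 by rewrite /f dxD Edx dxZ dx_mon scale0r scaler0 addr0.
have fy : dy f = dy F + (s * W.-1%:R) *: mon 0 W.-2 by rewrite /f dyD dyZ dy_mon scalerA.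
case: l l1 lq EF @W HF Ejb Edx @f fx fy => [|[|]] // _ lq EF W HF Ejb Edx f fx fy.
  by apply: ideal2M; rewrite -[dx F1]mul1r -mon00 -fx; exact: ideal2l.
have yQ : jac f (mon 0 1 * dx F1) by rewrite -fx; exact: ideal2l.
have [v0|v0] := posnP v; last first.
  have -> : mon u v = mon u v.-1 * mon 0 1 :> R by rewrite monM addn0 addn1 prednK.
  by rewrite -mulrA; exact: ideal2M.
have un : (n.+1 <= u)%N by move: Kuv; rewrite v0 addn0.
have -> : mon u v = mon (u - n.+1) 0 * mon n.+1 0 :> R by rewrite monM v0 subnK.
rewrite -mulrA; apply: ideal2M.
have [B EB] := low_divisible qx0 H1.
have W3 : (W.-2 = W.-2.-1.+1)%N by rewrite prednK// /W; move: n0 qx0; clear; nia.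
have MW : mon 0 W.-2 = mon 0 1 * mon 0 W.-2.-1 :> R by rewrite monM addn0 add1n -W3.
have dy1 : dy (mon 0 1) = 1 :> R by rewrite dy_mon scale1r mon00.
(* For [l = 1] only [y Q] is known to lie in the ideal. Modulo [y], the derivative in [y] of the
   deformation is a nonzero multiple of [x^(n+1)], so [x^(n+1) Q] lies in the ideal too. *)
have EfQ : cf F1 n.+1 0 *: (mon n.+1 0 * dx F1) = dx F1 * dy f -
   (B + dy F1 + (s * W.-1%:R) *: mon 0 W.-2.-1) * (mon 0 1 * dx F1).
  rewrite fy EF dyM dy1 MW; move: (s * _) (mon 0 W.-2.-1) (dx F1) (dy F1) => s' Y D D'.
  by move: (cf F1 n.+1 0) EB => c ->; rewrite !bscaleE; ring.
have : jac f (cf F1 n.+1 0 *: (mon n.+1 0 * dx F1)).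
  rewrite EfQ; apply: ideal2B; first by apply: ideal2M; exact: ideal2r.
  exact: ideal2M.
move/(ideal2Z (cf F1 n.+1 0)^-1); by rewrite scalerA mulVf// scale1r.
Qed.

(** The node, where the lower bound is 0: the Milnor number is 1, and adding a multiple of [y] makes
    the germ smooth. *)
Lemma axis_jump0 qx F F1 : (0 < qx)%N ->
  F = mon 0 1 * F1 -> homog qx 1 qx F1 -> cf F1 1 0 != 0 -> has_jump F 1.
Proof.
move=> qx0 EF H1 c0.
have [B EB] : exists B, F1 = cf F1 1 0 *: mon 1 0 + mon 0 1 * B.
  by apply: (@low_divisible qx 0) => //; rewrite mul1n.
have HF : homog qx 1 qx.+1 F.
  rewrite EF -[qx.+1]add1n; apply: homogM => //; exact: (@homog_mon C qx 1 0 1).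
have Hx := homog_dx HF; have Hy := homog_dy HF; rewrite subn1 /= in Hy.
rewrite subSnn in Hx.
have ow1 A : ordw qx 1 1 A -> ordw 1 1 1 A.
  by move=> H i j; rewrite /wt !muln1 => ij; apply: H; rewrite /wt; move: ij; clear; case: i => [|i]; case: j => [|j] //; lia.
have ox : ordw 1 1 1 (dx F) by apply: ow1; exact: ordw_homog.
have oy : ordw 1 1 1 (dy F) by apply: ow1; apply: (ordw_leq qx0); exact: ordw_homog.
have dxE : dx F = cf F1 1 0 *: mon 0 1 + mon 0 1 * (mon 0 1 * dx B).
  have -> : dx F = mon 0 1 * dx F1 by rewrite EF dxM dx_mon scale0r mul0r add0r.
  by rewrite {1}EB dxD dxZ dx_mon dxM dx_mon scale1r scale0r mul0r add0r mulrDr bscaleAr mon00 mulr1.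
have dB : dx B = 0.
  have : dx F1 = cf F1 1 0 *: mon 0 0.
    have := homog_dx H1; rewrite subnn => Hd; apply: bipP => i j.
    rewrite cfZ cf_mon; have [/eqP|ij] := eqVneq (i + j)%N 0%N.
      by rewrite addn_eq0 => /andP[/eqP-> /eqP->]; rewrite cf_dx mulr1.
    have -> : (i == 0%N) && (j == 0%N) = false by rewrite -addn_eq0 (negbTE ij).
    rewrite mulr0; apply/eqP; apply: contraT => /Hd; rewrite /wt.
    by move: qx0 ij; clear; nia.
  rewrite {1}EB dxD dxZ dx_mon scale1r dxM dx_mon scale0r mul0r add0r -[RHS]addr0 => /addrI/eqP.
  by rewrite mulf_eq0 (negbTE (mon_neq0 _ _ _)) => /eqP.
have Jy : jac F (mon 0 1).
  have -> : mon 0 1 = (cf F1 1 0)^-1 *: dx F by rewrite dxE dB !mulr0 addr0 scalerA mulVf// scale1r.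
  by apply: ideal2Z; exact: ideal2l.
have Jx : jac F (mon 1 0).
  have E : dy F = cf F1 1 0 *: mon 1 0 + (B + dy F1) * mon 0 1.
    by rewrite EF dyM dy_mon scale1r mon00 mul1r {1}EB; ring.
  have -> : mon 1 0 = (cf F1 1 0)^-1 *: (dy F - (B + dy F1) * mon 0 1) by rewrite E addrK scalerA mulVf// scale1r.
  by apply: ideal2Z; apply: ideal2B; [exact: ideal2r|exact: ideal2M].
exists (mon 0 1), 1%N, 0%N, 2%N; split=> [||N N2]; [by rewrite cf_mon|by []|split].
  exists (fun=> 1); split=> [c [A [B' H]] i _|h].
    have := H 0%N 0%N; rewrite /wt (leq_trans _ N2)// => /(_ isT).
    rewrite cfB (big_pred1 i) => [|j]; last by rewrite in_setT /= (ord1 j) (ord1 i).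
    rewrite cfZ -[in cf 1]mon00 cf_mon mulr1 (_ : cf (_ + _) 0 0 = 0) ?subr0//.
    by rewrite cfD (ordwMl A ox)// (ordwMl B' oy)// addr0.
  exists (fun=> cf h 0 0); apply: locid_ideal2.
  rewrite (big_pred1 ord0) => [|j]; last by rewrite in_setT /= (ord1 j).
  apply: (@ordw_expand C 1 1 1); [exact: subspace_ideal2| |].
    move=> i j; rewrite /wt !muln1; case: i => [|i]; case: j => [|j]// _.
    by rewrite cfB cfZ -[in cf 1]mon00 cf_mon mulr1 subrr.
  move=> [|i] j; rewrite /wt !muln1 => ij.
    by have -> : mon 0 j = mon 0 j.-1 * mon 0 1 :> R; [rewrite monM addn1 prednK|exact: ideal2M].
  by have -> : mon i.+1 j = mon i j * mon 1 0 :> R; [rewrite monM addn1 addn0|exact: ideal2M].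
(* The derivative in [y] is [s] plus a polynomial vanishing at 0: subtracting a multiple of it
   raises the order of [h] by one, until [N] is reached. *)
move=> s s0; have all h k : (k <= N)%N -> ordw 1 1 (N - k) h -> locjac (F + s *: mon 0 1) N h.
  elim: k h => [|k IH] h kN H; first by apply: locid_ord; rewrite subn0 in H.
  have E : h = s^-1 *: h * dy (F + s *: mon 0 1) - s^-1 *: h * dy F.
    by rewrite dyD dyZ dy_mon scale1r mon00 -mulrBr addrC addKr bscaleAl bscaleAr mulr1 scalerA mulVf// scale1r.
  rewrite E; apply: subspaceB; [exact: subspace_locid| |].
    by apply: locid_ideal2; apply: ideal2M; exact: ideal2r.
  apply: IH (ltnW kN) _; have -> : (N - k = N - k.+1 + 1)%N by move: kN; clear; lia.
  by apply: ordwM => // i j ij; rewrite cfZ H ?mulr0.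
exists (fun=> 0); split=> [c _ []//|h]; exists (fun=> 0).
by rewrite big_pred0 => [|[]//]; rewrite subr0; apply: (all _ N) => //; rewrite subnn => i j.
Qed.
End Jumps.

(** * Existence when [1 < px] *)

Section InteriorJump.
Variable C : numClosedFieldType.
Local Notation R := (bip C).
Implicit Types (h A B P Q F G : R).

(** Sylvester's bound. The Chinese remainder theorem gives a multiple of [qx] congruent to [n]
    modulo [px]; reducing its quotient modulo [px] gives [a], and [a qx <= (px - 1) qx <= n]. *)
Lemma weighted_representation px qx n : (0 < px)%N -> (0 < qx)%N -> coprime px qx ->
  (px * qx <= n.+1)%N -> exists a b, (a < px)%N /\ (a * qx + b * px = n)%N.
Proof.
move=> px0 qx0 cop nn; pose x := chinese px qx n 0.
have xq : (qx %| x)%N by rewrite /dvdn; have := chinese_modr cop n 0; rewrite mod0n => /eqP.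
have xp : x = n %[mod px] := chinese_modl cop n 0.
pose a := ((x %/ qx) %% px)%N; exists a.
have ap : (a < px)%N by rewrite ltn_mod.
have an : (a * qx <= n)%N by move: ap nn px0; clear; nia.
have : (px %| n - a * qx)%N by rewrite -eqn_mod_dvd// -xp modnMml divnK.
by move=> /dvdnP[b Eb]; exists b; rewrite -Eb subnKC.
Qed.

Lemma cf_xdx h i j : cf (mon 1 0 * dx h) i j = i%:R * cf h i j.
Proof.
rewrite cf_monM leq0n andbT subn0; case: i => [|i] /=; first by rewrite mul0r.
by rewrite subSS subn0 cf_dx mulr_natl.
Qed.
Lemma cf_ydy h i j : cf (mon 0 1 * dy h) i j = j%:R * cf h i j.
Proof.
rewrite cf_monM leq0n subn0 /=; case: j => [|j] /=; first by rewrite mul0r.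
by rewrite subSS subn0 cf_dy mulr_natl.
Qed.

Lemma y_power (k l a b e : nat) (c s : C) P B Q : (k <= 1)%N -> c != 0 ->
  P = c *: mon 0 e + mon 1 0 * B -> (k = 1 -> a <> 1)%N ->
  let f := mon k l * P + s *: mon a b in
  jac f (mon k l * Q) -> jac f (mon 0 (2 * l + e) * Q).
Proof.
move=> k1 c0 EP ka f J; case: k k1 ka @f J => [|[|]] // _ ka f J.
  have -> : mon 0 (2 * l + e) = mon 0 (l + e) * mon 0 l :> R by rewrite monM; congr mon; lia.
  by rewrite -mulrA; exact: ideal2M.
have [D ED] : exists D, a%:R *: mon a.-1 b * mon 0 l = mon 1 l * D :> R.
  case: a ka {f J} => [|[|a]] // ka; first by exists 0; rewrite scale0r mul0r mulr0.
    by case: (ka erefl).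
  by exists (a.+2%:R *: mon a b); rewrite bscaleAl bscaleAr !monM; congr (_ *: mon _ _); rewrite /= ?add1n ?addn0 ?[(l + b)%N]addnC.
have E : mon 0 l * dx f = c *: mon 0 (2 * l + e) + mon 1 l * (mon 0 l * B + mon 0 l * dx P + s *: D).
  rewrite /f dxD dxM dxZ !dx_mon scale1r [X in X * P](_ : _ = mon 0 l)//.
  have -> : mon 0 (2 * l + e) = mon 0 l * (mon 0 l * mon 0 e) :> R by rewrite !monM; congr mon; lia.
  have -> : mon 1 l * (mon 0 l * B + mon 0 l * dx P + s *: D) =
    mon 0 l * (mon 0 l * (mon 1 0 * B)) + mon 0 l * (mon 1 l * dx P) + s *: (mon 1 l * D).
    have -> : mon 1 l = mon 1 0 * mon 0 l :> R by rewrite monM.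
    by rewrite !bscaleE; ring.
  by rewrite -ED {1}EP !bscaleE; ring.
have Jf : jac f (mon 0 l * dx f) by apply: ideal2M; exact: ideal2l.
have -> : mon 0 (2 * l + e) * Q = c^-1 *: (Q * (mon 0 l * dx f) -
   (mon 0 l * B + mon 0 l * dx P + s *: D) * (mon 1 l * Q)).
  have E1 : c *: mon 0 (2 * l + e) * Q = Q * (mon 0 l * dx f) -
     (mon 0 l * B + mon 0 l * dx P + s *: D) * (mon 1 l * Q) by rewrite E; ring.
  by rewrite -E1 bscaleAl scalerA mulVf// scale1r.
by apply: ideal2Z; apply: ideal2B; exact: ideal2M.
Qed.

(** The field [b x d/dx - a y d/dy] kills [x^a y^b], so it takes the same value on the deformation
    and on [F], namely [x^k y^l Q] with [Q] of the weight of [P]. [y_power], applied also with the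
    variables exchanged, replaces [x^k y^l] by pure powers of [y] and of [x]. *)
Lemma interior_jump px qx k l d M P F :
  (1 < px)%N -> (px <= qx)%N -> coprime px qx -> (k <= 1)%N -> (l <= 1)%N -> (0 < d)%N ->
  homog qx px (d * (px * qx)) P -> cf P (px * d) 0 != 0 -> cf P 0 (qx * d) != 0 ->
  F = mon k l * P -> jac F (mon M 0) -> jac F (mon 0 M) -> has_jump F d.
Proof.
move=> px1 pq cop k1 l1 d0 HP cx cy EF xM yM.
have px0 : (0 < px)%N by exact: ltnW.
have qx0 : (0 < qx)%N by exact: leq_trans pq.
pose W := (k * qx + l * px + d * (px * qx))%N.
have HF : homog qx px W F.
  by rewrite EF; apply: homogM => //; exact: homog_mon.
have W1 : (px * qx <= W.-1.+1)%N.
  have W0 : (0 < W)%N by rewrite /W; move: px0 qx0 d0; clear; nia.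
  by rewrite prednK// /W; move: d0; clear; nia.
have [a [b [ap abW]]] := weighted_representation px0 qx0 cop W1.
have W0 : (0 < W)%N by rewrite /W; move: px0 qx0 d0; clear; nia.
have {}abW : (a * qx + b * px + 1 = W)%N by rewrite abW addn1 prednK.
pose E h : R := b%:R *: (mon 1 0 * dx h) - a%:R *: (mon 0 1 * dy h).
have cfE h i j : cf (E h) i j = ((b * i)%:R - (a * j)%:R) * cf h i j.
  by rewrite cfB !cfZ cf_xdx cf_ydy !natrM; ring.
pose Q := (b * k)%:R *: P - (a * l)%:R *: P + E P.
have cfQ i j : cf Q i j = ((b * (k + i))%:R - (a * (l + j))%:R) * cf P i j.
  by rewrite cfD cfB !cfZ cfE !mulnDr !natrD; ring.
have EQ : mon k l * Q = E F.
  apply: bipP => i j; rewrite cfE EF !cf_monM; case: ifP => [/andP[ki lj]|_]; last by rewrite mulr0.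
  by rewrite cfQ !subnKC.
have Eg s : E (s *: mon a b) = 0.
  apply: bipP => i j; rewrite cfE cf0 cfZ cf_mon; case: eqP => [->|]; last by rewrite !mulr0.
  by case: eqP => [->|]; rewrite ?mulr0// mulnC subrr mul0r.
have HQ : homog qx px (d * (px * qx)) Q.
  by move=> i j; rewrite cfQ => H; apply: HP; apply: contraNneq H => ->; rewrite mulr0.
have Ejb : jump_bound k l px qx d = d.
  have /negbTE p1 : px != 1%N by rewrite gtn_eqF.
  have /negbTE q1 : qx != 1%N by rewrite gtn_eqF// (leq_trans px1).
  by rewrite /jump_bound p1 q1 !subn0.
have qx1 : (1 < qx)%N by exact: leq_trans pq.
(* Otherwise comparing weights modulo [px] makes [px] divide 1. *)
have ka : k = 1%N -> a <> 1%N.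
  move=> Ek Ea; have D : (px %| 1)%N.
    have -> : (1 = l * px + d * (px * qx) - b * px)%N by move: abW; rewrite /W Ek Ea; move: (d * _)%N; clear; lia.
    by rewrite dvdn_sub ?dvdn_add ?(dvdn_mull _ (dvdnn _)) ?(dvdn_mull _ (dvdn_mulr _ (dvdnn _))).
  by move: D; rewrite dvdn1 gtn_eqF.
have lb : l = 1%N -> b <> 1%N.
  move=> El Eb; have D : (qx %| 1)%N.
    have -> : (1 = k * qx + d * (px * qx) - a * qx)%N by move: abW; rewrite /W El Eb; move: (d * _)%N; clear; lia.
    by rewrite dvdn_sub ?dvdn_add ?(dvdn_mull _ (dvdnn _)) ?(dvdn_mull _ (dvdn_mull _ (dvdnn _))).
  by move: D; rewrite dvdn1 gtn_eqF.
have apq : (a * qx + qx <= px * qx)%N by rewrite addnC -mulSn leq_mul2r ap orbT.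
have dpq : (px * qx <= d * (px * qx))%N by rewrite leq_pmull.
(* If [b = 0], then [W = a qx + 1]: for [l = 0] this makes [qx] divide 1, and for [l = 1] it
   contradicts [a < px]. *)
have b0 : (0 < b)%N.
  rewrite lt0n; apply/eqP => b0; case: l l1 {lb EF HF Q cfQ EQ HQ Ejb W1} @W W0 abW => [|[|]]// _ W W0 abW.
    have : (qx %| 1)%N.
      have -> : (1 = k * qx + d * (px * qx) - a * qx)%N by move: abW; rewrite /W b0; move: (d * _)%N; clear; lia.
      by rewrite dvdn_sub ?dvdn_add ?(dvdn_mull _ (dvdnn _)) ?(dvdn_mull _ (dvdn_mull _ (dvdnn _))).
    by rewrite dvdn1 gtn_eqF.
  by move: abW apq dpq; rewrite b0 /W mul0n mul1n addn0; move: px1 qx1; clear; nia.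
have [Bx EBx] : exists B, P = cf P 0 (qx * d) *: mon 0 (qx * d) + mon 1 0 * B.
  exists (\sum_(r < d) cf P (px * r.+1) (qx * (d - r.+1)) *: mon (px * r.+1).-1 (qx * (d - r.+1))).
  rewrite {1}(homog_expand px0 qx0 cop HP) big_ord_recl muln0 subn0; congr (_ + _).
  rewrite mulr_sumr; apply: eq_bigr => r _; rewrite bscaleAr monM add0n add1n prednK// muln_gt0 px0//.
have [By EBy] : exists B, P = cf P (px * d) 0 *: mon (px * d) 0 + mon 0 1 * B.
  exists (\sum_(r < d) cf P (px * r) (qx * (d - r)) *: mon (px * r) (qx * (d - r)).-1).
  rewrite {1}(homog_expand px0 qx0 cop HP) big_ord_recr subnn muln0 addrC; congr (_ + _).
  rewrite mulr_sumr; apply: eq_bigr => r _; rewrite bscaleAr monM add0n add1n prednK// muln_gt0 qx0 subn_gt0.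
  exact: ltn_ord.
rewrite -[X in has_jump _ X]Ejb.
apply: (@adjacent_jump _ px qx k l d W M a b (fun r => cf Q (px * r) (qx * (d - r))) (2 * l + qx * d + (2 * k + px * d))%N F) => //.
- have q2 : (2 * qx <= px * qx)%N by rewrite leq_mul2r px1 orbT.
  apply: (@leq_trans (d * (px * qx)) _ _ _ (leq_addl _ _)); apply: leq_trans dpq; apply: leq_trans q2.
  by rewrite mul2n -addnn leq_add2l.
(* The coefficient of [x^(px d)] in [Q] is [b (k + px d) - a l] times that of [P], nonzero since
   [b > 0] and [a < px]. *)
- rewrite Ejb subnn muln0 cfQ mulf_neq0// addn0 subr_eq0 eqr_nat.
  case: l l1 {lb EF HF Q cfQ EQ HQ Ejb W1 abW} @W W0 => [|[|]]// _ W W0.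
    by rewrite muln0; move: b0 px0 d0; clear; nia.
  have pd : (px <= px * d)%N by rewrite leq_pmulr.
  have bp : (k + px * d <= b * (k + px * d))%N by rewrite leq_pmull.
  by rewrite muln1; move: ap pd bp; clear; lia.
- have [->|a0] := posnP a; [by left|right].
  (* For [y^(qx d)] the factor vanishes if [b k = a (l + qx d)]; with [a > 0] this forces [k = 1]
     and gives [x^a y^b] a weight at least [W]. *)
  rewrite subn0 muln0 cfQ mulf_neq0// addn0 subr_eq0 eqr_nat.
  apply/eqP => Eab; case: k k1 {ka EF HF Q cfQ EQ HQ Ejb W1} @W W0 abW Eab => [|[|]]// _ W W0 abW.
    by rewrite muln0; move: a0 qx0 d0; clear; nia.
  have H1 : (qx <= a * qx)%N by rewrite leq_pmull.
  have H2 : ((l + qx * d) * px <= a * ((l + qx * d) * px))%N by rewrite leq_pmull.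
  rewrite muln1 => Eb; move: abW H1 H2; rewrite /W Eb; clear; nia.
move=> s u v s0 Kuv; rewrite Ejb -(homog_expand px0 qx0 cop HQ).
set f := F + _.
have Jkl : jac f (mon k l * Q).
  have -> : mon k l * Q = E f.
    by rewrite EQ; apply: bipP => i j; rewrite !cfE /f cfD mulrDr -(cfE (s *: _)) Eg cf0 addr0.
  by apply: ideal2B; apply: ideal2Z; apply: ideal2M; [exact: ideal2l|exact: ideal2r].
have Jy : jac f (mon 0 (2 * l + qx * d) * Q).
  by rewrite /f EF; apply: (y_power (c := cf P 0 (qx * d)) (B := Bx)) => //; rewrite -EF.
have Jx : jac f (mon (2 * k + px * d) 0 * Q).
  rewrite -[f]swapxyK -[mon _ _ * Q]swapxyK; apply: swapxy_jac.
  rewrite swapxyM swapxy_mon /f swapxyD EF swapxyM swapxy_mon.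
  have -> : swapxy (s *: mon a b) = s *: mon b a :> R.
    by apply: bipP => i j; rewrite cf_swapxy !cfZ !cf_mon andbC.
  have EPs : swapxy P = cf P (px * d) 0 *: mon 0 (px * d) + mon 1 0 * swapxy By.
    rewrite {1}EBy swapxyD swapxyM swapxy_mon; congr (_ + _).
    by apply: bipP => i j; rewrite cf_swapxy !cfZ !cf_mon andbC.
  apply: (y_power l1 cx EPs lb).
  have := swapxy_jac Jkl; rewrite swapxyM swapxy_mon /f swapxyD EF swapxyM swapxy_mon.
  have -> // : swapxy (s *: mon a b) = s *: mon b a :> R.
  by apply: bipP => i j; rewrite cf_swapxy !cfZ !cf_mon andbC.
have [vl|vl] := leqP (2 * l + qx * d) v.
  have -> : mon u v = mon u (v - (2 * l + qx * d)) * mon 0 (2 * l + qx * d) :> R by rewrite monM addn0 subnK.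
  by rewrite -mulrA; exact: ideal2M.
have ul : (2 * k + px * d <= u)%N by move: vl Kuv; clear; lia.
have -> : mon u v = mon (u - (2 * k + px * d)) v * mon (2 * k + px * d) 0 :> R by rewrite monM addn0 subnK.
by rewrite -mulrA; exact: ideal2M.
Qed.
End InteriorJump.

(** * Changes of coordinates and the case [p = q] *)

Section Shear.
Variable C : numClosedFieldType.
Local Notation R := (bip C).
Implicit Types (h A B P Q F G : R) (c : C).

(** A linear automorphism compatible with the local Jacobian ideals; the deforming polynomial is
    carried back by [g], which has to preserve its vanishing at the origin. *)
Lemma has_jump_iso (f g : R -> R) F r : linear f -> linear g -> cancel f g -> cancel g f ->
  (forall F N h, locjac F N h -> locjac (f F) N (f h)) ->
  (forall F N h, locjac F N h -> locjac (g F) N (g h)) ->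
  (forall h, cf h 0 0 = 0 -> cf (g h) 0 0 = 0) -> has_jump (f F) r -> has_jump F r.
Proof.
move=> lf lg fK gK Hf Hg g0 [G [m [n [N1 [G0 nm H]]]]].
have gD u v : g (u + v) = g u + g v by have := lg 1 u v; rewrite !scale1r.
have gz : g 0 = 0 by have := gD 0 0; rewrite addr0 => /eqP; rewrite -subr_eq subrr => /eqP.
have gZ a u : g (a *: u) = a *: g u by have := lg a u 0; rewrite !addr0 gz addr0.
have tr F' N n' : codim (locjac F' N) n' -> codim (locjac (g F') N) n'.
  apply: (codim_iso (f := g) (g := f)) => //; first exact: subspace_locid.
  by move=> u; split=> [/Hg//|/Hf]; rewrite !gK.
exists (g G), m, n, N1; split=> [||N N1N]; [exact: g0|by []|have [cm cn] := H N N1N; split].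
  by rewrite -[F]fK; exact: tr.
by move=> s s0; rewrite -[F]fK -gZ -gD; apply: tr; exact: cn.
Qed.

Lemma swapxy_linear : linear (@swapxy C).
Proof. by move=> a u v; apply: bipP => i j; rewrite cf_swapxy !cfD !cfZ !cf_swapxy. Qed.

Lemma swapxy_locjac F N h : locjac F N h -> locjac (swapxy F) N (swapxy h).
Proof.
move=> [A [B H]]; exists (swapxy B), (swapxy A) => i j ij.
have -> : swapxy h - (swapxy B * dx (swapxy F) + swapxy A * dy (swapxy F)) = swapxy (h - (A * dx F + B * dy F)).
  by rewrite swapxyD swapxyN swapxyD !swapxyM swapxy_dx swapxy_dy [X in _ = _ - X]addrC.
by rewrite cf_swapxy H// /wt addnC.
Qed.

Lemma has_jump_swapxy F r : has_jump (swapxy F) r -> has_jump F r.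
Proof.
apply: has_jump_iso; [exact: swapxy_linear|exact: swapxy_linear|exact: swapxyK|exact: swapxyK|
  exact: swapxy_locjac|exact: swapxy_locjac|by move=> h; rewrite cf_swapxy].
Qed.

(** The substitution [x -> x + c y], the outer variable being [x]. *)
Definition shear c h : R := h \Po ('X + (c *: 'X)%:P).

Lemma shearD c h A : shear c (h + A) = shear c h + shear c A. Proof. exact: comp_polyD. Qed.
Lemma shearM c h A : shear c (h * A) = shear c h * shear c A. Proof. exact: comp_polyM. Qed.
Lemma shearZ c a h : shear c (a *: h) = a *: shear c h.
Proof. by rewrite !bscaleE shearM /shear comp_polyC. Qed.
Lemma shearB c h A : shear c (h - A) = shear c h - shear c A. Proof. exact: comp_polyB. Qed.

Lemma shearK c : cancel (shear c) (shear (- c)).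
Proof.
move=> h; rewrite /shear -comp_polyA comp_polyD comp_polyX comp_polyC -addrA -polyCD.
by rewrite scaleNr addNr addr0 comp_polyXr.
Qed.

Lemma shearNK c : cancel (shear (- c)) (shear c).
Proof. by move=> h; rewrite -{1}[c]opprK shearK. Qed.

Lemma shearX c h n : shear c (h ^+ n) = shear c h ^+ n.
Proof.
by elim: n => [|n IH]; [rewrite !expr0 /shear -polyC1 comp_polyC|rewrite !exprS shearM IH].
Qed.

Lemma shear_linear c : linear (shear c).
Proof. by move=> a u v; rewrite shearD shearZ. Qed.

Lemma dx_shear c h : dx (shear c h) = shear c (dx h).
Proof. by rewrite /dx /shear deriv_comp derivD derivX derivC addr0 mulr1. Qed.

Lemma dyC (u : {poly C}) : dy (u%:P : R) = (u^`())%:P.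
Proof. by rewrite /dy map_polyC. Qed.

Lemma dyX : dy ('X : R) = 0.
Proof.
apply: bipP => i j; rewrite cf_dy cf0 /cf coefX; case: eqP => _; rewrite ?coef0 ?mul0rn//.
by rewrite coef1 mul0rn.
Qed.

Lemma dy_shear c h : dy (shear c h) = c *: shear c (dx h) + shear c (dy h).
Proof.
elim/poly_ind: h => [|h u IH].
  rewrite /shear comp_poly0.
  have -> : dx (0 : R) = 0 by apply: bipP => i j; rewrite cf_dx !cf0 mul0rn.
  have -> : dy (0 : R) = 0 by apply: bipP => i j; rewrite cf_dy !cf0 mul0rn.
  by rewrite !comp_poly0 bscaleE mulr0 addr0.
have dxE : dx (h * 'X + u%:P) = dx h * 'X + h by rewrite /dx derivD derivC addr0 derivM derivX mulr1.
have dyE : dy (h * 'X + u%:P) = dy h * 'X + (u^`())%:P by rewrite dyD dyM dyX mulr0 addr0 dyC.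
have sX : shear c ('X : R) = 'X + (c *: 'X)%:P by rewrite /shear comp_polyX.
have sC v : shear c (v%:P : R) = v%:P by rewrite /shear comp_polyC.
rewrite dxE dyE !shearD !shearM sX !sC dyD dyM dyD dyX add0r !dyC IH derivZ derivX.
rewrite alg_polyC !bscaleE; ring.
Qed.

Lemma homog_shear_mon c i j : homog 1 1 (i + j) (shear c (mon i j)).
Proof.
have -> : mon i j = mon 1 0 ^+ i * mon 0 1 ^+ j :> R.
  have X n : mon 1 0 ^+ n = mon n 0 :> R.
    by elim: n => [|n IH]; rewrite ?expr0 ?mon00// exprS IH monM add1n.
  have Y n : mon 0 1 ^+ n = mon 0 n :> R.
    by elim: n => [|n IH]; rewrite ?expr0 ?mon00// exprS IH monM add1n.
  by rewrite X Y monM addn0 add0n.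
have sX : shear c (mon 1 0) = mon 1 0 + c *: mon 0 1.
  by rewrite mon.unlock /shear expr0 mulr1 expr1 comp_polyX bscaleE expr0 mul1r expr1 -polyCM mul_polyC.
have sY : shear c (mon 0 1) = mon 0 1 by rewrite mon.unlock /shear expr0 mul1r comp_polyC.
rewrite shearM !shearX sX sY -[i in (i + j)%N]mul1n -[j in (_ + j)%N]mul1n.
apply: homogM; apply: homogX; last exact: (@homog_mon C 1 1 0 1).
by apply: homogD; [exact: (@homog_mon C 1 1 1 0)|apply: homogZ; exact: (@homog_mon C 1 1 0 1)].
Qed.

Lemma homog_shear c n h : homog 1 1 n h -> homog 1 1 n (shear c h).
Proof.
move=> Hh; have [m Hm] := cf_bound h; rewrite (bip_expand Hm) /shear (raddf_sum (comp_poly _)) /=.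
apply: homog_sum => u _; rewrite -/(shear c _) shearZ.
have [->|/Hh <-] := eqVneq (cf h u.1 u.2) 0; first by rewrite scale0r; exact: homog0.
by apply: homogZ; rewrite /wt !muln1; exact: homog_shear_mon.
Qed.

Lemma ordw_shear c N h : ordw 1 1 N h -> ordw 1 1 N (shear c h).
Proof.
move=> Hh; apply: (@ordw_expand C 1 1 N h (fun h => ordw 1 1 N (shear c h)) _ Hh).
  split=> [|a u v Hu Hv]; first by rewrite /shear comp_poly0; exact: ordw0.
  by rewrite shear_linear => i j ij; rewrite cfD cfZ Hu// Hv// mulr0 addr0.
move=> i j ij; apply: (ordw_leq ij); rewrite /wt !muln1.
by apply: ordw_homog; exact: homog_shear_mon.
Qed.

Lemma jac_shear_eq c A B F : shear c (A * dx F + B * dy F) =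
  (shear c A - c *: shear c B) * dx (shear c F) + shear c B * dy (shear c F).
Proof. by rewrite shearD !shearM dx_shear dy_shear !bscaleE; ring. Qed.

Lemma jac_shear c F h : jac F h -> jac (shear c F) (shear c h).
Proof.
move=> [A [B ->]]; exists (shear c A - c *: shear c B), (shear c B); exact: jac_shear_eq.
Qed.

Lemma locjac_shear c F N h : locjac F N h -> locjac (shear c F) N (shear c h).
Proof.
move=> [A [B H]]; exists (shear c A - c *: shear c B), (shear c B).
by rewrite -jac_shear_eq -shearB; exact: ordw_shear.
Qed.

Lemma has_jump_shear a F r : has_jump (shear a F) r -> has_jump F r.
Proof.
apply: (has_jump_iso (g := shear (- a))); [exact: shear_linear|exact: shear_linear|exact: shearK|
  exact: shearNK|exact: locjac_shear|exact: locjac_shear|move=> h h0].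
apply: (@ordw_shear _ 1) => // i j; rewrite /wt !muln1.
by rewrite ltnS leqn0 addn_eq0 => /andP[/eqP-> /eqP->].
Qed.

Lemma dehomog_shear c h : dehomog (shear c h) = dehomog h \Po ('X + c%:P).
Proof.
rewrite /dehomog /shear map_comp_poly rmorphD /= map_polyX map_polyC /=.
by rewrite /horner_eval hornerZ hornerX mulr1.
Qed.

Lemma coef_dehomog n h i : homog 1 1 n h -> (i <= n)%N -> (dehomog h)`_i = cf h i (n - i).
Proof.
move=> Hh ni; rewrite /dehomog coef_map_id0 /horner_eval ?horner0// (horner_coef_wide _ (leq_maxl _ (n - i).+1)).
have nm : (n - i < maxn (size (h`_i)%R) (n - i).+1)%N by rewrite leq_max ltnSn orbT.
rewrite (bigD1 (Ordinal nm))//= expr1n mulr1 big1 ?addr0// => j jn; rewrite expr1n mulr1.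
apply/eqP; apply: contraNT jn => /Hh; rewrite /wt !muln1 => E.
by rewrite -val_eqE /=; apply/eqP; move: E; move: (nat_of_ord j) => u; clear; lia.
Qed.

(** Shearing by a root of [F(x, 1)] produces a factor [x], which the exchange of variables turns
    into [y]: this is [axis_jump] with [qx = l = 1] and [n = D - 2], or [axis_jump0] if [D = 2]. The
    nonzero coefficient with [i > 0] makes [F(x, 1)] nonconstant. *)
Lemma homogeneous_jump D i M F : (2 <= D)%N -> (0 < i)%N -> (i <= D)%N -> cf F i (D - i) != 0 ->
  homog 1 1 D F -> jac F (mon M 0) -> jac F (mon 0 M) -> has_jump F (maxn 1 (D - 2)).
Proof.
move=> D2 i0 iD ci HF xM yM.
have [x0 rx0] : exists x0, root (dehomog F) x0.
  apply/closed_rootP; rewrite gtn_eqF//; apply: (@leq_ltn_trans i) => //.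
  by rewrite ltnNge; apply: contra ci => /leq_sizeP/(_ i (leqnn _)); rewrite (coef_dehomog HF iD) => ->.
pose F' := swapxy (shear x0 F).
have HF' : homog 1 1 D F' by apply: swapxy_homog; exact: homog_shear.
have jF h : ordw 1 1 (2 * M) h -> jac F' h.
  move=> Hh; rewrite -[h]swapxyK; apply: swapxy_jac; rewrite -[swapxy h](shearNK x0); apply: jac_shear.
  apply: (ord_jac xM yM (leqnn _)); apply: ordw_shear => u v uv.
  by rewrite cf_swapxy Hh// /wt addnC.
have x'M : jac F' (mon (2 * M) 0).
  by apply: jF; have := @ordw_mon C 1 1 (2 * M) 0; rewrite /wt !muln1 addn0.
have y'M : jac F' (mon 0 (2 * M)).
  by apply: jF; have := @ordw_mon C 1 1 0 (2 * M); rewrite /wt !muln1 add0n.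
have c0 : cf F' D 0 = 0.
  rewrite cf_swapxy -[D]subn0 -(coef_dehomog (homog_shear (c := x0) HF) (leq0n _)) -horner_coef0 dehomog_shear horner_comp.
  by rewrite hornerD hornerX hornerC add0r; apply/eqP.
have D1 : D = D.-1.+1 by rewrite prednK// (ltn_trans _ D2).
have [F1 EF1] : exists F1, F' = mon 0 1 * F1.
  have [|B] := @low_divisible C 1 D.-1 F' isT; first by rewrite -D1 muln1.
  by rewrite -D1 c0 scale0r add0r => ->; exists B.
have HF1 : homog 1 1 D.-1 F1.
  move=> u v; have -> : cf F1 u v = cf F' u v.+1 by rewrite EF1 cf_monM subn0 subSS subn0.
  by move=> /HF'; rewrite /wt !muln1 => <-; rewrite addnS.
(* Otherwise [y^2] divides [F'], both partials are divisible by [y], and no power of [x] lies in the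
   Jacobian ideal. *)
have c1 : cf F1 D.-1 0 != 0.
  have D3 : D.-1 = D.-2.+1 by rewrite prednK//; case: (D) D2 => [|[]].
  apply/eqP => c1; have [|B] := @low_divisible C 1 D.-2 F1 isT; first by rewrite -D3 muln1.
  rewrite -D3 c1 scale0r add0r => EB.
  have [A [A' E]] := x'M.
  have := congr1 (fun h => cf h (2 * M) 0) E; rewrite /= cf_mon !eqxx cfD EF1 EB.
  have -> : cf (A * dx (mon 0 1 * (mon 0 1 * B))) (2 * M) 0 = 0.
    by rewrite dxM dx_mon scale0r mul0r add0r mulrCA cf_monM andbF.
  have -> : cf (A' * dy (mon 0 1 * (mon 0 1 * B))) (2 * M) 0 = 0.
    have -> : A' * dy (mon 0 1 * (mon 0 1 * B)) = mon 0 1 * (A' * (dy (mon 0 1) * B + dy (mon 0 1 * B))).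
      by rewrite dyM; ring.
    by rewrite cf_monM andbF.
  by rewrite addr0 => /eqP; rewrite oner_eq0.
apply: (@has_jump_shear x0); apply: has_jump_swapxy; rewrite -/F'.
have [D3|D3] := leqP D 2.
  have -> : (D - 2 = 0)%N by move: D3; clear; lia.
  have ED : D = 2%N by move: D3 D2; clear; lia.
  by rewrite ED in HF1 c1; rewrite maxn0; exact: (@axis_jump0 C 1 F' F1 isT EF1 HF1 c1).
have -> : maxn 1 (D - 2) = (D - 2)%N by apply/maxn_idPr; move: D3; clear; lia.
have E : (D - 2).+1 = D.-1 by move: D3; clear; lia.
apply: (@axis_jump C 1 1 (D - 2) (2 * M) F' F1) => //; rewrite ?E ?muln1//.
by move: D3; clear; lia.
Qed.
End Shear.

(** * Normal form and comparison with the formula *)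

Section NormalForm.
Variable C : numClosedFieldType.
Local Notation R := (bip C).
Implicit Types (h A B P Q F G : R) (c : C).

(** The monomials [x^p] and [y^q] of [P] have equal weight, so [p wx = q wy], and the given weights
    are a common multiple of [qx] and [px], the quotients of [q] and [p] by their gcd. *)
Lemma normal_form k l p q wx wy W P F : (k <= 1)%N -> (l <= 1)%N -> (p <= q)%N -> (2 <= k + l + p)%N ->
  cf P p 0 = 1 -> cf P 0 q = 1 -> F = mon k l * P -> (0 < wx)%N -> (0 < wy)%N -> homog wx wy W F ->
  exists px qx d, [/\ [/\ (0 < px)%N, (px <= qx)%N, coprime px qx & (1 < px)%N -> (0 < d)%N],
    p = (px * d)%N, q = (qx * d)%N & homog qx px (d * (px * qx)) P].
Proof.
move=> k1 l1 pq klp cp cq EF wx0 wy0 HF.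
have HP i j : cf P i j != 0 -> (i * wx + j * wy = p * wx)%N.
  have key i' j' : cf P i' j' != 0 -> ((k + i') * wx + (l + j') * wy = W)%N.
    move=> cP; apply: HF; rewrite EF cf_monM !leq_addr /= !addKn//.
  have := key p 0%N; rewrite cp oner_neq0 => /(_ isT) E /key; move: E; clear; lia.
have qw : (q * wy = p * wx)%N by have := HP 0%N q; rewrite cq oner_neq0 => /(_ isT) <-; rewrite mul0n.
(* For [p = 0] the polynomial [P] is constant; [d = 0] with both weights equal to 1 keeps [p = px d]
   and [q = qx d]. *)
have [p0|p0] := posnP p.
  have q0 : q = 0%N by apply/eqP; move: qw; rewrite p0 mul0n => /eqP; rewrite muln_eq0 [wy == _]gtn_eqF// orbF.
  exists 1%N, 1%N, 0%N; split=> // i j /HP; rewrite p0 /wt !muln1 mul0n => /eqP; rewrite addn_eq0 !muln_eq0 [wx == _]gtn_eqF// [wy == _]gtn_eqF// !orbF.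
  by move=> /andP[/eqP-> /eqP->].
pose d := gcdn p q.
have d0 : (0 < d)%N by rewrite gcdn_gt0 p0.
have Ep : p = (p %/ d * d)%N by rewrite divnK// dvdn_gcdl.
have Eq : q = (q %/ d * d)%N by rewrite divnK// dvdn_gcdr.
set px := (p %/ d)%N in Ep; set qx := (q %/ d)%N in Eq.
have cop : coprime px qx.
  by rewrite /coprime -(eqn_pmul2r d0) muln_gcdl -Ep -Eq mul1n.
have px0 : (0 < px)%N by rewrite lt0n; apply: contraTneq p0 => px0; rewrite Ep px0.
have pxq : (px <= qx)%N by rewrite leq_div2r.
have qx0 : (0 < qx)%N by exact: leq_trans pxq.
have E1 : (qx * wy = px * wx)%N.
  by apply/eqP; rewrite -(eqn_pmul2r d0) mulnAC -Eq [X in _ == X]mulnAC -Ep qw.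
clearbody px qx d; have : (qx %| wx)%N.
  by rewrite -(@Gauss_dvdr qx px wx) -?E1 ?dvdn_mulr// coprime_sym.
move=> /dvdnP[t Et].
have Ewy : wy = (t * px)%N.
  by apply/eqP; rewrite -(eqn_pmul2l qx0) E1 Et; apply/eqP; clear; lia.
have t0 : (0 < t)%N by move: wx0; rewrite Et; case: (t).
exists px, qx, d; split; [by []|exact: Ep|exact: Eq|].
move=> i j /HP; rewrite Et Ewy Ep /wt => E.
apply/eqP; rewrite -(eqn_pmul2r t0); apply/eqP.
have -> : ((i * qx + j * px) * t = i * (t * qx) + j * (t * px))%N by ring.
by rewrite E; ring.
Qed.

(** The three cases of the formula are [px = qx = 1], [px = 1 < qx] and [1 < px]. With [d] the gcd
    of the exponents, [jump_bound] is [k + l + d - 2], [k + d - 1] and [d] respectively. *)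
Lemma jump_formulaE k l px qx d : (0 < px)%N -> (px <= qx)%N -> coprime px qx ->
  (1 < px -> 0 < d)%N -> (k <= 1)%N -> (l <= 1)%N -> (2 <= k + l + px * d)%N ->
  jump_formula (num_d k l (px * d) (qx * d)) (num_w (px * d) (qx * d)) = maxn 1 (jump_bound k l px qx d).
Proof.
move=> px0 pq cop pd k1 l1 klp; rewrite /jump_formula /num_d /num_w /jump_bound.
have [d0|d0] := posnP d.
  have px1 : px = 1%N by apply/eqP; move: pd; rewrite d0; case: (px) px0 => [|[|n]]// _ /(_ isT).
  by move: klp; rewrite d0 !muln0 eqxx; case: k k1 => [|[|]]//; case: l l1 => [|[|]].
have [E|npq] := eqVneq px qx.
  have px1 : px = 1%N by move: cop; rewrite -E /coprime gcdnn => /eqP.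
  rewrite -E px1 !mul1n !eqxx; move: klp; rewrite px1 mul1n => klp.
  have -> : (k + l + d == 1)%N = false by rewrite gtn_eqF.
  have [E2|n2] := eqVneq (k + l + d)%N 2; first by move: k1 l1 E2; clear; lia.
  by move: k1 l1 klp n2; clear; lia.
have -> : (px * d == qx * d)%N = false by rewrite eqn_pmul2r// (negbTE npq).
rewrite dvdn_pmul2r//.
have qx1 : (qx == 1)%N = false by apply/negbTE; move: npq pq px0; clear; lia.
rewrite qx1 subn0; have [px1|px1] := eqVneq px 1%N.
  rewrite px1 dvd1n mul1n; move: klp; rewrite px1 mul1n => klp.
  have -> : maxn 1 (d - (1 - k)) = maxn 1 (k + d - 1) by move: k1 d0; clear; lia.
  have : (0 < k + d)%N by rewrite addn_gt0 d0 orbT.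
  by move: (k + d)%N => [|[|[|n]]]// _; clear; rewrite /=; lia.
have -> : (px %| qx)%N = false.
  apply/negbTE; apply: contra px1 => dv.
  by move: cop; rewrite /coprime (gcdn_idPl dv).
have -> : gcdn (px * d) (qx * d) = d by rewrite -muln_gcdl (eqP cop) mul1n.
by rewrite subn0; move: d0; clear; case: d => [|[|[|d]]]//= _; lia.
Qed.

Lemma jump_exists k l px qx d M P F : (0 < px)%N -> (px <= qx)%N -> coprime px qx ->
  (1 < px -> 0 < d)%N -> (k <= 1)%N -> (l <= 1)%N -> (2 <= k + l + px * d)%N ->
  homog qx px (d * (px * qx)) P -> cf P (px * d) 0 = 1 -> cf P 0 (qx * d) = 1 ->
  F = mon k l * P -> jac F (mon M 0) -> jac F (mon 0 M) ->
  has_jump F (maxn 1 (jump_bound k l px qx d)).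
Proof.
move=> px0 pq cop pd k1 l1 klp HP cp cq EF xM yM.
have [px1|px1] := leqP px 1; last first.
  have d0 := pd px1.
  have -> : maxn 1 (jump_bound k l px qx d) = d.
    have /negbTE p1 : px != 1%N by rewrite gtn_eqF.
    have /negbTE q1 : qx != 1%N by rewrite gtn_eqF// (leq_trans px1).
    by rewrite /jump_bound p1 q1 !subn0; apply/maxn_idPr.
  by apply: (interior_jump px1 pq cop k1 l1 d0 HP _ _ EF xM yM); rewrite ?cp ?cq oner_neq0.
have {px1} Ep : px = 1%N by apply/eqP; rewrite eqn_leq px1.
move: pq cop klp HP cp cq pd {px0}; rewrite Ep => q0 _ klp HP cp cq _.
rewrite !mul1n in klp HP cp.
have [q1|q1] := eqVneq qx 1%N.
  have -> : maxn 1 (jump_bound k l 1 qx d) = maxn 1 (k + l + d - 2).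
    by rewrite /jump_bound q1 eqxx; move: k1 l1 klp; clear; lia.
  rewrite q1 muln1 in HP.
  have HF : homog 1 1 (k + l + d) F.
    rewrite EF; apply: homogM => //; have := @homog_mon C 1 1 k l; rewrite /wt !muln1; exact.
  apply: (@homogeneous_jump C (k + l + d) (k + d) M F) => //; try by move: k1 l1 klp; clear; lia.
  rewrite EF cf_monM leq_addr addKn; have -> : (k + l + d - (k + d) = l)%N by clear; lia.
  by rewrite leqnn subnn cp oner_neq0.
have q2 : (1 < qx)%N by move: q0 q1; clear; lia.
(* The factor [x^k] is absorbed in [F1], so that [k + d] is the exponent of [x] seen by
   [axis_jump]. *)
pose F1 : R := mon k 0 * P.
have EF1 : F = mon 0 l * F1 by rewrite EF mulrA monM add0n addn0.
have kd : (0 < k + d)%N by move: l1 klp; clear; lia.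
have HF1 : homog qx 1 ((k + d).-1.+1 * qx) F1.
  rewrite prednK// mulnDl; apply: homogM => //.
  by have := @homog_mon C qx 1 k 0; rewrite /wt mul0n addn0.
have c1 : cf F1 (k + d).-1.+1 0 != 0.
  by rewrite prednK// cf_monM leq_addr addKn subn0 cp oner_neq0.
have Ejb : jump_bound k l 1 qx d = (k + d).-1.
  by rewrite /jump_bound eqxx (negbTE q1) subn0; move: k1 kd; clear; lia.
rewrite Ejb; have [n0|n0] := posnP (k + d).-1.
  have El : l = 1%N by move: n0 l1 k1 klp; clear; lia.
  rewrite n0 maxn0; apply: (@axis_jump0 C qx F F1) => //.
  - by rewrite -El.
  - by move: HF1; rewrite n0 mul1n.
  - by move: c1; rewrite n0.
have -> : maxn 1 (k + d).-1 = (k + d).-1 by apply/maxn_idPr.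
exact: (axis_jump (qx := qx) (l := l) (M := M) _ l1 n0 _ EF1 HF1 c1 xM yM).
Qed.
End NormalForm.

From mathcomp Require Import all_classical all_reals all_analysis.
Import numFieldNormedType.Exports.
Local Open Scope classical_set_scope.
Local Open Scope ring_scope.

(** * Power series in two complex variables *)

Section ComplexLimits.
Variable R : realType.
Local Notation C := (complex_field R).

Lemma near0P (P : C * C -> Prop) : (\forall z \near (0 : C * C), P z) <->
  exists d : C, 0 < d /\ forall z, `|z.1| < d -> `|z.2| < d -> P z.
Proof.
split.
  move=> /nbhs_ballP[d /= d0 H]; exists d; split=> // z z1 z2; apply: H.
  by split; rewrite /ball/= sub0r normrN.
move=> [d [d0 H]]; apply/nbhs_ballP; exists d => //= z [z1 z2].
by apply: H; [move: z1|move: z2]; rewrite /ball/= sub0r normrN.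
Qed.

Lemma near_punctured0P (P : C -> Prop) : (\forall s \near (0 : C)^', P s) <->
  exists d : C, 0 < d /\ forall s, s != 0 -> `|s| < d -> P s.
Proof.
split.
  move=> /nbhs_ballP[d /= d0 H]; exists d; split=> // s s0 sd; apply: H => //.
  by rewrite /ball/= sub0r normrN.
move=> [d [d0 H]]; apply/nbhs_ballP; exists d => //= s sd s0; apply: H => //.
by move: sd; rewrite /ball/= sub0r normrN.
Qed.

(** Monotone convergence is available for real sequences; [ofR] and [toR] carry its conclusions to
    the complex numbers. *)
Definition ofR (x : R) : C := (x%:C)%C.
Definition toR (z : C) : R := complex.Re z.

Lemma ofR_lt x y : (ofR x < ofR y) = (x < y). Proof. exact: ltcR. Qed.
Lemma ofRK z : 0 <= z -> ofR (toR z) = z.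
Proof.
case: z => a b; by rewrite /ofR /toR lecE/= => /andP[/eqP -> _].
Qed.
Lemma ofRB x y : ofR (x - y) = ofR x - ofR y. Proof. exact: rmorphB. Qed.
Lemma ofR_norm x : `|ofR x| = ofR `|x|. Proof. by rewrite /ofR normc_def/= expr0n/= addr0 sqrtr_sqr. Qed.

Lemma cvg_ofR (u : nat -> R) (l : R) : u @ \oo --> l -> (fun n => ofR (u n)) @ \oo --> ofR l.
Proof.
move=> ul; apply/cvgrPdist_lt => e e0.
have e0' : 0 < toR e by rewrite -ofR_lt ofRK ?ltW.
move/cvgrPdist_lt: ul => /(_ _ e0'); apply: filterS => n.
by rewrite -ofRB ofR_norm -{2}(ofRK (ltW e0)) ofR_lt.
Qed.
End ComplexLimits.

Definition square_sum (V : nmodType) (t : nat -> nat -> V) (n : nat) : V :=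
  \sum_(i < n) \sum_(j < n) t i j.

Lemma square_sumD (V : nmodType) (t u : nat -> nat -> V) n :
  square_sum (fun i j => t i j + u i j) n = square_sum t n + square_sum u n.
Proof. by rewrite /square_sum -big_split; apply: eq_bigr => i _; rewrite -big_split. Qed.
Lemma square_sumM (V : pzRingType) (c : V) (t : nat -> nat -> V) n :
  square_sum (fun i j => c * t i j) n = c * square_sum t n.
Proof. by rewrite /square_sum mulr_sumr; apply: eq_bigr => i _; rewrite mulr_sumr. Qed.
Lemma square_sum_ext (V : nmodType) (t u : nat -> nat -> V) n :
  (forall i j, t i j = u i j) -> square_sum t n = square_sum u n.
Proof. by move=> tu; apply: eq_bigr => i _; apply: eq_bigr => j _. Qed.
Lemma ler_square_sum (V : numDomainType) (t u : nat -> nat -> V) n :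
  (forall i j, t i j <= u i j) -> square_sum t n <= square_sum u n.
Proof. by move=> tu; apply: ler_sum => i _; apply: ler_sum. Qed.
Lemma ler_norm_square_sum (V : numDomainType) (t : nat -> nat -> V) n :
  `|square_sum t n| <= square_sum (fun i j => `|t i j|) n.
Proof.
apply: le_trans (ler_norm_sum _ _ _) _; apply: ler_sum => i _.
exact: ler_norm_sum.
Qed.
Lemma square_sum_ge0 (V : numDomainType) (t : nat -> nat -> V) n :
  (forall i j, 0 <= t i j) -> 0 <= square_sum t n.
Proof. by move=> t0; apply: sumr_ge0 => i _; apply: sumr_ge0. Qed.

Section DoubleSums.
Variable R : realType.
Local Notation C := (complex_field R).

Lemma ler_toR (z w : C) : z <= w -> toR z <= toR w.
Proof. by rewrite lecE => /andP[]. Qed.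
Lemma toR_square_sum (t : nat -> nat -> C) n : toR (square_sum t n) = square_sum (fun i j => toR (t i j)) n.
Proof.
rewrite /toR /square_sum raddf_sum; apply: eq_bigr => i _; by rewrite raddf_sum.
Qed.
Lemma ofR_square_sum (t : nat -> nat -> R) n : ofR (square_sum t n) = square_sum (fun i j => ofR (t i j)) n.
Proof.
rewrite /ofR /square_sum raddf_sum; apply: eq_bigr => i _; by rewrite raddf_sum.
Qed.

Lemma square_sum_cvgR (t : nat -> nat -> R) K : (forall i j, 0 <= t i j) ->
  (forall n, square_sum t n <= K) -> cvgn (square_sum t).
Proof.
move=> t0 tK; apply: nondecreasing_is_cvgn.
  apply/nondecreasing_seqP => n; rewrite /square_sum big_ord_recr/=.
  rewrite -[X in X <= _]addr0; apply: lerD; last by apply: sumr_ge0 => j _.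
  by apply: ler_sum => i _; rewrite big_ord_recr/= lerDl.
by exists K => _ [n _ <-].
Qed.

Lemma square_sum_cvgC_abs (t : nat -> nat -> C) K : (forall n, square_sum (fun i j => `|t i j|) n <= K) ->
  cvgn (square_sum (fun i j => `|t i j|)).
Proof.
move=> tK.
have : cvgn (square_sum (fun i j => toR `|t i j|)).
  apply: (@square_sum_cvgR _ (toR K)) => [i j|n].
    by have := ler_toR (normr_ge0 (t i j)).
  by rewrite -toR_square_sum; exact: ler_toR.
move=> H; apply: (cvgP (ofR (limn (square_sum (fun i j => toR `|t i j|))) : C)).
apply: cvg_trans (cvg_ofR H); apply: near_eq_cvg; near=> n.
by rewrite ofR_square_sum; apply: square_sum_ext => i j; rewrite ofRK.
Unshelve. all: by end_near. Qed.

(** Real and imaginary parts are treated separately: a real [p] bounded by [|t|] is the difference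
    of [p + |t|] and [|t|], whose sums are monotone and bounded. *)
Lemma square_sum_cvgC (t : nat -> nat -> C) K : (forall n, square_sum (fun i j => `|t i j|) n <= K) ->
  exists L : C, square_sum t @ \oo --> L.
Proof.
move=> tK.
have part (p : nat -> nat -> R) : (forall i j, `|p i j| <= toR `|t i j|) -> exists l : C, (fun n => ofR (square_sum p n)) @ \oo --> l.
  move=> Hp.
  have Hn : cvgn (square_sum (fun i j => toR `|t i j|)).
    apply: (@square_sum_cvgR _ (toR K)) => [i j|n].
      by have := ler_toR (normr_ge0 (t i j)).
    by rewrite -toR_square_sum; exact: ler_toR.
  have Hp2 : cvgn (square_sum (fun i j => p i j + toR `|t i j|)).
    apply: (@square_sum_cvgR _ (toR K *+ 2)) => [i j|n].
      by have := Hp i j; rewrite ler_norml => /andP[H _]; rewrite -lerBlDr sub0r.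
    rewrite square_sumD mulr2n lerD//; last by rewrite -toR_square_sum; exact: ler_toR.
    apply: (@le_trans _ _ (square_sum (fun i j => toR `|t i j|) n)); last by rewrite -toR_square_sum; exact: ler_toR.
    by apply: ler_square_sum => i j; apply: le_trans (ler_norm _) (Hp i j).
  exists (ofR (limn (square_sum (fun i j => p i j + toR `|t i j|)) - limn (square_sum (fun i j => toR `|t i j|)))).
  apply: cvg_ofR; apply: cvg_trans (cvgB Hp2 Hn); apply: near_eq_cvg; near=> n.
  by rewrite /= fctE square_sumD addrK.
have [l1 H1] : exists l : C, (fun n => ofR (square_sum (fun i j => complex.Re (t i j)) n)) @ \oo --> l.
  by apply: part => i j; have := ler_toR (normc_ge_Re (t i j)).
have [l2 H2] : exists l : C, (fun n => ofR (square_sum (fun i j => complex.Im (t i j)) n)) @ \oo --> l.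
  by apply: part => i j; rewrite /toR normc_def/= -sqrtr_sqr ler_wsqrtr// lerDr sqr_ge0.
exists (l1 + ('i%C : C) * l2).
have -> : square_sum t = (fun n => ofR (square_sum (fun i j => complex.Re (t i j)) n) +
    ('i%C : C) * ofR (square_sum (fun i j => complex.Im (t i j)) n)).
  apply/funext => n; rewrite !ofR_square_sum -square_sumM -square_sumD; apply: square_sum_ext => i j.
  by rewrite /= [LHS]complexE.
exact: cvgD H1 (cvgM (cvg_cst ('i%C : C)) H2).
Unshelve. all: by end_near. Qed.

Lemma norm_lim_le (u : nat -> C) L K : u @ \oo --> L -> (forall n, `|u n| <= K) -> `|L| <= K.
Proof.
move=> uL uK; have K0 : 0 <= K by exact: le_trans (uK 0%N).
rewrite real_leNgt ?normr_real// ?ger0_real//; apply/negP => KL.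
have e0 : 0 < `|L| - K by rewrite subr_gt0.
have /cvgrPdist_lt/(_ _ e0)[N _ /(_ N (leqnn N))/= H] := uL.
have : `|L| < (`|L| - K) + K.
  apply: le_lt_trans (_ : `|L - u N| + `|u N| < _); first by rewrite -{1}(subrK (u N) L) ler_normD.
  by apply: ltr_leD.
by rewrite subrK ltxx.
Qed.

Lemma geo_sum n : \sum_(i < n) (2^-1 : C) ^+ i <= 2.
Proof.
have -> : \sum_(i < n) (2^-1 : C) ^+ i = 2 - 2 * 2^-1 ^+ n.
  elim: n => [|n IH]; first by rewrite big_ord0 expr0 mulr1 subrr.
  by rewrite big_ord_recr/= IH exprS; field.
by rewrite gerBl mulr_ge0// exprn_ge0// invr_ge0.
Qed.

Lemma geo_square_sum n : square_sum (fun i j => (2^-1 : C) ^+ (i + j)) n <= 4.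
Proof.
have -> : square_sum (fun i j => (2^-1 : C) ^+ (i + j)) n = (\sum_(i < n) (2^-1 : C) ^+ i) * (\sum_(i < n) (2^-1 : C) ^+ i).
  rewrite mulr_suml; apply: eq_bigr => i _; rewrite mulr_sumr.
  by apply: eq_bigr => j _; rewrite exprD.
have -> : 4 = 2 * 2 :> C by rewrite -natrM.
by apply: ler_pM; rewrite ?geo_sum// sumr_ge0// => i _; rewrite exprn_ge0// invr_ge0.
Qed.

(** The geometric majorant of ratio 1/2, whose square sums are at most [4 M]. *)
Definition dominated (t : nat -> nat -> C) (M : C) :=
  forall i j, `|t i j| <= M * 2^-1 ^+ (i + j).

Lemma dominated_square_sum t M n : 0 <= M -> dominated t M -> square_sum (fun i j => `|t i j|) n <= M * 4.
Proof.
move=> M0 tM; apply: le_trans (ler_square_sum _ tM) _.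
by rewrite square_sumM ler_wpM2l// geo_square_sum.
Qed.

Lemma dominated_cvg t M : 0 <= M -> dominated t M ->
  cvgn (square_sum (fun i j => `|t i j|)) /\ exists2 L : C, square_sum t @ \oo --> L & `|L| <= M * 4.
Proof.
move=> M0 tM; split; first by apply: (@square_sum_cvgC_abs _ (M * 4)) => n; exact: dominated_square_sum.
have [|L HL] := @square_sum_cvgC t (M * 4); first by move=> n; exact: dominated_square_sum.
exists L => //; apply: (norm_lim_le HL) => n.
by apply: le_trans (ler_norm_square_sum _ _) _; exact: dominated_square_sum.
Qed.

Lemma half_cvg : (fun n => (2^-1 : C) ^+ n) @ \oo --> (0 : C).
Proof.
have H : (fun n => (2^-1 : R) ^+ n) @ \oo --> (0 : R).
  by apply: cvg_expr; rewrite ger0_norm ?invr_ge0// invf_lt1// ltr1n.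
have := cvg_ofR H; have -> : ofR (0 : R) = 0 :> C by [].
have -> // : (fun n => ofR ((2^-1 : R) ^+ n)) = (fun n => (2^-1 : C) ^+ n).
by apply/funext => n; rewrite /ofR rmorphXn fmorphV rmorph_nat.
Qed.
End DoubleSums.

(** * Germs through the growth of their coefficients *)

Section Expansions.
Variable R : realType.
Local Notation C := (complex_field R).
Implicit Types (f g h : C * C -> C) (a b : nat -> nat -> C) (z : C * C).

Definition expands f a := \forall z \near (0 : C * C),
  cvgn (abs_power_sum a z) /\ power_sum a z @ \oo --> f z.

Definition term a z (i j : nat) : C := a i j * z.1 ^+ i * z.2 ^+ j.

Lemma power_sumE a z : power_sum a z = square_sum (term a z). Proof. by []. Qed.

(** Cauchy estimates. They reduce convergence of sums, products, inverses and derivatives to bounds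
    on coefficients, with explicit [M] and [r]. *)
Definition geo_with a (M r : C) :=
  [/\ 0 <= M, 0 < r & forall i j, `|a i j| * r ^+ (i + j) <= M].
Definition geo a := exists M r, geo_with a M r.

Lemma half_pos (x : C) : 0 < x -> 0 < x / 2.
Proof. by move=> x0; rewrite divr_gt0. Qed.

Lemma geo_weaken a M r r' : 0 < r' -> r' <= r -> geo_with a M r -> geo_with a M r'.
Proof.
move=> r0 rr [M0 _ H]; split=> // i j; apply: le_trans (H i j).
by rewrite ler_wpM2l// lerXn2r ?nnegrE// ltW// (lt_le_trans r0).
Qed.

Lemma common_radius (r s : C) : 0 < r -> 0 < s -> exists t : C, [/\ 0 < t, t <= r & t <= s].
Proof.
move=> r0 s0; exists (r * s / (r + s)); have rs : 0 < r + s by rewrite addr_gt0.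
split; first by rewrite divr_gt0// mulr_gt0.
  by rewrite ler_pdivrMr// ler_wpM2l ?(ltW r0)// lerDr ltW.
by rewrite ler_pdivrMr// mulrC ler_wpM2l ?(ltW s0)// lerDl ltW.
Qed.

Lemma term_dominated a M r (k : nat) z : geo_with a M r ->
  `|z.1| <= r * 2^-1 ^+ k -> `|z.2| <= r * 2^-1 ^+ k ->
  forall i j, `|term a z i j| <= M * 2^-1 ^+ (k * (i + j)).
Proof.
move=> [M0 r0 H] z1 z2 i j; rewrite /term !normrM !normrX.
set q := r * 2^-1 ^+ k in z1 z2.
have -> : M * 2^-1 ^+ (k * (i + j)) = M / r ^+ (i + j) * q ^+ i * q ^+ j.
  by rewrite -mulrA -exprD /q exprMn -exprM mulrA divfK// expf_neq0// gt_eqF.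
have q0 : 0 <= q by exact: le_trans z1.
rewrite ler_pM ?mulr_ge0 ?exprn_ge0// ?lerXn2r ?nnegrE//.
by rewrite ler_pM ?exprn_ge0// ?lerXn2r ?nnegrE// ler_pdivlMr ?exprn_gt0.
Qed.

Lemma term_dominated1 a M r z : geo_with a M r -> `|z.1| <= r / 2 -> `|z.2| <= r / 2 ->
  dominated (term a z) M.
Proof. by move=> ga z1 z2 i j; rewrite -[(i + j)%N]mul1n; exact: (term_dominated ga). Qed.

Lemma near_small (r : C) : 0 < r -> \forall z \near (0 : C * C), `|z.1| <= r /\ `|z.2| <= r.
Proof. by move=> r0; apply/near0P; exists r; split=> // z /ltW z1 /ltW z2. Qed.

(** Abel's lemma: absolute convergence at the point [(d/2, d/2)] bounds the terms there, which gives
    the estimates; the converse is comparison with a geometric series. *)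
Lemma expandsP f a : expands f a <->
  geo a /\ \forall z \near (0 : C * C), power_sum a z @ \oo --> f z.
Proof.
split=> [fa|[[M [r [M0 r0 H]]] fa]].
  split; last by move: fa; apply: filterS => z [].
  have [d [d0 H]] := (near0P _).1 fa.
  have d2 : 0 < d / 2 by exact: half_pos.
  have nd : `|d / 2| = d / 2 by rewrite ger0_norm ?ltW.
  have dd : `|d / 2| < d by rewrite nd ltr_pdivrMr// mulr_natr mulr2n ltrDl.
  have [Hc _] := H (d / 2, d / 2) dd dd.
  have /cvgrPdist_lt/(_ _ ltr01)[N _ HN] := Hc.
  set L := lim _ in HN.
  exists (`|L| + 1), (d / 2); split=> [||i j]; [by rewrite addr_ge0|by []|].
  pose n := (maxn N (maxn i j)).+1.
  have iN : (i < n)%N by rewrite ltnS !leq_max leqnn orbT.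
  have jN : (j < n)%N by rewrite ltnS !leq_max leqnn !orbT.
  have nN : (N <= n)%N by rewrite leqW// leq_maxl.
  have tn : `|a i j * (d / 2) ^+ i * (d / 2) ^+ j| <= abs_power_sum a (d / 2, d / 2) n.
    rewrite /abs_power_sum (bigD1 (Ordinal iN))//= (bigD1 (Ordinal jN))//= -addrA lerDl.
    by rewrite addr_ge0// ?sumr_ge0// => k _; rewrite sumr_ge0.
  have -> : `|a i j| * (d / 2) ^+ (i + j) = `|a i j * (d / 2) ^+ i * (d / 2) ^+ j|.
    by rewrite !normrM !normrX nd exprD mulrA.
  apply: le_trans tn _.
  have a0 : 0 <= abs_power_sum a (d / 2, d / 2) n.
    by rewrite sumr_ge0// => k _; rewrite sumr_ge0.
  rewrite -(ger0_norm a0) -{1}(subrK L (abs_power_sum _ _ _)).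
  apply: le_trans (ler_normD _ _) _; rewrite addrC lerD2l distrC ltW//.
  exact: HN.
have r2 := half_pos r0.
have := near_small r2.
move: fa.
apply: filterS2 => z fz.
move=> [z1 z2].
split; last exact: fz.
exact: (dominated_cvg M0 (term_dominated1 (And3 M0 r0 H) z1 z2)).1.
Qed.

Lemma geo_expands a : geo a -> exists f, expands f a.
Proof.
move=> ga; have [M [r gr]] := ga; have [M0 r0 H] := gr.
exists (fun z => xget 0 [set l : C | power_sum a z @ \oo --> l]).
apply/expandsP; split=> //; have := near_small (half_pos r0); apply: filterS => z [z1 z2].
have [L HL _] := (dominated_cvg M0 (term_dominated1 gr z1 z2)).2.
have /(xgetPex 0) : exists l : C, power_sum a z @ \oo --> l by exists L.
exact.
Qed.

Lemma expands_hol f a : expands f a -> holomorphic_germ f. Proof. by exists a. Qed.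

Lemma expands_near f g a : expands f a -> (\forall z \near (0 : C * C), f z = g z) -> expands g a.
Proof. by move=> fa fg; move: fa fg; apply: filterS2 => z [? ?] <-. Qed.

Lemma limC_unique (u : nat -> C) (k l : C) : u @ \oo --> k -> u @ \oo --> l -> k = l.
Proof. exact: norm_cvg_unique. Qed.

Lemma expands_fun_unique f g a : expands f a -> expands g a -> \forall z \near (0 : C * C), f z = g z.
Proof.
move=> fa ga; move: fa ga; apply: filterS2 => z [_ H1] [_ H2].
exact: limC_unique H1 H2.
Qed.

Lemma expands0 f a : expands f a -> f 0 = a 0%N 0%N.
Proof.
move=> /nbhs_singleton[_ H]; apply: limC_unique H _.
apply: cvg_near_cst; exists 1%N => // n /= n0.
case: n n0 => // n _; rewrite power_sumE /square_sum big_ord_recl [X in _ + X]big1 => [|i _]; last first.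
  by rewrite big1// => j _; rewrite /term/= exprS mul0r mulr0 mul0r.
rewrite big_ord_recl [X in _ + X + _]big1 => [|j _]; last first.
  by rewrite /term/= exprS mul0r mulr0.
by rewrite !addr0 /term/= !expr0 !mulr1.
Qed.

Lemma geoD a b : geo a -> geo b -> geo (fun i j => a i j + b i j).
Proof.
move=> [M [r [M0 r0 H]]] [M' [r' [M'0 r'0 H']]].
have [t [t0 tr tr']] := common_radius r0 r'0.
have [_ _ G] := geo_weaken t0 tr (And3 M0 r0 H).
have [_ _ G'] := geo_weaken t0 tr' (And3 M'0 r'0 H').
exists (M + M'), t; split=> // [|i j]; first exact: addr_ge0.
apply: le_trans (_ : (`|a i j| + `|b i j|) * t ^+ (i + j) <= _).
  by rewrite ler_wpM2r ?ler_normD// exprn_ge0// ltW.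
by rewrite mulrDl lerD.
Qed.

Lemma geoZ c a : geo a -> geo (fun i j => c * a i j).
Proof.
move=> [M [r [M0 r0 H]]]; exists (`|c| * M), r; split=> // [|i j]; first exact: mulr_ge0.
by rewrite normrM -mulrA ler_wpM2l.
Qed.

Lemma expandsD f g a b : expands f a -> expands g b ->
  expands (fun z => f z + g z) (fun i j => a i j + b i j).
Proof.
move=> /expandsP[ga fa] /expandsP[gb fb]; apply/expandsP; split; first exact: geoD.
move: fa fb; apply: filterS2 => z H1 H2.
have -> : power_sum (fun i j => a i j + b i j) z = (fun n => power_sum a z n + power_sum b z n).
  apply/funext => n; rewrite !power_sumE -square_sumD; apply: square_sum_ext => i j.
  by rewrite /term !mulrDl.
exact: (cvgD H1 H2).
Qed.

Lemma expandsZ c f a : expands f a -> expands (fun z => c * f z) (fun i j => c * a i j).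
Proof.
move=> /expandsP[ga fa]; apply/expandsP; split; first exact: geoZ.
move: fa; apply: filterS => z H1.
have -> : power_sum (fun i j => c * a i j) z = (fun n => c * power_sum a z n).
  apply/funext => n; rewrite !power_sumE -square_sumM; apply: square_sum_ext => i j.
  by rewrite /term !mulrA.
exact: (cvgM (cvg_cst c) H1).
Qed.

Lemma poly_germD (H A : {poly {poly C}}) z : poly_germ (H + A) z = poly_germ H z + poly_germ A z.
Proof. by rewrite /poly_germ !hornerD. Qed.
Lemma poly_germM (H A : {poly {poly C}}) z : poly_germ (H * A) z = poly_germ H z * poly_germ A z.
Proof. by rewrite /poly_germ !hornerM. Qed.
Lemma poly_germZ c (H : bip C) z : poly_germ (c *: H) z = c * poly_germ H z.
Proof. by rewrite bscaleE poly_germM /poly_germ !hornerC. Qed.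
Lemma poly_germ_mon i j z : poly_germ (@mon C i j) z = z.1 ^+ i * z.2 ^+ j.
Proof. by rewrite mon.unlock poly_germM /poly_germ hornerXn hornerC !hornerXn -rmorphXn hornerC. Qed.

Lemma poly_germE (H : {poly {poly C}}) z n : (forall i j, cf H i j != 0 -> (i < n)%N && (j < n)%N) ->
  poly_germ H z = square_sum (term (cf H) z) n.
Proof.
move=> Hn; rewrite [in LHS](bip_expand Hn).
have g0 : poly_germ (0 : {poly {poly C}}) z = 0 by rewrite /poly_germ !horner0.
rewrite (big_morph (fun H => poly_germ H z) (fun A B => poly_germD A B z) g0).
rewrite /square_sum pair_bigA/=; apply: eq_bigr => u _.
by rewrite poly_germZ poly_germ_mon /term mulrA.
Qed.

Lemma geo_poly (H : {poly {poly C}}) : geo (cf H).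
Proof.
have [n Hn] := cf_bound H.
exists (square_sum (fun i j => `|cf H i j|) n), 1; split=> //; first exact: square_sum_ge0.
move=> i j; rewrite expr1n mulr1; have [->|h0] := eqVneq (cf H i j) 0.
  by rewrite normr0 square_sum_ge0.
have /andP[iN jN] := Hn _ _ h0.
rewrite /square_sum (bigD1 (Ordinal iN))//= (bigD1 (Ordinal jN))//= -addrA lerDl.
by rewrite addr_ge0// ?sumr_ge0// => k _; rewrite sumr_ge0.
Qed.

Lemma square_sum_stable (t : nat -> nat -> C) n m : (n <= m)%N ->
  (forall i j, t i j != 0 -> (i < n)%N && (j < n)%N) -> square_sum t m = square_sum t n.
Proof.
move=> nm H; rewrite /square_sum (big_ord_widen _ (fun i => \sum_(j < n) t i j) nm) [RHS]big_mkcond/=.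
apply: eq_bigr => i _; case: ltnP => ni.
  rewrite (big_ord_widen _ (fun j => t i j) nm) [RHS]big_mkcond/=.
  apply: eq_bigr => j _; case: ltnP => nj //.
  by apply/eqP; apply: contraTT nj => /H/andP[_]; rewrite ltnNge.
by rewrite big1// => j _; apply/eqP; apply: contraTT ni => /H/andP[]; rewrite ltnNge.
Qed.

Lemma expands_poly (H : {poly {poly C}}) : expands (poly_germ H) (cf H).
Proof.
apply/expandsP; split; first exact: geo_poly.
apply/near0P; exists 1; split=> // z _ _; have [n Hn] := cf_bound H.
apply: cvg_near_cst; exists n => // m /= nm.
rewrite power_sumE (poly_germE z Hn); apply: square_sum_stable => // i j.
by rewrite /term !mulf_eq0 !negb_or => /andP[/andP[/Hn]].
Qed.

Definition conv a b (k l : nat) : C :=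
  \sum_(i < k.+1) \sum_(j < l.+1) a i j * b (k - i)%N (l - j)%N.

(** There are [(k + 1) (l + 1) <= 2^(k+l)] terms; [geo_conv] pays for this factor by halving the
    radius. *)
Lemma conv_bound a b M M' r k l : geo_with a M r -> geo_with b M' r ->
  \sum_(i < k.+1) \sum_(j < l.+1) `|a i j| * `|b (k - i)%N (l - j)%N|
    <= M * M' * 2 ^+ (k + l) / r ^+ (k + l).
Proof.
move=> [M0 r0 H] [M'0 _ H']; rewrite ler_pdivlMr ?exprn_gt0//.
apply: (@le_trans _ _ (\sum_(i < k.+1) \sum_(j < l.+1) M * M')).
  rewrite mulr_suml; apply: ler_sum => i _; rewrite mulr_suml; apply: ler_sum => j _.
  have -> : r ^+ (k + l) = r ^+ (i + j) * r ^+ (k - i + (l - j)).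
    by rewrite -exprD; congr (_ ^+ _); have := ltn_ord i; have := ltn_ord j; lia.
  by rewrite mulrACA ler_pM ?mulr_ge0 ?exprn_ge0 ?(ltW r0) ?H ?H'.
rewrite (eq_bigr (fun=> (M * M') *+ l.+1)) => [|i _]; last by rewrite big_const_ord iter_addr_0.
rewrite big_const_ord iter_addr_0 -mulrnA -[_ *+ (_ * _)]mulr_natr ler_wpM2l ?mulr_ge0//.
by rewrite -natrX ler_nat expnD mulnC leq_mul// ltn_expl.
Qed.

Lemma geo_conv a b M M' r : geo_with a M r -> geo_with b M' r ->
  geo_with (conv a b) (M * M') (r / 2).
Proof.
move=> ga gb; have [M0 r0 _] := ga; have [M'0 _ _] := gb.
split=> [||k l]; [exact: mulr_ge0|exact: half_pos|].
have := conv_bound k l ga gb.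
have q0 : 0 < (r / 2) ^+ (k + l) by rewrite exprn_gt0// half_pos.
rewrite -(ler_pM2r q0) [X in _ <= X -> _](_ : _ = M * M'); last first.
  by rewrite expr_div_n mulrA mulfVK ?mulfK// expf_neq0// ?gt_eqF// ?ltr0n.
apply: le_trans; rewrite ler_pM2r//; apply: le_trans (ler_norm_sum _ _ _) _.
apply: ler_sum => i _; apply: le_trans (ler_norm_sum _ _ _) _.
by apply: ler_sum => j _; rewrite normrM.
Qed.

Lemma geoM a b : geo a -> geo b -> geo (conv a b).
Proof.
move=> [M [r ga]] [M' [r' gb]]; have [_ r0 _] := ga; have [_ r'0 _] := gb.
have [t [t0 tr tr']] := common_radius r0 r'0.
exists (M * M'), (t / 2); apply: geo_conv; [exact: geo_weaken ga|exact: geo_weaken gb].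
Qed.

Definition trunc a n : {poly {poly C}} := \poly_(i < n) \poly_(j < n) a i j.

Lemma cf_trunc a n i j : cf (trunc a n) i j = if (i < n)%N && (j < n)%N then a i j else 0.
Proof.
rewrite /cf coef_poly; case: ltnP => _ /=; last by rewrite coef0.
by rewrite coef_poly.
Qed.

Lemma trunc_germ a n z : poly_germ (trunc a n) z = power_sum a z n.
Proof.
rewrite (@poly_germE _ z n); last by move=> i j; rewrite cf_trunc; case: ifP; rewrite ?eqxx.
by apply: eq_bigr => i _; apply: eq_bigr => j _; rewrite /term cf_trunc !ltn_ord.
Qed.

Lemma geo_trunc a M r n : geo_with a M r -> geo_with (cf (trunc a n)) M r.
Proof.
move=> [M0 r0 H]; split=> // i j; rewrite cf_trunc; case: ifP => _; first exact: H.
by rewrite normr0 mul0r.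
Qed.

(** The product of the partial sums and the partial sum of the Cauchy product differ only by terms
    having an index at least [n], a tail that tends to 0. *)
Lemma expandsM f g a b : expands f a -> expands g b ->
  expands (fun z => f z * g z) (conv a b).
Proof.
move=> /expandsP[ga fa] /expandsP[gb fb]; apply/expandsP; split; first exact: geoM.
have [M [r gM]] := ga; have [M' [r' gM']] := gb.
have [M0 r0 _] := gM; have [M'0 r'0 _] := gM'.
have [t [t0 tr tr']] := common_radius r0 r'0.
have ga' := geo_weaken t0 tr gM; have gb' := geo_weaken t0 tr' gM'.
(* For [z] of size at most [t / 8] the terms, estimated at radius [t / 2], decay like [4^-(i+j)]:
   one factor [2^-(i+j)] is summed, the other gives [2^-n] outside the square. *)
have t8 : 0 < t * 2^-1 ^+ 3 by rewrite mulr_gt0// exprn_gt0// invr_gt0.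
have := near_small t8; move: fa fb; apply: filterS3 => z H1 H2 [z1 z2].
have HM : (fun n => power_sum a z n * power_sum b z n) @ \oo --> f z * g z by exact: (cvgM H1 H2).
pose u n i j : C := if (i < n)%N && (j < n)%N then 0 else term (cf (trunc a n * trunc b n)) z i j.
have E n : power_sum a z n * power_sum b z n - power_sum (conv a b) z n = square_sum (u n) (n + n).
  rewrite -!trunc_germ -poly_germM (@poly_germE _ z (n + n)); last first.
    move=> i j; apply: contraNT; rewrite negb_and -!leqNgt => H; apply/eqP.
    rewrite cfM; apply: big1 => k _; apply: big1 => l _; rewrite !cf_trunc.
    by case: andP => [[kn ln]|]; rewrite ?mul0r//; case: andP => [[kn' ln']|]; rewrite ?mulr0//;
      exfalso; move: H kn ln kn' ln' (leq_ord k) (leq_ord l); clear; lia.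
  have -> : poly_germ (trunc (conv a b) n) z = square_sum (term (cf (trunc (conv a b) n)) z) (n + n).
    by apply: poly_germE => i j; rewrite cf_trunc; case: ifP; rewrite ?eqxx// => /andP[iN jN] _; rewrite !ltn_addr.
  rewrite -[X in _ - X]mul1r -mulNr -square_sumM -square_sumD; apply: square_sum_ext => i j.
  rewrite /u /term cf_trunc; case: ifP => [/andP[iN jN]|_]; last by rewrite !mul0r mulr0 addr0.
  rewrite mulN1r; apply/eqP; rewrite subr_eq0; apply/eqP; congr (_ * _ * _).
  rewrite cfM /conv; apply: eq_bigr => k _; apply: eq_bigr => l _; rewrite !cf_trunc.
  have -> : (k < n)%N := leq_ltn_trans (leq_ord k) iN.
  have -> : (l < n)%N := leq_ltn_trans (leq_ord l) jN.
  have -> : (i - k < n)%N := leq_ltn_trans (leq_subr _ _) iN.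
  by have -> : (j - l < n)%N := leq_ltn_trans (leq_subr _ _) jN.
have Z : (fun n => square_sum (u n) (n + n)) @ \oo --> (0 : C).
  apply/cvgrPdist_le => e e0.
  have h0 : (fun n => (M * M' * 4) * 2^-1 ^+ n : C) @ \oo --> (M * M' * 4) * (0 : C).
    by apply: cvgM; [exact: cvg_cst|exact: half_cvg].
  rewrite mulr0 in h0; move/cvgrPdist_le: h0 => /(_ _ e0); apply: filterS => n.
  rewrite !sub0r !normrN; apply: le_trans.
  rewrite [X in _ <= X]ger0_norm; last by rewrite !mulr_ge0// exprn_ge0// invr_ge0.
  apply: le_trans (ler_norm_square_sum _ _) _.
  apply: (@le_trans _ _ (square_sum (fun i j => (M * M' * 2^-1 ^+ n) * 2^-1 ^+ (i + j)) (n + n))).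
    apply: ler_square_sum => i j; rewrite /u; case: ifP => [_|/negbT ij].
      by rewrite normr0 !mulr_ge0// exprn_ge0// invr_ge0.
    have gp : geo_with (cf (trunc a n * trunc b n)) (M * M') (t / 2).
      have [G0 G1 G2] := geo_conv (geo_trunc n ga') (geo_trunc n gb').
      by split=> // k l; rewrite cfM; exact: G2.
    have z1' : `|z.1| <= t / 2 * 2^-1 ^+ 2 by rewrite -mulrA -exprS.
    have z2' : `|z.2| <= t / 2 * 2^-1 ^+ 2 by rewrite -mulrA -exprS.
    apply: le_trans (term_dominated gp z1' z2' i j) _.
    rewrite -[X in _ <= X]mulrA ler_wpM2l ?mulr_ge0// -exprD.
    apply: ler_wiXn2l; rewrite ?invr_ge0// ?invf_le1// ?ler1n//.
    by move: ij; clear; rewrite negb_and -!leqNgt; lia.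
  rewrite square_sumM -!mulrA !ler_wpM2l// mulrC ler_wpM2r ?geo_square_sum// exprn_ge0// invr_ge0//.
have -> : power_sum (conv a b) z = (fun n => power_sum a z n * power_sum b z n - square_sum (u n) (n + n)).
  by apply/funext => n; rewrite -E opprB addrC subrK.
rewrite -[f z * g z]subr0; exact: (cvgB HM Z).
Qed.
End Expansions.

Section Inverse.
Variable R : realType.
Local Notation C := (complex_field R).
Implicit Types (f g h u : C * C -> C) (a b : nat -> nat -> C) (z : C * C).

Variable a : nat -> nat -> C.
Hypothesis a0 : a 0%N 0%N != 0.

Definition delta (k l : nat) : C := ((k == 0) && (l == 0))%:R.
Definition off (t : nat -> nat -> C) (i j : nat) : C := if (i == 0%N) && (j == 0%N) then 0 else t i j.

(** The recursion on the total degree [k + l] is not structural: a counter exceeding it is supplied,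
    and by [inv_fuelE] its value does not matter. *)
Fixpoint inv_fuel (n k l : nat) : C := match n with
  | 0%N => 0
  | n'.+1 => (a 0%N 0%N)^-1 * (delta k l - \sum_(i < k.+1) \sum_(j < l.+1)
      off (fun i j => a i j * inv_fuel n' (k - i) (l - j)) i j)
  end.
Definition inv_coef k l := inv_fuel (k + l).+1 k l.

Lemma inv_fuelE n k l : (k + l < n)%N -> inv_fuel n k l = inv_coef k l.
Proof.
suff H m m' : (k + l < m)%N -> (k + l < m')%N -> inv_fuel m k l = inv_fuel m' k l.
  by move=> kln; exact: H.
elim: m m' k l => [//|m IH] [//|m'] k l /= klm klm'; congr (_ * (_ - _)).
apply: eq_bigr => i _; apply: eq_bigr => j _; rewrite /off; case: ifP => // ij.
have ki : (k - i + (l - j) < k + l)%N.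
  by move: ij klm (leq_ord i) (leq_ord j); clear; case: (i : nat) => [|i']; case: (j : nat) => [|j'] //= _; lia.
by congr (_ * _); apply: IH; exact: leq_trans ki _.
Qed.

Lemma inv_coefE k l : inv_coef k l = (a 0%N 0%N)^-1 * (delta k l -
  \sum_(i < k.+1) \sum_(j < l.+1) off (fun i j => a i j * inv_coef (k - i) (l - j)) i j).
Proof.
rewrite {1}/inv_coef /=; congr (_ * (_ - _)).
apply: eq_bigr => i _; apply: eq_bigr => j _; rewrite /off; case: ifP => // ij.
congr (_ * _); apply: inv_fuelE.
by move: ij (leq_ord i) (leq_ord j); clear; case: (i : nat) => [|i']; case: (j : nat) => [|j'] //= _; lia.
Qed.

Lemma sum_off (t : nat -> nat -> C) k l : \sum_(i < k.+1) \sum_(j < l.+1) t i j =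
  t 0%N 0%N + \sum_(i < k.+1) \sum_(j < l.+1) off t i j.
Proof.
pose d i j : C := if (i == 0%N) && (j == 0%N) then t i j else 0.
have dE i j : t i j = d i j + off t i j by rewrite /d /off; case: ifP; rewrite ?addr0 ?add0r.
have -> : t 0%N 0%N = \sum_(i < k.+1) \sum_(j < l.+1) d i j.
  rewrite (bigD1 ord0)//= (bigD1 ord0)//= big1 ?addr0 => [|j j0]; last first.
    by rewrite /d eqxx /= (negPf (j0 : nat_of_ord j != 0%N)).
  rewrite big1 ?addr0// => i i0; rewrite big1// => j _.
  by rewrite /d (negPf (i0 : nat_of_ord i != 0%N)).
rewrite -big_split; apply: eq_bigr => i _; rewrite -big_split; exact: eq_bigr.
Qed.

Lemma conv_inv k l : conv a inv_coef k l = delta k l.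
Proof.
rewrite /conv (sum_off (fun i j => a i j * inv_coef (k - i) (l - j))) !subn0.
by rewrite [X in a _ _ * X]inv_coefE mulVKf// subrK.
Qed.

Lemma geo_inv : geo a -> geo inv_coef.
Proof.
move=> [M [r [M0 r0 H]]].
have na : 0 < `|a 0%N 0%N| by rewrite normr_gt0.
have aM : `|a 0%N 0%N| <= M by have := H 0%N 0%N; rewrite expr0 mulr1.
have Mp : 0 < M by exact: lt_le_trans aM.
(* After scaling, the sum in [inv_coefE] has to be at most [|a 0 0|]. For [i + j > 0] and [e <= 1/2]
   one has [e^(i+j) <= 2 e 2^-(i+j)], and these powers of 1/2 sum to at most 4, times the bound
   being proved: whence the 8. *)
have [e [eE e0 e1]] : exists e : C, [/\ e = `|a 0%N 0%N| / (M * 8), 0 < e & e <= 2^-1].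
  exists (`|a 0%N 0%N| / (M * 8)); split=> //; first by rewrite divr_gt0// mulr_gt0.
  rewrite ler_pdivrMr ?mulr_gt0// (le_trans aM)//.
  rewrite [X in _ <= X](_ : _ = M * 4); last by field.
  by rewrite ler_peMr// ler1n.
pose B := `|a 0%N 0%N|^-1.
have B0 : 0 <= B by rewrite invr_ge0.
exists B, (r * e); split=> //; first exact: mulr_gt0.
move=> k l; have [n] := ubnP (k + l)%N; elim: n k l => [//|n IH] k l kln.
have re0 m : 0 <= (r * e) ^+ m by rewrite exprn_ge0// mulr_ge0// ltW.
rewrite inv_coefE normrM normfV -/B -mulrA -[X in _ <= X]mulr1 ler_wpM2l//.
have [/andP[/eqP-> /eqP->]|kl] := boolP ((k == 0%N) && (l == 0%N)).
  by rewrite !big_ord1 /off/= subr0 /delta/= normr1 expr0 mul1r.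
rewrite /delta (negPf kl) sub0r normrN.
have four : \sum_(i < k.+1) \sum_(j < l.+1) (2^-1 : C) ^+ (i + j) <= 4.
  have -> : \sum_(i < k.+1) \sum_(j < l.+1) (2^-1 : C) ^+ (i + j) =
     (\sum_(i < k.+1) (2^-1 : C) ^+ i) * (\sum_(i < l.+1) (2^-1 : C) ^+ i).
    rewrite mulr_suml; apply: eq_bigr => i _; rewrite mulr_sumr.
    by apply: eq_bigr => j _; rewrite exprD.
  have -> : 4 = 2 * 2 :> C by rewrite -natrM.
  by apply: ler_pM; rewrite ?geo_sum// sumr_ge0// => i _; rewrite exprn_ge0// invr_ge0.
apply: (@le_trans _ _ (\sum_(i < k.+1) \sum_(j < l.+1) (M * B * (e * 2)) * 2^-1 ^+ (i + j))); last first.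
  rewrite (eq_bigr (fun i : 'I_k.+1 => (M * B * (e * 2)) * \sum_(j < l.+1) 2^-1 ^+ (i + j))); last first.
    by move=> i _; rewrite mulr_sumr.
  rewrite -mulr_sumr; apply: le_trans (_ : (M * B * (e * 2)) * 4 <= _).
    by rewrite ler_wpM2l ?mulr_ge0 ?(ltW e0).
  rewrite eE /B le_eqVlt; apply/orP; left; apply/eqP; field.
  by rewrite !gt_eqF.
apply: le_trans (ler_wpM2r (re0 _) (ler_norm_sum _ _ _)) _.
rewrite mulr_suml; apply: ler_sum => i _.
apply: le_trans (ler_wpM2r (re0 _) (ler_norm_sum _ _ _)) _.
rewrite mulr_suml; apply: ler_sum => j _; rewrite /off; case: ifP => [_|ij].
  by rewrite normr0 mul0r ?mulr_ge0 ?exprn_ge0 ?invr_ge0 ?(ltW e0).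
have ki : (k - i + (l - j) < n)%N.
  by move: ij kln (leq_ord i) (leq_ord j); clear; case: (i : nat) => [|i']; case: (j : nat) => [|j'] //= _; lia.
have -> : (k + l = (i + j) + (k - i + (l - j)))%N.
  by move: (leq_ord i) (leq_ord j); clear; lia.
rewrite exprD normrM mulrACA.
have step : `|a i j| * (r * e) ^+ (i + j) <= M * (e * 2 * 2^-1 ^+ (i + j)).
  have -> : `|a i j| * (r * e) ^+ (i + j) = `|a i j| * r ^+ (i + j) * e ^+ (i + j).
    by rewrite exprMn mulrA.
  apply: ler_pM; [by rewrite mulr_ge0// exprn_ge0// ltW|by rewrite exprn_ge0// ltW|exact: H|].
  have : (0 < i + j)%N by move: ij; clear; case: (i : nat) => [|i']; case: (j : nat) => [|j'].
  move: (i + j)%N => [//|s] _; rewrite !exprS.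
  have -> : e * 2 * (2^-1 * 2^-1 ^+ s) = e * 2^-1 ^+ s :> C by field.
  by rewrite ler_wpM2l ?(ltW e0)// lerXn2r ?nnegrE ?invr_ge0// ltW.
apply: le_trans (ler_pM _ _ step (IH _ _ ki)) _; rewrite ?mulr_ge0//.
by rewrite le_eqVlt; apply/orP; left; apply/eqP; ring.
Qed.
End Inverse.

Section InverseGerm.
Variable R : realType.
Local Notation C := (complex_field R).

Lemma cf1 k l : cf (1 : {poly {poly C}}) k l = delta R k l.
Proof.
by rewrite -[1]/(1 : bip C) -(mon00 C) cf_mon /delta.
Qed.

Lemma expandsV (u : C * C -> C) a : expands u a -> a 0%N 0%N != 0 ->
  expands (fun z => (u z)^-1) (inv_coef a).
Proof.
move=> ua a0; have ga : geo a by case/expandsP: ua.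
have [g gb] := geo_expands (geo_inv a0 ga).
apply: (expands_near gb).
have H1 : expands (poly_germ (1 : {poly {poly C}})) (conv a (inv_coef a)).
  suff -> : conv a (inv_coef a) = cf (1 : {poly {poly C}}) by exact: expands_poly.
  by apply/funext => k; apply/funext => l; rewrite conv_inv// cf1.
have := expands_fun_unique (expandsM ua gb) H1; apply: filterS => z.
rewrite /poly_germ !hornerC => E.
have u0 : u z != 0 by apply: contra_eq_neq E => ->; rewrite mul0r eq_sym oner_neq0.
by apply: (mulfI u0); rewrite E mulfV.
Qed.
End InverseGerm.

(** * Differentiation of expansions *)

Section Derivative.
Variable R : realType.
Local Notation C := (complex_field R).
Implicit Types (f g h u : C * C -> C) (a b : nat -> nat -> C) (z : C * C).

Definition dcoef a (i j : nat) : C := a i.+1 j *+ i.+1.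

Lemma geo_dcoef a M r : geo_with a M r -> geo_with (dcoef a) (M / r) (r / 2).
Proof.
move=> [M0 r0 H]; split=> [||i j]; [by rewrite divr_ge0// ltW|exact: half_pos|].
rewrite /dcoef normrMn ler_pdivlMr// expr_div_n.
have := H i.+1 j; rewrite addSn exprS => H1.
rewrite mulrnAl mulrnAl -mulr_natr.
have -> : `|a i.+1 j| * (r ^+ (i + j) / 2 ^+ (i + j)) * r * i.+1%:R =
  (`|a i.+1 j| * (r * r ^+ (i + j))) * (i.+1%:R / 2 ^+ (i + j)) by ring.
rewrite -[X in _ <= X]mulr1; apply: ler_pM; [|by rewrite divr_ge0// exprn_ge0|exact: H1|].
  by rewrite mulr_ge0// mulr_ge0 ?exprn_ge0// ltW.
rewrite ler_pdivrMr ?exprn_gt0// mul1r -natrX ler_nat.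
by apply: leq_trans (ltn_expl i (leqnn 2)) _; rewrite leq_exp2l// leq_addr.
Qed.

(** The Taylor remainder of order two of [x^i] with increment [h]. *)
Definition dquot (x h : C) i := (x + h) ^+ i - x ^+ i - h * (x ^+ i.-1 *+ i).

(** Induction: the remainder for [i + 1] is [x + h] times that for [i], plus [h^2 i x^(i-1)].
    Multiplying by [c ^+ 2] avoids the exponent [i - 2], truncated for small [i]. *)
Lemma dquot_bound (x h c : C) i : 0 < c -> `|x| <= c -> `|x| + `|h| <= c ->
  `|dquot x h i| * c ^+ 2 <= `|h| ^+ 2 * (i ^ 2)%:R * c ^+ i.
Proof.
move=> c0 xc xhc; elim: i => [|i IH].
  by rewrite /dquot !expr0 mulr0n mulr0 subrr subr0 normr0 mul0r mulr_ge0 ?mulr_ge0 ?exprn_ge0.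
have E : dquot x h i.+1 = (x + h) * dquot x h i + h ^+ 2 * (x ^+ i.-1 *+ i).
  rewrite /dquot /=; case: i {IH} => [|i] /=.
    by rewrite !expr0 !mulr0n mulr1n; ring.
  rewrite -[_ *+ i.+2]mulr_natr -[_ *+ i.+1]mulr_natr -[in i.+2%:R]addn1 natrD !exprS; ring.
rewrite E; apply: (@le_trans _ _ (c * (`|dquot x h i| * c ^+ 2) + `|h| ^+ 2 * (c ^+ i.-1 * i%:R) * c ^+ 2)).
  rewrite [X in _ <= X](_ : _ = (c * `|dquot x h i| + `|h| ^+ 2 * (c ^+ i.-1 * i%:R)) * c ^+ 2); last by ring.
  rewrite ler_wpM2r ?exprn_ge0 ?(ltW c0)//.
  apply: le_trans (ler_normD _ _) _; apply: lerD.
    by rewrite normrM ler_wpM2r// (le_trans (ler_normD _ _)).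
  rewrite normrM normrX ler_wpM2l ?exprn_ge0// normrMn normrX -[_ *+ i]mulr_natr ler_wpM2r//.
  by rewrite lerXn2r// nnegrE ltW.
have ci : c ^+ i.-1 * i%:R * c = c ^+ i * i%:R by case: (i) => [|i']; rewrite ?mulr0 ?mul0r//= exprS; ring.
have -> : `|h| ^+ 2 * (c ^+ i.-1 * i%:R) * c ^+ 2 = `|h| ^+ 2 * (c ^+ i * i%:R) * c by rewrite -ci; ring.
apply: (@le_trans _ _ (c * (`|h| ^+ 2 * (i ^ 2)%:R * c ^+ i) + `|h| ^+ 2 * (c ^+ i * i%:R) * c)).
  by rewrite lerD2r ler_wpM2l// ltW.
rewrite [X in X <= _](_ : _ = `|h| ^+ 2 * c ^+ i.+1 * (i ^ 2 + i)%:R); last by rewrite [c ^+ i.+1]exprS natrD; ring.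
rewrite [X in _ <= X](_ : _ = `|h| ^+ 2 * c ^+ i.+1 * (i.+1 ^ 2)%:R); last by ring.
rewrite ler_wpM2l ?mulr_ge0 ?exprn_ge0 ?(ltW c0)// ler_nat.
by clear; lia.
Qed.

Lemma square_sum_dcoef a z n : power_sum (dcoef a) z n = square_sum (fun i j => a i j * (z.1 ^+ i.-1 *+ i) * z.2 ^+ j) n
  + \sum_(j < n) term (dcoef a) z n.-1 j.
Proof.
case: n => [|n]; first by rewrite power_sumE /square_sum !big_ord0 addr0.
rewrite power_sumE /square_sum [LHS]big_ord_recr/=; congr (_ + _).
rewrite [RHS]big_ord_recl [X in _ = X + _]big1 => [|j _]; last by rewrite mulr0n mulr0 mul0r.
rewrite add0r; apply: eq_bigr => i _; apply: eq_bigr => j _.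
by rewrite /term /dcoef/= /bump leq0n add1n mulrnAl mulrnAl mulrnAr mulrnAl.
Qed.

(** Differentiation shifts an index; by [square_sum_dcoef] the two partial sums differ by one
    boundary row, which tends to 0. *)
Lemma dcoef_cvg a M r z : geo_with a M r -> `|z.1| <= r / 2 / 2 -> `|z.2| <= r / 2 / 2 ->
  forall g : C, power_sum (dcoef a) z @ \oo --> g ->
  square_sum (fun i j => a i j * (z.1 ^+ i.-1 *+ i) * z.2 ^+ j) @ \oo --> g.
Proof.
move=> ga z1 z2 g Hg.
have gd := geo_dcoef ga; have [Md _ _] := gd.
have dom := term_dominated1 gd z1 z2.
have Z : (fun n => \sum_(j < n) term (dcoef a) z n.-1 j) @ \oo --> (0 : C).
  apply/cvgrPdist_le => e e0.
  have h0 : (fun n => (M / r * 4) * 2^-1 ^+ n : C) @ \oo --> (M / r * 4) * (0 : C).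
    exact: (cvgM (cvg_cst (M / r * 4)) (@half_cvg R)).
  rewrite mulr0 in h0; move/cvgrPdist_le: h0 => /(_ _ e0); apply: filterS => n.
  rewrite !sub0r !normrN; apply: le_trans.
  rewrite [X in _ <= X]ger0_norm; last by rewrite mulr_ge0 ?exprn_ge0 ?invr_ge0// mulr_ge0.
  apply: le_trans (ler_norm_sum _ _ _) _.
  apply: (@le_trans _ _ (\sum_(j < n) (M / r * 2^-1 ^+ n.-1) * 2^-1 ^+ j)).
    by apply: ler_sum => j _; rewrite -mulrA -exprD; exact: dom.
  rewrite -mulr_sumr.
  have P0 m : 0 <= M / r * 2^-1 ^+ m by rewrite mulr_ge0// exprn_ge0// invr_ge0.
  apply: le_trans (ler_wpM2l (P0 _) (geo_sum R n)) _.
  case: n => [|n] /=.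
    by rewrite !expr0 !mulr1 ler_wpM2l// ler_nat.
  rewrite exprS [X in _ <= X](_ : _ = M / r * 2^-1 ^+ n * (4 / 2)); last by ring.
  by rewrite ler_wpM2l// ler_pdivlMr// -natrM ler_nat.
have -> : square_sum (fun i j => a i j * (z.1 ^+ i.-1 *+ i) * z.2 ^+ j) =
  (fun n => power_sum (dcoef a) z n - \sum_(j < n) term (dcoef a) z n.-1 j).
  by apply/funext => n; rewrite square_sum_dcoef addrK.
by rewrite -[g]subr0; exact: (cvgB Hg Z).
Qed.

Lemma pair_shift (z : C * C) (h : C) : h *: ((1 : C), (0 : C)) + z = (z.1 + h, z.2).
Proof. by case: z => x y; rewrite /= -[_ *: _]/(h * 1, h * 0) mulr1 mulr0 -[LHS]/(h + x, 0 + y) add0r addrC. Qed.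

Lemma expands_dx f a : expands f a -> expands (partial_x f) (dcoef a).
Proof.
move=> fa; have [ga Hf] := (expandsP f a).1 fa.
have [M [r gM]] := ga; have [M0 r0 _] := gM.
have gd := geo_dcoef gM.
have [d [d0 Hd]] := (near0P _).1 Hf.
have [g Hg] := geo_expands (ex_intro _ _ (ex_intro _ _ gd)).
apply: (expands_near Hg).
(* At radius [r / 8] the factor [8^-(i+j)] absorbs the growth [i^2 <= 4^(i+j)] of the remainder and
   leaves the majorant [2^-(i+j)]. *)
pose c := r * 2^-1 ^+ 3.
have c0 : 0 < c by rewrite mulr_gt0// exprn_gt0// invr_gt0.
have [e [e0 ed ec]] := common_radius (half_pos (half_pos d0)) (half_pos c0).
have d2 : d / 2 < d by rewrite ltr_pdivrMr// mulr_natr mulr2n ltrDl.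
have dd : d / 2 / 2 + d / 2 / 2 = d / 2 by rewrite -splitr.
have d4 : d / 2 / 2 < d by rewrite (lt_trans _ d2)// ltr_pdivrMr ?half_pos// mulr_natr mulr2n ltrDl half_pos.
have cc : c / 2 + c / 2 = c by rewrite -splitr.
have cr : c <= r / 2 / 2.
  by rewrite /c -!mulrA ler_wpM2l ?(ltW r0)// -expr2 ler_wiXn2l ?invr_ge0// invf_le1// ler1n.
have c2c : c / 2 <= c by rewrite ler_pdivrMr// ler_peMr ?(ltW c0)// ler1n.
have := near_small e0; have [_ Hg'] := (expandsP g _).1 Hg.
move: Hg'; apply: filterS2 => z Hgz [z1 z2].
pose K := M / c ^+ 2 * 4 + 1.
have K0 : 0 < K.
  by rewrite ltr_wpDl ?ltr01// mulr_ge0// divr_ge0// exprn_ge0// ltW.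
have main (h : C) : `|h| <= e -> `|f (z.1 + h, z.2) - f z - h * g z| <= `|h| ^+ 2 * (M / c ^+ 2 * 4).
  move=> he.
  have xd : `|z.1 + h| < d.
    apply: le_lt_trans d2; rewrite -dd; apply: le_trans (ler_normD _ _) _.
    by rewrite lerD// (le_trans _ ed).
  have yd : `|z.2| < d by apply: le_lt_trans d4; exact: le_trans ed.
  have zd : `|z.1| < d by apply: le_lt_trans d4; exact: le_trans ed.
  have F1 := Hd (z.1 + h, z.2) xd yd.
  have F0 := Hd z zd yd.
  have G := dcoef_cvg gM (le_trans z1 (le_trans ec (le_trans c2c cr))) (le_trans z2 (le_trans ec (le_trans c2c cr))) Hgz.
  pose t i j : C := a i j * dquot z.1 h i * z.2 ^+ j.
  have tdom : dominated t (`|h| ^+ 2 * (M / c ^+ 2)).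
    move=> i j; rewrite /t !normrM normrX.
    have xh : `|z.1| + `|h| <= c by rewrite -cc lerD// (le_trans _ ec).
    have xc : `|z.1| <= c by rewrite (le_trans _ c2c)// (le_trans _ ec).
    have yc : `|z.2| <= c by rewrite (le_trans _ c2c)// (le_trans _ ec).
    have := dquot_bound i c0 xc xh; rewrite -ler_pdivlMr ?exprn_gt0// => Db.
    have aM : `|a i j| <= M / r ^+ (i + j) by rewrite ler_pdivlMr ?exprn_gt0//; case: gM.
    apply: le_trans (ler_pM _ _ (ler_pM _ _ aM Db) (lerXn2r j _ _ yc)) _; rewrite ?mulr_ge0 ?exprn_ge0 ?nnegrE ?(ltW c0)//.
    have -> : M / r ^+ (i + j) * (`|h| ^+ 2 * (i ^ 2)%:R * c ^+ i / c ^+ 2) * c ^+ j =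
       `|h| ^+ 2 * (M / c ^+ 2) * ((c ^+ (i + j) / r ^+ (i + j)) * (i ^ 2)%:R) by rewrite [c ^+ (i + j)]exprD; ring.
    have -> : c ^+ (i + j) / r ^+ (i + j) = 2^-1 ^+ (i + j) / (2 ^ (2 * (i + j)))%:R.
      rewrite /c exprMn mulrAC mulfV ?expf_neq0 ?gt_eqF// mul1r -exprM natrX.
      by rewrite mulSn exprD [_ ^+ (2 * _)]exprVn.
    apply: (ler_wpM2l (mulr_ge0 (exprn_ge0 2 (normr_ge0 h)) (divr_ge0 M0 (exprn_ge0 2 (ltW c0))))).
    rewrite -mulrA -[X in _ <= X]mulr1 ler_wpM2l ?exprn_ge0 ?invr_ge0//.
    rewrite mulrC ler_pdivrMr ?ltr0n ?expn_gt0// mul1r ler_nat mulnC expnM leq_exp2r//.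
    by apply: leq_trans (ltnW (ltn_expl i (leqnn 2))) _; rewrite leq_exp2l// leq_addr.
  have [_ [L HL LM]] := dominated_cvg (mulr_ge0 (exprn_ge0 2 (normr_ge0 h)) (divr_ge0 M0 (exprn_ge0 2 (ltW c0)))) tdom.
  suff -> : f (z.1 + h, z.2) - f z - h * g z = L by rewrite -mulrA in LM.
  have H2 : (fun n => power_sum a (z.1 + h, z.2) n - power_sum a z n - h * square_sum (fun i j => a i j * (z.1 ^+ i.-1 *+ i) * z.2 ^+ j) n)
      @ \oo --> f (z.1 + h, z.2) - f z - h * g z.
    exact: (cvgB (cvgB F1 F0) (cvgM (cvg_cst h) G)).
  apply: limC_unique H2 _.
  suff -> : (fun n => power_sum a (z.1 + h, z.2) n - power_sum a z n - h * square_sum (fun i j => a i j * (z.1 ^+ i.-1 *+ i) * z.2 ^+ j) n) = square_sum t by [].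
  apply/funext => n; rewrite !power_sumE -square_sumM -[X in _ - X - _]mul1r -mulNr -square_sumM -[X in _ - X]mul1r -mulNr -square_sumM -!square_sumD.
  by apply: square_sum_ext => i j; rewrite /term /t /dquot /=; ring.
rewrite /partial_x /derive; symmetry; apply: cvg_lim; first exact: norm_hausdorff.
apply/cvgrPdist_le => eps eps0; apply/near_punctured0P.
have [d' [d'0 d'e d'eps]] := common_radius e0 (divr_gt0 eps0 K0).
exists d'; split=> // h h0 hd.
have he : `|h| <= e by rewrite (le_trans (ltW hd)).
rewrite /= pair_shift -[h^-1 *: _]/(h^-1 * _).
have -> : g z - h^-1 * (f (z.1 + h, z.2) - f z) = - (h^-1 * (f (z.1 + h, z.2) - f z - h * g z)).
  by rewrite [in RHS]mulrBr mulKf//; ring.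
rewrite normrN normrM normfV; apply: le_trans (ler_wpM2l _ (main h he)) _; first by rewrite invr_ge0.
have nh : 0 < `|h| by rewrite normr_gt0.
rewrite /K in K0 d'eps *; move: (M / c ^+ 2 * 4) K0 d'eps => B K0 d'eps.
rewrite expr2 -mulrA mulKf ?gt_eqF//.
apply: (@le_trans _ _ (`|h| * (B + 1))); first by rewrite ler_wpM2l// lerDl.
by rewrite -ler_pdivlMr// (le_trans (ltW hd)).
Qed.
End Derivative.

Section Uniqueness.
Variable R : realType.
Local Notation C := (complex_field R).
Implicit Types (f g h u : C * C -> C) (a b : nat -> nat -> C) (z : C * C).

Definition swapz z := (z.2, z.1).

Lemma near_swapz (P : C * C -> Prop) : (\forall z \near (0 : C * C), P z) ->
  \forall z \near (0 : C * C), P (swapz z).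
Proof.
by move=> /near0P[d [d0 H]]; apply/near0P; exists d; split=> // z z1 z2; exact: H.
Qed.

Lemma expands_swapz f a : expands f a -> expands (f \o swapz) (fun i j => a j i).
Proof.
have E (t : nat -> nat -> C) : square_sum (fun i j => t j i) = square_sum t.
  by apply/funext => n; rewrite /square_sum exchange_big.
move=> /near_swapz; apply: filterS => z.
rewrite /abs_power_sum !power_sumE -[fun n : nat => \sum_(i < n) _]/(square_sum (fun i j => `|term a (swapz z) i j|)) -(E (fun i j => `|term a _ i j|)).
rewrite -[fun n : nat => \sum_(i < n) _]/(square_sum (fun i j => `|term (fun i j => a j i) z i j|)) -(E (term a _)).
have -> : (fun i j => term a (swapz z) j i) = term (fun i j => a j i) z.
  by apply/funext => i; apply/funext => j; rewrite /term /=; ring.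
have -> : (fun i j => `|term a (swapz z) j i|) = (fun i j => `|term (fun i j => a j i) z i j|).
  by apply/funext => i; apply/funext => j; rewrite /term /=; congr `|_|; ring.
by [].
Qed.

Lemma partial_y_swap f z : partial_y f z = partial_x (f \o swapz) (swapz z).
Proof.
rewrite /partial_y /partial_x /derive.
set u := (fun h : C => _); set v := (fun h : C => _).
have -> : u = v by apply/funext => h; rewrite /u /v; case: z {u v}.
reflexivity.
Qed.

Definition dcoefy a (i j : nat) : C := a i j.+1 *+ j.+1.

Lemma expands_dy f a : expands f a -> expands (partial_y f) (dcoefy a).
Proof.
have -> : partial_y f = partial_x (f \o swapz) \o swapz.
  by apply/funext => z; exact: partial_y_swap.
by move=> fa; exact: (expands_swapz (expands_dx (expands_swapz fa))).
Qed.

(** The coefficient of index [(0, 0)] is the value at 0; the others are reached through derivatives,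
    multiplication by [i + 1] being injective. *)
Lemma expands_unique f a b : expands f a -> expands f b -> forall i j, a i j = b i j.
Proof.
move=> fa fb i j.
elim: i f a b fa fb => [|i IH] f a b fa fb.
  elim: j f a b fa fb => [|j IH] f a b fa fb.
    by rewrite -(expands0 fa) -(expands0 fb).
  have := IH _ _ _ (expands_dy fa) (expands_dy fb).
  rewrite /dcoefy -[a _ _ *+ _]mulr_natr -[b _ _ *+ _]mulr_natr.
  by apply: mulIf; rewrite pnatr_eq0.
have := IH _ _ _ (expands_dx fa) (expands_dx fb).
rewrite /dcoef -[a _ _ *+ _]mulr_natr -[b _ _ *+ _]mulr_natr.
by apply: mulIf; rewrite pnatr_eq0.
Qed.

Lemma partial_x_poly (F : bip C) : \forall z \near (0 : C * C),
  partial_x (poly_germ F) z = poly_germ (dx F) z.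
Proof.
apply: expands_fun_unique (expands_dx (expands_poly F)) _.
have -> : dcoef (cf F) = cf (dx F); last exact: expands_poly.
by apply/funext => i; apply/funext => j; rewrite cf_dx.
Qed.

Lemma partial_y_poly (F : bip C) : \forall z \near (0 : C * C),
  partial_y (poly_germ F) z = poly_germ (dy F) z.
Proof.
apply: expands_fun_unique (expands_dy (expands_poly F)) _.
have -> : dcoefy (cf F) = cf (dy F); last exact: expands_poly.
by apply/funext => i; apply/funext => j; rewrite cf_dy.
Qed.
End Uniqueness.

(** * Germs and Milnor numbers *)

Section GermIdeals.
Variable R : realType.
Local Notation C := (complex_field R).
Implicit Types (f g h u v : C * C -> C) (a b : nat -> nat -> C) (z : C * C).

Definition germ_ord N f := exists2 a, expands f a & forall i j, (i + j < N)%N -> a i j = 0.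

Lemma hol_poly (H : bip C) : holomorphic_germ (poly_germ H).
Proof. exact: expands_hol (expands_poly H). Qed.

Lemma hol_cst (c : C) : holomorphic_germ (fun=> c).
Proof.
suff -> : (fun=> c) = poly_germ (c *: @mon C 0 0 : bip C) by exact: hol_poly.
by apply/funext => z; rewrite poly_germZ poly_germ_mon !expr0 !mulr1.
Qed.

Lemma holD f g : holomorphic_germ f -> holomorphic_germ g -> holomorphic_germ (fun z => f z + g z).
Proof. by move=> [a fa] [b gb]; apply: expands_hol; exact: expandsD fa gb. Qed.

Lemma holM f g : holomorphic_germ f -> holomorphic_germ g -> holomorphic_germ (fun z => f z * g z).
Proof. by move=> [a fa] [b gb]; apply: expands_hol; exact: expandsM fa gb. Qed.

Lemma hol_ext f g : holomorphic_germ f -> f =1 g -> holomorphic_germ g.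
Proof. by move=> H /funext <-. Qed.

Lemma holN f : holomorphic_germ f -> holomorphic_germ (fun z => - f z).
Proof.
by move=> H; apply: (hol_ext (holM (hol_cst (-1)) H)) => z; rewrite mulN1r.
Qed.

Lemma holB f g : holomorphic_germ f -> holomorphic_germ g -> holomorphic_germ (fun z => f z - g z).
Proof. by move=> fa ga; exact: (holD fa (holN ga)). Qed.

Lemma hol_sum (I : Type) (r : seq I) (P : pred I) (F : I -> C * C -> C) :
  (forall i, holomorphic_germ (F i)) -> holomorphic_germ (fun z => \sum_(i <- r | P i) F i z).
Proof.
move=> H; elim: r => [|i r IH].
  by apply: (hol_ext (hol_cst 0)) => z; rewrite big_nil.
case E : (P i).
  by apply: (hol_ext (holD (H i) IH)) => z; rewrite big_cons E.
by apply: (hol_ext IH) => z; rewrite big_cons E.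
Qed.

Lemma hol_prod (I : Type) (r : seq I) (P : pred I) (F : I -> C * C -> C) :
  (forall i, holomorphic_germ (F i)) -> holomorphic_germ (fun z => \prod_(i <- r | P i) F i z).
Proof.
move=> H; elim: r => [|i r IH].
  by apply: (hol_ext (hol_cst 1)) => z; rewrite big_nil.
case E : (P i).
  by apply: (hol_ext (holM (H i) IH)) => z; rewrite big_cons E.
by apply: (hol_ext IH) => z; rewrite big_cons E.
Qed.

Lemma hol_det n (A : 'I_n -> 'I_n -> C * C -> C) : (forall i j, holomorphic_germ (A i j)) ->
  holomorphic_germ (fun z => \det (\matrix_(i, j) A i j z)).
Proof.
move=> H; rewrite /determinant; apply: hol_sum => s; apply: holM; first exact: hol_cst.
by apply: hol_prod => i; apply: hol_ext; [exact: (H i (perm.fun_of_perm s i))|move=> z; rewrite mxE].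
Qed.

Lemma hol_adj n (A : 'I_n -> 'I_n -> C * C -> C) : (forall i j, holomorphic_germ (A i j)) ->
  forall i j, holomorphic_germ (fun z => (\adj (\matrix_(i, j) A i j z)) i j).
Proof.
move=> H i j.
have D : holomorphic_germ (fun z => (-1) ^+ (j + i) * \det (\matrix_(k < n.-1, l < n.-1) A (lift j k) (lift i l) z)).
  by apply: (holM (hol_cst _) (hol_det _)) => k l; exact: H.
apply: (hol_ext D) => z; rewrite mxE /cofactor; congr (_ * \det _).
by apply/matrixP => k l; rewrite !mxE.
Qed.

Lemma hol_inv u : holomorphic_germ u -> u 0 != 0 ->
  exists2 v, holomorphic_germ v & \forall z \near (0 : C * C), v z * u z = 1.
Proof.
move=> [a ua] u0; rewrite (expands0 ua) in u0.
exists (fun z => (u z)^-1); first exact: expands_hol (expandsV ua u0).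
have E := expandsM ua (expandsV ua u0).
have E1 : expands (poly_germ (@mon C 0 0)) (conv a (inv_coef a)).
  have -> : conv a (inv_coef a) = cf (1 : {poly {poly C}}).
    by apply/funext => i; apply/funext => j; rewrite conv_inv// cf1.
  by rewrite mon00; exact: expands_poly.
have := expands_fun_unique E E1; apply: filterS => z.
by rewrite poly_germ_mon !expr0 mulr1 mulrC.
Qed.

Lemma germ_ordD N f g : germ_ord N f -> germ_ord N g -> germ_ord N (fun z => f z + g z).
Proof.
move=> [a fa Ha] [b gb Hb]; exists (fun i j => a i j + b i j); first exact: (expandsD fa gb).
by move=> i j ij; rewrite Ha// Hb// addr0.
Qed.

Lemma germ_ordM N f g : holomorphic_germ f -> germ_ord N g -> germ_ord N (fun z => f z * g z).
Proof.
move=> [a fa] [b gb Hb]; exists (conv a b); first exact: (expandsM fa gb).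
move=> k l kl; rewrite /conv big1// => i _; rewrite big1// => j _.
by rewrite Hb ?mulr0//; move: kl; clear; lia.
Qed.

Lemma germ_ord_near N f g : germ_ord N f -> (\forall z \near (0 : C * C), f z = g z) -> germ_ord N g.
Proof. move=> [a fa H] E; by exists a; [exact: expands_near fa E|exact: H]. Qed.

Lemma germ_ord_leq N N' f : (N' <= N)%N -> germ_ord N f -> germ_ord N' f.
Proof. by move=> NN [a fa H]; exists a; [exact: fa|move=> i j ij; apply: H; exact: leq_trans NN]. Qed.

Lemma germ_ord_poly N (H : bip C) : germ_ord N (poly_germ H) <-> ordw 1 1 N H.
Proof.
split=> [[a Ha a0] i j|H0].
  by rewrite /wt !muln1 => /a0 <-; apply: expands_unique (expands_poly H) Ha i j.
by exists (cf H); [exact: expands_poly|move=> i j ij; apply: H0; rewrite /wt !muln1].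
Qed.

Lemma germ_ord_trunc N f a (T : bip C) : expands f a ->
  (forall i j, (i + j < N)%N -> cf T i j = a i j) -> germ_ord N (fun z => f z - poly_germ T z).
Proof.
move=> fa HT; exists (fun i j => a i j + -1 * cf T i j).
  rewrite (_ : (fun z => _) = (fun z => f z + -1 * poly_germ T z)).
    exact: (expandsD fa (expandsZ (-1) (expands_poly T))).
  by apply/funext => z; rewrite mulN1r.
by move=> i j ij; rewrite HT// mulN1r subrr.
Qed.
End GermIdeals.

(** * Hadamard's and Nakayama's lemmas *)

Section Nakayama.
Variable R : realType.
Local Notation C := (complex_field R).
Implicit Types (f g h u v : C * C -> C) (a b : nat -> nat -> C) (z : C * C).

(** Each monomial of degree at least [N] is assigned to a single [x^k y^(N-k)], with [k] the minimum
    of [N] and its exponent of [x]; so the cofactor contains [x] only if [k = N]. *)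
Definition hadamard_coef N a k (i j : nat) : C :=
  if (i == 0%N) || (k == N) then a (i + k)%N (j + (N - k))%N else 0.

Lemma geo_hadamard N a k : (k <= N)%N -> geo a -> geo (hadamard_coef N a k).
Proof.
move=> kN [M [r [M0 r0 H]]]; exists (M / r ^+ N), r; split=> [||i j].
- by rewrite divr_ge0// exprn_ge0// ltW.
- exact: r0.
rewrite /hadamard_coef; case: ifP => _; last by rewrite normr0 mul0r divr_ge0// exprn_ge0// ltW.
rewrite ler_pdivlMr ?exprn_gt0// -mulrA -exprD.
have -> : (i + j + N = i + k + (j + (N - k)))%N by move: kN; clear; lia.
exact: H.
Qed.

Lemma conv_mon p q b k l : conv (cf (mon p q)) b k l =
  if (p <= k)%N && (q <= l)%N then b (k - p)%N (l - q)%N else 0.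
Proof.
rewrite /conv; case: ifP => [/andP[pk ql]|npq].
  rewrite (bigD1 (Ordinal (pk : (p < k.+1)%N)))//= (bigD1 (Ordinal (ql : (q < l.+1)%N)))//=.
  rewrite cf_mon !eqxx mul1r big1 => [|j jq]; last first.
    by rewrite cf_mon -val_eqE /= in jq *; rewrite (negbTE jq) andbF mul0r.
  rewrite addr0 big1 ?addr0// => i ip; rewrite big1// => j _.
  by rewrite cf_mon -val_eqE /= in ip *; rewrite (negbTE ip) mul0r.
rewrite big1// => i _; rewrite big1// => j _; rewrite cf_mon.
have [/eqP ip|_] := boolP (i == p :> nat); last by rewrite mul0r.
have [/eqP jq|_] := boolP (j == q :> nat); last by rewrite andbF mul0r.
have := ltn_ord i; have := ltn_ord j; rewrite ip jq !ltnS => ql pk.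
by rewrite pk ql in npq.
Qed.

Lemma expands_sum (n : nat) (F : 'I_n -> C * C -> C) (b : 'I_n -> nat -> nat -> C) :
  (forall k, expands (F k) (b k)) ->
  expands (fun z => \sum_k F k z) (fun i j => \sum_k b k i j).
Proof.
elim: n F b => [|n IH] F b H.
  have := expands_poly (0 : bip C).
  have -> : poly_germ (0 : bip C) = fun z => \sum_(k < 0) F k z.
    by apply/funext => z; rewrite big_ord0 /poly_germ !horner0.
  suff -> : cf (0 : bip C) = fun i j => \sum_(k < 0) b k i j by exact: id.
  by apply/funext => i; apply/funext => j; rewrite big_ord0 cf0.
have -> : (fun z => \sum_k F k z) = fun z => F ord0 z + \sum_k F (lift ord0 k) z.
  by apply/funext => z; rewrite big_ord_recl.
have -> : (fun i j => \sum_k b k i j) = fun i j => b ord0 i j + \sum_k b (lift ord0 k) i j.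
  by apply/funext => i; apply/funext => j; rewrite big_ord_recl.
by apply: (expandsD (H ord0) (IH _ _ _)) => k; exact: H.
Qed.

Lemma hadamard_sum N a i j : (forall i j, (i + j < N)%N -> a i j = 0) ->
  \sum_(k < N.+1) conv (cf (@mon C k (N - k))) (hadamard_coef N a k) i j = a i j.
Proof.
move=> a0; under eq_bigr do rewrite conv_mon.
have [ijN|Nij] := ltnP (i + j) N.
  rewrite a0// big1// => k _; case: ifP => // H.
  by exfalso; move: H ijN; clear; case: k => k /=; lia.
have mN : (minn i N < N.+1)%N by rewrite ltnS geq_minr.
rewrite (bigD1 (Ordinal mN))//= big1 => [|k].
  have -> : (minn i N <= i)%N && (N - minn i N <= j)%N by move: Nij; clear; lia.
  rewrite addr0 /hadamard_coef ifT; last by move: Nij; clear; lia.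
  by congr (a _ _); move: Nij; clear; lia.
rewrite -val_eqE /= => km; case: ifP => // H; rewrite /hadamard_coef ifF//.
by apply/negbTE; move: km H; clear; case: k => k /=; lia.
Qed.

Lemma hadamard N f a : expands f a -> (forall i j, (i + j < N)%N -> a i j = 0) ->
  exists c : 'I_N.+1 -> C * C -> C, [/\ forall k, holomorphic_germ (c k),
    \forall z \near (0 : C * C), f z = \sum_(k < N.+1) poly_germ (@mon C k (N - k)) z * c k z &
    forall k, c k 0 = a k (N - k)%N].
Proof.
move=> fa a0; have [ga _] := (expandsP f a).1 fa.
have H (k : 'I_N.+1) : exists c, expands c (hadamard_coef N a k).
  by apply: geo_expands; apply: geo_hadamard ga; rewrite -ltnS.
have [c Hc] := choice H; exists c; split=> [k||k]; first exact: expands_hol (Hc k).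
  apply: expands_fun_unique fa _.
  have -> : a = fun i j => \sum_(k < N.+1) conv (cf (@mon C k (N - k))) (hadamard_coef N a k) i j.
    by apply/funext => i; apply/funext => j; rewrite hadamard_sum.
  by apply: expands_sum => k; exact: (expandsM (expands_poly _) (Hc k)).
by rewrite (expands0 (Hc k)) /hadamard_coef eqxx.
Qed.

Lemma near_all (P : C * C -> Prop) : (forall z, P z) -> \forall z \near (0 : C * C), P z.
Proof. by move=> H; apply/near0P; exists 1; split=> // z _ _; exact: H. Qed.

Lemma jacobian_ideal_near f g h : jacobian_ideal f g -> (\forall z \near (0 : C * C), g z = h z) ->
  jacobian_ideal f h.
Proof.
move=> [u [v [hu hv E]]] gh; exists u, v; split; [exact: hu|exact: hv|].
by move: gh E; apply: filterS2 => z ->.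
Qed.

Lemma jacobian_idealD f g h : jacobian_ideal f g -> jacobian_ideal f h ->
  jacobian_ideal f (fun z => g z + h z).
Proof.
move=> [u [v [hu hv E]]] [u' [v' [hu' hv' E']]].
exists (fun z => u z + u' z), (fun z => v z + v' z); split; [exact: holD|exact: holD|].
by move: E E'; apply: filterS2 => z -> ->; ring.
Qed.

Lemma jacobian_idealM f g h : holomorphic_germ g -> jacobian_ideal f h ->
  jacobian_ideal f (fun z => g z * h z).
Proof.
move=> hg [u [v [hu hv E]]].
exists (fun z => g z * u z), (fun z => g z * v z); split; [exact: holM|exact: holM|].
by move: E; apply: filterS => z ->; ring.
Qed.

Lemma jacobian_ideal_sum f n (F : 'I_n -> C * C -> C) : (forall k, jacobian_ideal f (F k)) ->
  jacobian_ideal f (fun z => \sum_k F k z).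
Proof.
elim: n F => [|n IH] F H.
  exists (fun=> 0), (fun=> 0); split; [exact: hol_cst|exact: hol_cst|].
  apply: near_all => z; cbv beta; rewrite big_ord0.
  by move: (partial_x f z) (partial_y f z) => X Y; rewrite !mul0r addr0.
have -> : (fun z => \sum_k F k z) = fun z => F ord0 z + \sum_k F (lift ord0 k) z.
  by apply/funext => z; rewrite big_ord_recl.
by apply: jacobian_idealD; [exact: H|apply: IH => k; exact: H].
Qed.

Definition local_jacobian f N h := exists u v e, [/\ holomorphic_germ u, holomorphic_germ v,
  germ_ord N e & \forall z \near (0 : C * C), h z = u z * partial_x f z + v z * partial_y f z + e z].

(* With [m_k] the monomials of degree [N], the hypothesis and Hadamard's lemma read
   [(1 - c) m = A f_x + B f_y] for a matrix [c] of germs vanishing at 0; multiply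
   by the adjugate of [1 - c]. *)
Lemma nakayama f N : (forall k : 'I_N.+1, local_jacobian f N.+1 (poly_germ (@mon C k (N - k)))) ->
  forall h, germ_ord N h -> jacobian_ideal f h.
Proof.
move=> H.
have /choice[uvc Huvc] (k : 'I_N.+1) : exists t : (C * C -> C) * (C * C -> C) * ('I_N.+1 -> C * C -> C),
    [/\ holomorphic_germ t.1.1, holomorphic_germ t.1.2, forall l, holomorphic_germ (t.2 l),
      forall l, t.2 l 0 = 0 &
     \forall z \near (0 : C * C), poly_germ (@mon C k (N - k)) z = t.1.1 z * partial_x f z + t.1.2 z * partial_y f z +
         \sum_(l < N.+1) poly_germ (@mon C l (N - l)) z * t.2 l z].
  have [u [v [e [hu hv [a ea a0] E]]]] := H k.
  have [|c [hc ec c0]] := hadamard (N := N) ea.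
    by move=> i j ij; apply: a0; rewrite ltnS ltnW.
  exists (u, v, c); split; [exact: hu|exact: hv|exact: hc| |].
    by move=> l; change (c l 0 = 0); rewrite c0 a0// ltnS subnKC// -ltnS.
  by move: E ec; apply: filterS2 => z -> ->.
pose A (k l : 'I_N.+1) (z : C * C) : C := (k == l)%:R - (uvc k).2 l z.
have hA k l : holomorphic_germ (A k l).
  by have [_ _ hc _ _] := Huvc k; exact: (holB (hol_cst _) (hc l)).
pose d (z : C * C) : C := \det (\matrix_(k, l) A k l z).
have d0 : d 0 = 1.
  rewrite /d -[RHS](det1 _ N.+1); congr (\det _); apply/matrixP => k l; rewrite !mxE /A.
  by have [_ _ _ -> _] := Huvc k; rewrite subr0.
have [|w hw Hw] := hol_inv (hol_det hA); first by rewrite -/(d 0) d0 oner_neq0.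
have all_near := filter_forall (nbhs_filter (0 : C * C)) (fun k => let: And5 _ _ _ _ E := Huvc k in E).
pose M (z : C * C) : 'M[C]_N.+1 := \matrix_(k, l) A k l z.
have mon_in (l : 'I_N.+1) : jacobian_ideal f (poly_germ (@mon C l (N - l))).
  apply: (@jacobian_ideal_near _ (fun z => w z * \sum_(k < N.+1) (\adj (M z)) l k *
      ((uvc k).1.1 z * partial_x f z + (uvc k).1.2 z * partial_y f z))).
    apply: jacobian_idealM => //; apply: jacobian_ideal_sum => k; apply: jacobian_idealM.
      exact: hol_adj.
    have [hu hv _ _ _] := Huvc k; exists (uvc k).1.1, (uvc k).1.2; split; [exact: hu|exact: hv|].
    exact: near_all.
  move: Hw all_near; apply: filterS2 => z; move: (partial_x f z) (partial_y f z) => X Y Hz E.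
  have -> : \sum_(k < N.+1) (\adj (M z)) l k *
      ((uvc k).1.1 z * X + (uvc k).1.2 z * Y) =
      \sum_(k < N.+1) \sum_(j < N.+1) (\adj (M z)) l k * A k j z * poly_germ (@mon C j (N - j)) z.
    apply: eq_bigr => k _; rewrite -[((uvc k).1.1 z * X + _)](addrK (\sum_(l < N.+1) poly_germ (@mon C l (N - l)) z * (uvc k).2 l z)) -E.
    under [RHS]eq_bigr do rewrite -mulrA; rewrite -mulr_sumr; congr (_ * _).
    under [RHS]eq_bigr do rewrite /A mulrBl; rewrite big_split/= sumrN; congr (_ - _).
      rewrite (bigD1 k)//= eqxx mul1r big1 ?addr0// => j jk.
      by rewrite eq_sym (negbTE jk) mul0r.
    by apply: eq_bigr => j _; rewrite mulrC.
  rewrite exchange_big /=.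
  have -> : \sum_(j < N.+1) \sum_(k < N.+1) (\adj (M z)) l k * A k j z * poly_germ (@mon C j (N - j)) z =
    \sum_(j < N.+1) (d z *+ (l == j)) * poly_germ (@mon C j (N - j)) z.
    apply: eq_bigr => j _; rewrite -mulr_suml; congr (_ * _).
    transitivity ((\adj (M z) *m (M z)) l j).
      by rewrite !mxE; apply: eq_bigr => k _; rewrite !mxE.
    by rewrite mul_adj_mx !mxE.
  rewrite (bigD1 l)//= eqxx mulr1n big1 ?addr0 => [|j jl].
    by rewrite mulrA Hz mul1r.
  by rewrite eq_sym (negbTE jl) mulr0n mul0r.
move=> h [a ha a0]; have [c [hc ec _]] := hadamard ha a0.
apply: (@jacobian_ideal_near _ (fun z => \sum_k c k z * poly_germ (@mon C k (N - k)) z)).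
  by apply: jacobian_ideal_sum => k; exact: (jacobian_idealM (hc k) (mon_in k)).
by move: ec; apply: filterS => z ->; apply: eq_bigr => k _; rewrite mulrC.
Qed.
End Nakayama.

Section Milnor.
Variable R : realType.
Local Notation C := (complex_field R).
Implicit Types (f g h u v : C * C -> C) (a : nat -> nat -> C) (z : C * C) (F T H : bip C).

Lemma germ_ord_ext N f g : germ_ord N f -> f =1 g -> germ_ord N g.
Proof. by move=> H /funext <-. Qed.

Lemma germ_ord0 N : germ_ord N (fun _ : C * C => 0 : C).
Proof.
apply: (@germ_ord_ext _ (poly_germ (0 : bip C))); first by apply/germ_ord_poly; exact: ordw0.
by move=> z; rewrite /poly_germ !horner0.
Qed.

Lemma germ_ordZ N (c : C) f : germ_ord N f -> germ_ord N (fun z => c * f z).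
Proof. by move=> H; exact: (germ_ordM (hol_cst c) H). Qed.

Lemma germ_ord_sum N n (F : 'I_n -> C * C -> C) : (forall k, germ_ord N (F k)) ->
  germ_ord N (fun z => \sum_k F k z).
Proof.
elim: n F => [|n IH] F H.
  by apply: (germ_ord_ext (germ_ord0 N)) => z; rewrite big_ord0.
apply: (germ_ord_ext (germ_ordD (H ord0) (IH _ (fun k => H (lift ord0 k))))) => z.
by rewrite big_ord_recl.
Qed.

Lemma poly_germN H z : poly_germ (- H) z = - poly_germ H z.
Proof. by rewrite /poly_germ !hornerN. Qed.

Lemma poly_germ_sum n (c : 'I_n -> C) (b : 'I_n -> bip C) z :
  poly_germ (\sum_(i in [set: 'I_n]%SET) c i *: b i) z = \sum_i c i * poly_germ (b i) z.
Proof.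
rewrite (eq_bigl xpredT) => [|i]; last by rewrite finset.in_setT.
apply: (big_ind2 (fun (H : bip C) (x : C) => poly_germ H z = x)).
- by rewrite /poly_germ !horner0.
- by move=> H1 x H2 y <- <-; rewrite poly_germD.
- by move=> i _; rewrite poly_germZ.
Qed.

Lemma local_jacobian_add f N g h : local_jacobian f N g -> germ_ord N (fun z => h z - g z) ->
  local_jacobian f N h.
Proof.
move=> [u [v [e [hu hv he E]]]] H; exists u, v, (fun z => e z + (h z - g z)).
split; [exact: hu|exact: hv|exact: (germ_ordD he H)|].
by move: E; apply: filterS => z ->; ring.
Qed.

Lemma jacobian_ideal_local f N h : jacobian_ideal f h -> local_jacobian f N h.
Proof.
move=> [u [v [hu hv E]]]; exists u, v, (fun=> 0).
split; [exact: hu|exact: hv|exact: germ_ord0|].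
by move: E; apply: filterS => z ->; rewrite addr0.
Qed.

Lemma local_jacobian_ideal f N h : (forall g, germ_ord N g -> jacobian_ideal f g) ->
  local_jacobian f N h -> jacobian_ideal f h.
Proof.
move=> HN [u [v [e [hu hv he E]]]]; have [u' [v' [hu' hv' E']]] := HN e he.
exists (fun z => u z + u' z), (fun z => v z + v' z); split; [exact: holD|exact: holD|].
by move: E E'; apply: filterS2 => z -> ->; ring.
Qed.

(** Differentiation lowers the degree by one, so modulo order [N] the partials depend only on the
    coefficients of degree at most [N], and a polynomial can stand for [f]. *)
Lemma local_jacobian_poly f a T N H : expands f a ->
  (forall i j, (i + j <= N)%N -> cf T i j = a i j) ->
  local_jacobian f N (poly_germ H) <-> locjac T N H.
Proof.
move=> fa HT.
have fx := expands_dx fa; have fy := expands_dy fa.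
have Tx : germ_ord N (fun z => partial_x f z - poly_germ (dx T) z).
  by apply: (germ_ord_trunc fx) => i j ij; rewrite cf_dx HT.
have Ty : germ_ord N (fun z => partial_y f z - poly_germ (dy T) z).
  by apply: (germ_ord_trunc fy) => i j ij; rewrite cf_dy HT// addnS.
split=> [[u [v [e [[b ub] [b' vb'] he E]]]]|[A [B HAB]]].
  exists (trunc b N), (trunc b' N); apply/germ_ord_poly.
  have Hu : germ_ord N (fun z => u z - poly_germ (trunc b N) z).
    apply: (germ_ord_trunc ub) => i j ij; rewrite cf_trunc.
    by rewrite (leq_ltn_trans (leq_addr j i) ij) (leq_ltn_trans (leq_addl i j) ij).
  have Hv : germ_ord N (fun z => v z - poly_germ (trunc b' N) z).
    apply: (germ_ord_trunc vb') => i j ij; rewrite cf_trunc.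
    by rewrite (leq_ltn_trans (leq_addr j i) ij) (leq_ltn_trans (leq_addl i j) ij).
  have X := germ_ordD (germ_ordD he (germ_ordD (germ_ordM (expands_hol fx) Hu) (germ_ordM (expands_hol fy) Hv)))
    (germ_ordD (germ_ordM (hol_poly (trunc b N)) Tx) (germ_ordM (hol_poly (trunc b' N)) Ty)).
  apply: (germ_ord_near X); move: E; apply: filterS => z.
  rewrite poly_germD poly_germN poly_germD !poly_germM => ->.
  by move: (partial_x f z) (partial_y f z) => p q; ring.
exists (poly_germ A), (poly_germ B), (fun z => poly_germ H z - (poly_germ A z * partial_x f z + poly_germ B z * partial_y f z)).
split; [exact: hol_poly|exact: hol_poly| |].
  have X := germ_ordD ((germ_ord_poly _ _).2 HAB) (germ_ordZ (-1)
    (germ_ordD (germ_ordM (hol_poly A) Tx) (germ_ordM (hol_poly B) Ty))).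
  apply: (germ_ord_ext X) => z.
  rewrite poly_germD poly_germN poly_germD !poly_germM.
  by move: (partial_x f z) (partial_y f z) => p q; ring.
by apply: near_all => z; move: (partial_x f z) (partial_y f z) => p q; ring.
Qed.

(** The second hypothesis and [nakayama] put all germs of order [N] in the Jacobian ideal, after
    which only Taylor polynomials matter. *)
Lemma milnor_poly F N n : codim (locjac F N) n ->
  (forall k : 'I_N.+1, locjac F N.+1 (mon k (N - k))) -> milnor_number (poly_germ F) n.
Proof.
move=> [b [ib sb]] HN.
have loc N' H : local_jacobian (poly_germ F) N' (poly_germ H) <-> locjac F N' H.
  exact: (local_jacobian_poly _ (expands_poly F)).
have small := nakayama (fun k => (loc N.+1 _).2 (HN k)).
exists (fun i => poly_germ (b i)); split=> [i|h [a ha]]; first exact: hol_poly.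
have [c Hc] := sb (trunc a N).
have comb (c' : 'I_n -> C) H z : poly_germ (H - \sum_(i in [set: 'I_n]%SET) c' i *: b i) z =
    poly_germ H z - \sum_i c' i * poly_germ (b i) z.
  by rewrite poly_germD poly_germN poly_germ_sum.
have J : jacobian_ideal (poly_germ F) (fun z => h z - \sum_i c i * poly_germ (b i) z).
  apply: (local_jacobian_ideal small); apply: (local_jacobian_add ((loc _ _).2 Hc)).
  have X : germ_ord N (fun z => h z - poly_germ (trunc a N) z).
    apply: (germ_ord_trunc ha) => i j ij; rewrite cf_trunc.
    by rewrite (leq_ltn_trans (leq_addr j i) ij) (leq_ltn_trans (leq_addl i j) ij).
  by apply: (germ_ord_ext X) => z; rewrite comb; ring.
exists (\row_i c i); split.
  by apply: (jacobian_ideal_near J); apply: near_all => z; congr (_ - _); apply: eq_bigr => i _; rewrite mxE.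
move=> c' J'; apply/rowP => i; rewrite mxE; apply/eqP; rewrite -subr_eq0; apply/eqP.
apply: (ib (fun i => c i - c' 0 i)); last by rewrite finset.in_setT.
apply/(loc N).
have D := jacobian_idealD J' (jacobian_idealM (hol_cst (-1)) J).
apply: jacobian_ideal_local; apply: (jacobian_ideal_near D); apply: near_all => z.
rewrite poly_germ_sum [X in _ = X](_ : _ = \sum_i c i * poly_germ (b i) z - \sum_i c' 0 i * poly_germ (b i) z); first by ring.
by rewrite -sumrB; apply: eq_bigr => k _; rewrite mulrBl.
Qed.

(* The local codimensions modulo the powers of the maximal ideal increase and are
   at most [n], so two consecutive ones agree at some power at most [n]. *)
Lemma milnor_codim f a n N T : expands f a -> milnor_number f n -> (n <= N)%N ->
  (forall i j, (i + j <= N)%N -> cf T i j = a i j) -> codim (locjac T N) n.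
Proof.
move=> fa [b [hb Hb]] nN HT.
have [beta Hbeta] := choice hb.
pose L := N.+2; pose T' := trunc a L.+1; pose B i := trunc (beta i) L.
have loc N' H : (N' <= L)%N -> local_jacobian f N' (poly_germ H) <-> locjac T' N' H.
  move=> NL; apply: (local_jacobian_poly _ fa) => i j ij; rewrite cf_trunc !ltnS.
  by rewrite (leq_trans (leq_trans (leq_addr j i) ij) NL) (leq_trans (leq_trans (leq_addl i j) ij) NL).
have bB i : germ_ord L (fun z => b i z - poly_germ (B i) z).
  apply: (germ_ord_trunc (Hbeta i)) => k l kl; rewrite cf_trunc.
  by rewrite (leq_ltn_trans (leq_addr l k) kl) (leq_ltn_trans (leq_addl k l) kl).
have bBs (c : 'I_n -> C) : germ_ord L (fun z => \sum_i c i * b i z - \sum_i c i * poly_germ (B i) z).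
  apply: (germ_ord_ext (germ_ord_sum (fun i => germ_ordZ (c i) (bB i)))) => z.
  by rewrite -sumrB; apply: eq_bigr => i _; rewrite mulrBr.
have sp N' : (N' <= L)%N -> forall H, in_span (locjac T' N') [set: 'I_n]%SET B H.
  move=> NL H; have [c [Hc _]] := Hb _ (hol_poly H); exists (c 0).
  apply/(loc _ _ NL); apply: (local_jacobian_add (jacobian_ideal_local N' Hc)).
  apply: (germ_ord_ext (germ_ord_leq NL (bBs (c 0)))) => z.
  by rewrite poly_germD poly_germN poly_germ_sum; ring.
have cd N' : (N' <= L)%N -> exists2 m, (m <= n)%N & codim (locjac T' N') m.
  move=> NL; have [m [b' [mn ib sb' _]]] := span_codim (subspace_locid _ _ _) (sp N' NL).
  by exists m; [rewrite cardsT card_ord in mn|exists b'].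
have [N0 N0n HN0] : exists2 N0, (N0 <= n)%N & forall H, locjac T' N0 H -> locjac T' N0.+1 H.
  (* As long as no two consecutive codimensions agree, the [k]-th is at least [k]; at [k = n + 1]
     this contradicts the bound [n]. *)
  have claim k : (k <= n.+1)%N -> (exists2 N0, (N0 < k)%N & forall H, locjac T' N0 H -> locjac T' N0.+1 H)
      \/ exists2 m, (k <= m)%N & codim (locjac T' k) m.
    elim: k => [_|k IH kn]; first by have [m _ Hm] := cd 0%N isT; right; exists m.
    have kL : (k < L)%N by apply: leq_trans kn _; rewrite ltnS (leq_trans nN).
    have [[N0 N0k H]|[m km Hm]] := IH (ltnW kn); first by left; exists N0 => //; exact: ltnW.
    have [m' _ Hm'] := cd k.+1 kL.
    have sub H : locjac T' k.+1 H -> locjac T' k H by apply: locid_leq.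
    have mm := codim_leq (subspace_locid _ _ _) (subspace_locid _ _ _) sub Hm' Hm.
    have [Em|nE] := (m =P m').
      left; exists k => //.
      by rewrite -Em in Hm'; exact: (codim_sub (subspace_locid _ _ _) (subspace_locid _ _ _) sub Hm' Hm).
    by right; exists m' => //; move: km mm nE; clear; lia.
  have [[N0 H1 H2]|[m nm Hm]] := claim n.+1 (leqnn _); first by exists N0.
  have nL : (n.+1 <= L)%N by rewrite /L ltnS (leq_trans nN).
  have [m' mn Hm'] := cd _ nL.
  have := codim_uniq (subspace_locid _ _ _) Hm Hm'; move: nm mn; clear; lia.
have small g : germ_ord N g -> jacobian_ideal f g.
  move=> /(germ_ord_leq (leq_trans N0n nN)); apply: nakayama => k.
  have nL : (N0.+1 <= L)%N by rewrite /L ltnS (leq_trans (leq_trans N0n nN)).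
  apply/(loc _ _ nL); apply: HN0; apply: locid_ord.
  by have := @ordw_mon C 1%N 1%N k (N0 - k); rewrite /wt !muln1 subnKC// -ltnS.
have NL : (N <= L)%N by rewrite /L; clear; lia.
have TT H : locjac T N H <-> locjac T' N H.
  exact: iff_trans (iff_sym (local_jacobian_poly _ fa HT)) (loc _ _ NL).
exists B; split=> [c Hc i _|H]; last by have [c /TT Hc] := sp N NL H; exists c.
move: Hc => /TT/(loc _ _ NL) Hc.
have J : jacobian_ideal f (fun z => \sum_i c i * b i z).
  apply: (local_jacobian_ideal small); apply: (local_jacobian_add Hc).
  by apply: (germ_ord_ext (germ_ord_leq NL (bBs c))) => z; rewrite poly_germ_sum.
have [c0 [_ Hu]] := Hb _ (hol_cst 0).
have E0 : c0 = 0.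
  apply: Hu; have J0 := jacobian_idealM (hol_cst 0) J.
  apply: (jacobian_ideal_near J0); apply: near_all => z.
  by rewrite mul0r big1 ?subr0// => k _; rewrite mxE mul0r.
have E1 : c0 = \row_k (- c k).
  apply: Hu; apply: (jacobian_ideal_near J); apply: near_all => z.
  by rewrite sub0r -sumrN; apply: eq_bigr => k _; rewrite mxE mulNr opprK.
have := congr1 (fun r : 'rV[C]_n => r 0 i) (etrans (esym E1) E0).
by rewrite !mxE => /eqP; rewrite oppr_eq0 => /eqP.
Qed.

End Milnor.

(** * The jump of the Milnor number *)

Section Isolated.
Variable R : realType.
Local Notation C := (complex_field R).
Implicit Types (F G h : bip C) (z : C * C).

Lemma poly_germ_dehomog h x : poly_germ h (x, 1) = (dehomog h).[x].
Proof.
rewrite /poly_germ /dehomog -[X in (map_poly _ _).[X]](hornerC x 1).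
by rewrite -[_.[1] in RHS]/(horner_eval 1 _) horner_map.
Qed.

Lemma poly_germ_homog wx wy n h (x t : C) : homog wx wy n h ->
  poly_germ h (x * t ^+ wx, t ^+ wy) = t ^+ n * poly_germ h (x, 1).
Proof.
move=> Hh; have [b Hb] := cf_bound h; rewrite !(poly_germE _ Hb) -square_sumM.
apply: square_sum_ext => i j; rewrite /term /= expr1n mulr1 exprMn -!exprM.
have [->|/Hh <-] := eqVneq (cf h i j) 0; first by rewrite !mul0r mulr0.
by rewrite /wt exprD [(wx * i)%N]mulnC [(wy * j)%N]mulnC; ring.
Qed.

Definition isolated_zero F := exists d : C, 0 < d /\ forall z, `|z.1| < d -> `|z.2| < d -> z != 0 ->
  ~ (poly_germ (dx F) z = 0 /\ poly_germ (dy F) z = 0).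

Lemma isolated_zeroP F : isolated_singularity (poly_germ F) -> isolated_zero F.
Proof.
move=> [_ _ _ H].
have H' : \forall z \near (0 : C * C), z != 0 -> ~ critical_point (poly_germ F) z by exact: H.
have := partial_x_poly F; have := partial_y_poly F => Hy Hx.
apply/near0P; have N : \forall z \near (0 : C * C), partial_x (poly_germ F) z = poly_germ (dx F) z /\
    partial_y (poly_germ F) z = poly_germ (dy F) z by move: Hx Hy; apply: filterS2.
move: H' N; apply: filterS2 => z Hz [Ex Ey] z0 [zx zy].
by apply: (Hz z0); rewrite /critical_point Ex Ey.
Qed.

(* A common root [x] of the partials in the chart [y = 1] gives the curve
   [(x t^wx, t^wy)] of critical points. *)
Lemma y_in_jac wx wy W F : (0 < wx)%N -> (0 < wy)%N -> homog wx wy W F -> isolated_zero F ->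
  exists M, jac F (mon 0 M).
Proof.
move=> wx0 wy0 HF [d [d0 Hd]].
have Hx := homog_dx HF; have Hy := homog_dy HF.
have cop : coprimep (dehomog (dx F)) (dehomog (dy F)).
  rewrite /coprimep; apply: contraT => nc.
  have /closed_rootP[x rx] := nc.
  rewrite root_gcd in rx; move/andP: rx => [/rootP rx /rootP ry].
  have x1 : 0 < `|x| + 1 by rewrite ltr_wpDl// ltr01.
  (* [t] is at most 1 and so small that the point of the curve stays in the polydisc. *)
  have [t [t0 t1 td]] := common_radius (@ltr01 C) (half_pos (divr_gt0 d0 x1)).
  have tn n : (0 < n)%N -> `|t ^+ n| <= t.
    by move=> n0; rewrite ger0_norm ?exprn_ge0 ?(ltW t0)// ler_iXnr// ltW.
  have td' : t * (`|x| + 1) < d.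
    rewrite -ltr_pdivlMr// (le_lt_trans td)// ltr_pdivrMr// ltr_pMr ?divr_gt0//.
    by rewrite ltr1n.
  exfalso; apply: (Hd (x * t ^+ wx, t ^+ wy)).
  - rewrite normrM; apply: le_lt_trans td'; rewrite mulrC.
    by apply: ler_pM; rewrite ?normr_ge0 ?tn// lerDl.
  - by apply: le_lt_trans td'; apply: le_trans (tn _ wy0) _; rewrite ler_peMr ?(ltW t0)// lerDr.
  - by apply/eqP => -[_ /eqP]; rewrite expf_eq0 wy0 gt_eqF.
  by rewrite (poly_germ_homog _ _ Hx) (poly_germ_homog _ _ Hy) !poly_germ_dehomog rx ry !mulr0.
have [[u v] /= E] := Bezout_eq1_coprimepP _ _ cop.
have H0 : homog wx wy 0 (mon 0 0 : bip C) by exact: (@homog_mon C wx wy 0 0).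
have [|M HM] := homogenize Hx Hy (t1 := u) (t2 := v) wy0 H0; first by rewrite E dehomog_mon expr0.
by exists M; rewrite monM !addn0 in HM.
Qed.

Lemma poly_germ_swapxy h z : poly_germ (swapxy h) z = poly_germ h (swapz z).
Proof.
have [b Hb] := cf_bound h.
have Hb' i j : cf (swapxy h) i j != 0 -> (i < b)%N && (j < b)%N by rewrite cf_swapxy andbC; exact: Hb.
rewrite (poly_germE _ Hb) (poly_germE _ Hb') /square_sum exchange_big.
by apply: eq_bigr => i _; apply: eq_bigr => j _; rewrite /term cf_swapxy /=; ring.
Qed.

Lemma isolated_jac wx wy W F : (0 < wx)%N -> (0 < wy)%N -> homog wx wy W F ->
  isolated_singularity (poly_germ F) -> exists M, jac F (mon M 0) /\ jac F (mon 0 M).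
Proof.
move=> wx0 wy0 HF /isolated_zeroP iso.
have [M yM] := y_in_jac wx0 wy0 HF iso.
have [|M' xM] := y_in_jac wy0 wx0 (swapxy_homog HF).
  have [d [d0 Hd]] := iso; exists d; split=> // z z1 z2 z0 [].
  rewrite -swapxy_dx -swapxy_dy !poly_germ_swapxy => Ex Ey; apply: (Hd (swapz z)) => //.
  by apply: contraNneq z0; case: z {z1 z2 Ex Ey} => a b [-> ->].
have {}xM := swapxy_jac xM; rewrite swapxyK swapxy_mon in xM.
exists (M + M')%N; split.
  by have -> : mon (M + M') 0 = mon M 0 * mon M' 0 :> bip C; [rewrite monM|exact: ideal2M].
by have -> : mon 0 (M + M') = mon 0 M' * mon 0 M :> bip C; [rewrite monM addnC|exact: ideal2M].
Qed.
End Isolated.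

(** * From codimensions to jumps of germs *)

Section Bounds.
Variable R : realType.
Local Notation C := (complex_field R).
Implicit Types (F G h : bip C) (z : C * C).

Lemma small_nonroot (D : {poly C}) (d : C) : D != 0 -> 0 < d -> exists t, [/\ t != 0, `|t| < d & D.[t] != 0].
Proof.
move=> D0 d0; pose s (k : nat) : C := d / k.+2%:R.
have s0 k : 0 < s k by rewrite divr_gt0// ltr0n.
have sd k : `|s k| < d by rewrite gtr0_norm// /s ltr_pdivrMr ?ltr0n// ltr_pMr// ltr1n.
have si : injective s.
  move=> i j /(mulfI (lt0r_neq0 d0))/GRing.invr_inj/eqP; rewrite eqr_nat => /eqP; clear; lia.
have : ~~ all (root D) (map s (iota 0 (size D))).
  apply/negP => H; have := max_poly_roots D0 H; rewrite map_inj_uniq// iota_uniq => /(_ isT).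
  by rewrite size_map size_iota ltnn.
rewrite all_map => /allPn[k _ /= rk]; exists (s k); split=> //; first by rewrite gt_eqF.
Qed.

Lemma germ_sum F G s : linear_deformation (poly_germ F) (poly_germ G) s = poly_germ (F + s *: G).
Proof. by apply/funext => z; rewrite /linear_deformation poly_germD poly_germZ. Qed.

(** Equal codimensions at [N1] and [N1 + 1] mean that the monomials of degree [N1] lie in the ideal
    modulo higher order, as [milnor_poly] requires. *)
Lemma milnor_stable F n N1 : (forall N, (N1 <= N)%N -> codim (locjac F N) n) ->
  milnor_number (poly_germ F) n.
Proof.
move=> H; apply: (@milnor_poly _ F N1); first exact: H.
move=> k; have sub h : locjac F N1.+1 h -> locjac F N1 h by apply: locid_leq.
apply: (codim_sub (subspace_locid _ _ _) (subspace_locid _ _ _) sub (H _ (leqnSn _)) (H _ (leqnn _))).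
apply: locid_ord; have := @ordw_mon C 1%N 1%N k (N1 - k); rewrite /wt !muln1 subnKC//.
by rewrite -ltnS.
Qed.

Lemma has_jump_linear F c : has_jump F c -> is_linear_jump (poly_germ F) c.
Proof.
move=> [G [m [n [N1 [G0 <- H]]]]]; exists (poly_germ G); split.
- exact: hol_poly.
- by rewrite (expands0 (expands_poly G)).
exists (n + c)%N, n; split=> //.
  by apply: (@milnor_stable F _ N1) => N /H[].
apply/near_punctured0P; exists 1; split=> // s s0 _; rewrite germ_sum.
by apply: (@milnor_stable _ _ N1) => N /H[_]; exact.
Qed.

(** [g] is replaced by its Taylor polynomial [G]. If the lowest weight [e] of [G] is below [W], the
    local codimension for [F] plus that part is at least [n] and obeys [local_codim_bound];
    otherwise the Milnor number does not drop, against [j != 0]. *)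
Lemma linear_jump_bound k l px qx d M F g j : (0 < px)%N -> (px <= qx)%N -> coprime px qx ->
  (k <= 1)%N -> (l <= 1)%N ->
  let W := (k * qx + l * px + d * (px * qx))%N in
  (qx + px <= W)%N -> homog qx px W F -> jac F (mon M 0) -> jac F (mon 0 M) ->
  holomorphic_germ g -> g 0 = 0 -> deformation_jump (poly_germ F) g j -> j != 0%N ->
  (maxn 1 (jump_bound k l px qx d) <= j)%N.
Proof.
move=> px0 pq cop k1 l1 W pqW HF xM yM [b gb] g0 [m [n [Hm Hn mnj]]] j0.
have qx0 : (0 < qx)%N by exact: leq_trans pq.
have b0 : b 0%N 0%N = 0 by rewrite -(expands0 gb).
(* The summands [m] and [n] serve [milnor_codim], the next two [higher_terms_leq], and the last one
   [locjac_jac]. *)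
pose N := (m + n + W + 2 * M * (qx + px) + 2 * M)%N.
have cm : codim (jac F) m.
  apply: (codim_eqv (J := locjac F N)) => [h|].
    by apply: (locjac_jac _ xM yM); rewrite /N; clear; lia.
  by apply: (milnor_codim (expands_poly F) Hm) => //; rewrite /N; clear; lia.
pose G : bip C := trunc b N.+1.
have [dl [dl0 Hdl]] := (near_punctured0P _).1 Hn.
have cs s : s != 0 -> `|s| < dl -> codim (locjac (F + s *: G) N) n.
  move=> s0 sd; have := Hdl s s0 sd.
  have E : expands (linear_deformation (poly_germ F) g s) (fun i j => cf F i j + s * b i j).
    exact: (expandsD (expands_poly F) (expandsZ s gb)).
  move=> /(milnor_codim E); apply; first by rewrite /N; clear; lia.
  move=> u v uv; rewrite cfD cfZ cf_trunc !ltnS.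
  by rewrite (leq_trans (leq_addr v u) uv) (leq_trans (leq_addl u v) uv).
have [/existsP[e0 He0]|/existsPn He0] := boolP [exists e : 'I_W, wpart qx px e G != 0].
  have ex : exists e, wpart qx px e G != 0 by exists e0.
  have [e He emin] := ex_minnP ex; have eW : (e < W)%N by apply: leq_ltn_trans (emin _ He0) (ltn_ord _).
  have HG : ordw qx px e G.
    move=> u v uv; have : wpart qx px (wt qx px u v) G == 0.
      by apply: contraTT uv => /emin; rewrite -leqNgt.
    by move=> /eqP/(congr1 (fun h => cf h u v)); rewrite cf_wpart eqxx cf0.
  have e1 : (0 < e)%N.
    rewrite lt0n; apply: contra He => /eqP->; apply/eqP; apply: bipP => u v; rewrite cf_wpart cf0.
    case: eqP => // /eqP; rewrite /wt addn_eq0 !muln_eq0 [qx == _]gtn_eqF// [px == _]gtn_eqF// !orbF.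
    by move=> /andP[/eqP-> /eqP->]; rewrite cf_trunc b0.
  have [m' cm' low] := codim_jac_lower qx0 px0 HF xM yM.
  have cl := low _ _ (@homog_wpart _ qx px e G) eW.
  have [ne _ cne] := codim_sup (subspace_ideal2 _ _) (subspace_locid _ _ N) (@locid_ideal2 _ _ _ N) cl.
  have mm' : m' = m := codim_uniq (subspace_ideal2 _ _) cm' cm.
  have B := local_codim_bound px0 pq cop k1 l1 erefl pqW HF (@homog_wpart _ qx px e G) e1 eW He xM yM cl cne.
  (* The parameter is [s = t^(W-e)], nonzero and small together with [t]. *)
  have D : (n <= ne)%N.
    apply: (lowest_degeneration HF HG eW cne) => D D0.
    have Dn0 : D != 0 by apply: contraNneq D0 => ->; rewrite horner0.
    have [d1 [d10 d11 d1d]] := common_radius (@ltr01 C) dl0.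
    have [t [t0 td Dt]] := small_nonroot Dn0 d10; exists t; split=> //.
    apply: cs; first by rewrite expf_neq0.
    rewrite normrX; apply: le_lt_trans (lt_le_trans td d1d).
    by rewrite ler_iXnr ?subn_gt0// (le_trans (ltW td)).
  rewrite geq_max lt0n j0 /=; move: B D; rewrite mm' mnj; move: (jump_bound _ _ _ _ _) => x; clear; lia.
have HG : ordw qx px W G.
  move=> u v uv; have := He0 (Ordinal uv); rewrite negbK => /eqP/(congr1 (fun h => cf h u v)).
  by rewrite cf_wpart eqxx cf0.
suff : (m <= n)%N by move: j0 mnj; clear; lia.
apply: (@higher_terms_leq C qx px W N M m n F G) => //; try by move: pqW; rewrite /N; clear; lia.
move=> D D0; have Dn0 : D != 0 by apply: contraNneq D0 => ->; rewrite horner0.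
by have [t [t0 td Dt]] := small_nonroot Dn0 dl0; exists t; split=> //; exact: cs.
Qed.
End Bounds.

Theorem theorem5p1 (R : realType) (k l p q : nat)
    (P : {poly {poly complex_field R}})
    (hk : (k <= 1)%N) (hl : (l <= 1)%N) (hpq : (p <= q)%N)
    (hklp : (2 <= k + l + p)%N)
    (hPx : P`_p`_0 = 1) (hPy : P`_0`_q = 1)
    (F : {poly {poly complex_field R}})
    (hF : F = 'X^k * ('X^l)%:P * P)
    (hqh : quasihomogeneous F)
    (hsing : isolated_singularity (poly_germ F)) :
  lambda_lin (poly_germ F) (jump_formula (num_d k l p q) (num_w p q)).
Proof.
have EF : F = mon k l * P by rewrite hF mon.unlock.
have [wx [wy [W [wx0 wy0 _ HF]]]] := hqh.
have [px [qx [d [[px0 pq cop pd] Ep Eq HP]]]] := normal_form hk hl hpq hklp hPx hPy EF wx0 wy0 HF.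
subst p q.
have qx0 : (0 < qx)%N by exact: leq_trans pq.
have HF' : homog qx px (k * qx + l * px + d * (px * qx)) F.
  by rewrite EF; apply: homogM => //; exact: homog_mon.
have [M [xM yM]] := isolated_jac qx0 px0 HF' hsing.
(* This makes [W + e - qx - px] in [local_codim_bound] a true difference. *)
have pqW : (qx + px <= k * qx + l * px + d * (px * qx))%N.
  have [p1|p1] := leqP px 1.
    have E : px = 1%N by apply/eqP; rewrite eqn_leq p1.
    move: hklp hk hl qx0; rewrite E !mul1n muln1; clear.
    by case: k => [|[|k]]//; case: l => [|[|l]]//; nia.
  have p2 : (2 * qx <= px * qx)%N by rewrite leq_mul2r p1 orbT.
  apply: (@leq_trans (d * (px * qx)) _ _ _ (leq_addl _ _)).
  apply: (@leq_trans (px * qx)); last by rewrite leq_pmull// pd.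
  by apply: leq_trans p2; rewrite mul2n -addnn leq_add2l.
rewrite (jump_formulaE px0 pq cop pd hk hl hklp); split.
- by rewrite -lt0n leq_max.
- by apply: has_jump_linear; exact: (jump_exists px0 pq cop pd hk hl hklp HP hPx hPy EF xM yM).
by move=> j [g [hg g0 Hj]] j0; exact: (linear_jump_bound px0 pq cop hk hl pqW HF' xM yM hg g0 Hj j0).
Qed.
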